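(* Let $u_0\in\mathcal{V}_1(\mathbb{R})$. The Cauchy problem with initial data $u(0,\cdot)=u_0$ for the Camassa-Holm equation $u_t-u_{txx}+3uu_x-uu_{xxx}-2u_xu_{xx}=0$, understood in its equivalent form $$u_t+uu_x=-\partial_x(1-\partial_x^2)^{-1}\left(u^2+\tfrac12 u_x^2\right),\qquad(\ast)$$ is equivalent to the system $$\frac{d\eta}{dt}=U,\qquad \frac{dU}{dt}=-\mathcal{L}_\eta\left(U^2+\frac{U_x^2}{2\eta_x^2}\right),\qquad \eta(0,\cdot)=\mathrm{Id},\quad U(0,\cdot)=u_0,\qquad(\ast\ast)$$ for a curve $(\eta(t),U(t))$ in $T\mathcal{D}(\mathbb{R})=\mathcal{D}(\mathbb{R})\times\mathcal{V}_1(\mathbb{R})$, in the sense that solutions correspond via $\eta_t(t,x)=u(t,\eta(t,x))$, $\eta(0,x)=x$, $U=u\circ\eta$, and conversely $u=U\circ\eta^{-1}$ (composition in the space variable; $u$ ranges over functions in $C([0,T);\mathcal{V}_1(\mathbb{R}))\cap C^1([0,T)\times\mathbb{R})$ and $(\eta,U)$ over $C^1$ curves in $\mathcal{D}(\mathbb{R})\times\mathcal{V}_1(\mathbb{R})$). Moreover: (1) the right-hand side $(\eta,U)\mapsto\left(U,\,-\mathcal{L}_\eta\left(U^2+\frac{U_x^2}{2\eta_x^2}\right)\right)$ of $(\ast\ast)$ is a $C^1$ vector field on $T\mathcal{D}(\mathbb{R})$, that is, a $C^1$ map from $\mathcal{D}(\mathbb{R})\times\mathcal{V}_1(\mathbb{R})$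 to $\mathcal{V}_1(\mathbb{R})\times\mathcal{V}_1(\mathbb{R})$; (2) the solution curve $(\eta,U)$ of $(\ast\ast)$ exists on $[0,T)$ for some $T>0$; (3) defining $u(t,\cdot)=U(t,\cdot)\circ\eta(t,\cdot)^{-1}$, we obtain a $C^1$ function $u:[0,T)\times\mathbb{R}\to\mathbb{R}$ satisfying the Camassa-Holm equation in the form $(\ast)$ with $u(0,\cdot)=u_0$; (4) $u$ depends continuously on $u_0$: for every $u_0\in\mathcal{V}_1(\mathbb{R})$ there are $T>0$ and a neighborhood $N$ of $u_0$ in $\mathcal{V}_1(\mathbb{R})$ such that for every $v_0\in N$ the solution $(\eta,U)$ of $(\ast\ast)$ with initial data $(\mathrm{Id},v_0)$ exists on $[0,T)$, and for each $t\in[0,T)$ the map $N\to\mathcal{V}_1(\mathbb{R})$, $v_0\mapsto U(t)\circ\eta(t)^{-1}$, is continuous.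
   Context: $\mathcal{V}_1(\mathbb{R})$ is the set of $C^1$ functions $u:\mathbb{R}\to\mathbb{R}$ with $u'$ bounded, $\int_{\mathbb{R}}|u|^2dx<\infty$, $\int_{\mathbb{R}}|u'|^2dx<\infty$ and $\lim_{|x|\to\infty}u'(x)=0$; it is a Banach space with norm $\|u\|_{1,1}=\sup|u|+\sup|u'|+\left(\int_{\mathbb{R}}u^2dx+\int_{\mathbb{R}}(u')^2dx\right)^{1/2}$. $\mathcal{D}(\mathbb{R})$ is the set of $C^1$ maps $\eta:\mathbb{R}\to\mathbb{R}$ such that $a\le\eta'(x)\le b$ on $\mathbb{R}$ for some $0<a<b$ (depending on $\eta$), $\int_{\mathbb{R}}|\eta(x)-x|^2dx<\infty$, $\int_{\mathbb{R}}|\eta'(x)-1|^2dx<\infty$ and $\lim_{|x|\to\infty}\eta'(x)=1$. Its topology is given by the distance $D(\eta,\xi)=\|\eta-\xi\|_{1,1}$. The map $\eta\mapsto\eta-\mathrm{Id}$ is a bijection of $\mathcal{D}(\mathbb{R})$ onto the open convex subset $\{v\in\mathcal{V}_1(\mathbb{R}):\min v'>-1\}$ (for $v\in\mathcal{V}_1(\mathbb{R})$ near whose infimum is at most $0$ the condition reads $\inf v'>-1$), and this single chart makes $\mathcal{D}(\mathbb{R})$ a Banach manifold with tangent bundle $T\mathcal{D}(\mathbb{R})=\mathcal{D}(\mathbb{R})\times\mathcal{V}_1(\mathbb{R})$. $\mathcal{V}_0(\mathbb{R})$ is the set of continuous functions on $\mathbb{R}$ tending to $0$ as $|x|\to\infty$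 with $\int_{\mathbb{R}}|u|^2dx<\infty$, with norm $\|u\|_{L^\infty}+\|u\|_{L^2}$. For a bounded continuous function $g$, $((1-\partial_x^2)^{-1}g)(x)=\frac12\int_{\mathbb{R}}e^{-|x-y|}g(y)\,dy$. Put $\mathcal{L}=\partial_x(1-\partial_x^2)^{-1}$ and, for $\eta\in\mathcal{D}(\mathbb{R})$ and $\phi\in\mathcal{V}_0(\mathbb{R})$, $\mathcal{L}_\eta(\phi)=\mathcal{L}(\phi\circ\eta^{-1})\circ\eta$. *)

(* Defs.v *)
From HB Require Import structures.
From mathcomp Require Import all_boot all_order all_algebra.
From mathcomp Require Import all_classical all_reals all_analysis.
From mathcomp Require Import measurable_realfun.
From mathcomp Require Import ring lra.

Set Implicit Arguments.
Unset Strict Implicit.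
Unset Printing Implicit Defensive.

Import Order.TTheory GRing.Theory Num.Theory.
Import numFieldNormedType.Exports.

Local Open Scope classical_set_scope.
Local Open Scope ring_scope.

Record is_V1 (R : realType) (u : R -> R) : Prop := IsV1 {
  is_V1_derivable : forall x, derivable u x 1 ;
  is_V1_continuous : continuous (derive1 u) ;
  is_V1_bounded : exists M, forall x, `|derive1 u x| <= M ;
  is_V1_L2 :
    (@lebesgue_measure R).-integrable setT (EFin \o (fun x => u x ^+ 2)) ;
  is_V1_L2' :
    (@lebesgue_measure R).-integrable setT
      (EFin \o (fun x => derive1 u x ^+ 2)) ;
  is_V1_cvgy : derive1 u x @[x --> +oo] --> (0 : R) ;
  is_V1_cvgNy : derive1 u x @[x --> -oo] --> (0 : R) }.

Definition V1_pred (R : realType) : {pred R -> R} := mem [set u | is_V1 u].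

Structure V1 (R : realType) := MkV1 {
  V1_fun :> R -> R ;
  _ : V1_fun \in @V1_pred R }.

HB.instance Definition _ (R : realType) := [isSub of V1 R for @V1_fun R].
HB.instance Definition _ (R : realType) := [Choice of V1 R by <:].

Lemma V1P (R : realType) (u : V1 R) : is_V1 u.
Proof. by case: u => u /= /set_mem. Qed.

Section closure.
Variable R : realType.
Implicit Types (u v : R -> R) (a : R).
Local Notation mu := (@lebesgue_measure R).

Lemma derive1_lin a u v : (forall x, derivable u x 1) ->
  (forall x, derivable v x 1) ->
  derive1 (a *: u + v) = a *: derive1 u + derive1 v.
Proof.
move=> du dv; apply/funext => x.
rewrite derive1E (deriveD (derivableZ (du x)) (dv x)).
by rewrite (deriveZ _ (du x)) -!derive1E.
Qed.

Lemma L2_lin a u v : continuous u -> continuous v ->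
  mu.-integrable setT (EFin \o (fun x => u x ^+ 2)) ->
  mu.-integrable setT (EFin \o (fun x => v x ^+ 2)) ->
  mu.-integrable setT (EFin \o (fun x => (a *: u + v) x ^+ 2)).
Proof.
move=> cu cv iu iv.
apply: (@le_integrable _ _ _ mu _ _ _
  (EFin \o (fun x => 2 * a ^+ 2 * u x ^+ 2 + 2 * v x ^+ 2))) => //.
- apply/measurable_EFinP; apply: measurable_funX.
  apply: continuous_measurable_fun => x.
  apply: continuousD; last exact: cv.
  by apply: continuousZl_tmp; exact: cu.
- move=> x _ /=; rewrite lee_fin -[(a *: u + v) x]/(a * u x + v x).
  have h : 0 <= 2 * a ^+ 2 * u x ^+ 2 + 2 * v x ^+ 2.
    by have := sqr_ge0 (a * u x); have := sqr_ge0 (v x); lra.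
  rewrite (ger0_norm h) ger0_norm ?sqr_ge0//.
  by have := sqr_ge0 (a * u x - v x); lra.
- rewrite (_ : _ \o _ = (fun x => (2 * a ^+ 2)%:E * (u x ^+ 2)%:E
    + 2%:E * (v x ^+ 2)%:E)%E)//.
  by apply: integrableD => //; apply: integrableZl.
Qed.

Lemma is_V1_cont u : is_V1 u -> continuous u.
Proof.
by move=> [du _ _ _ _ _ _] x; apply/differentiable_continuous/derivable1_diffP.
Qed.

Lemma is_V1_lin a u v : is_V1 u -> is_V1 v -> is_V1 (a *: u + v).
Proof.
move=> U V; have := is_V1_cont U; have := is_V1_cont V.
case: U V => [du cu [M bu] iu iu' uy uNy] [dv cv [N bv] iv iv' vy vNy] cv0 cu0.
split.
- by move=> x; apply: derivableD => //; apply: derivableZ.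
- rewrite derive1_lin// => x; apply: continuousD; last exact: cv.
  by apply: continuousZl_tmp; exact: cu.
- exists (`|a| * M + N) => x; rewrite derive1_lin//.
  by rewrite (le_trans (ler_normD _ _))// lerD// normrM ler_wpM2l.
- exact: L2_lin.
- by rewrite derive1_lin//; exact: L2_lin.
- rewrite derive1_lin//; have := cvgD (cvgMl_tmp (a := a) uy) vy.
  by rewrite mulr0 addr0; exact.
- rewrite derive1_lin//; have := cvgD (cvgMl_tmp (a := a) uNy) vNy.
  by rewrite mulr0 addr0; exact.
Qed.

Lemma is_V1_0 : is_V1 (0 : R -> R).
Proof.
have d0 : derive1 (0 : R -> R) = 0.
  by apply/funext => x; rewrite -[0]/(cst 0) derive1_cst.
split; rewrite ?d0.
- by move=> x; exact: derivable_cst.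
- by move=> x; exact: cvg_cst.
- by exists 0 => x; rewrite normr0.
- rewrite (_ : _ \o _ = cst 0%E); first exact: integrable0.
  by apply/funext => x /=; rewrite expr0n.
- rewrite (_ : _ \o _ = cst 0%E); first exact: integrable0.
  by apply/funext => x /=; rewrite expr0n.
- exact: cvg_cst.
- exact: cvg_cst.
Qed.

Lemma V1_submod_closed : submod_closed (@V1_pred R).
Proof.
split; first by apply/mem_set; exact: is_V1_0.
by move=> a u v /set_mem U /set_mem V; apply/mem_set; exact: is_V1_lin.
Qed.

End closure.

HB.instance Definition _ (R : realType) :=
  GRing.isSubmodClosed.Build R (R -> R) (@V1_pred R) (@V1_submod_closed R).
HB.instance Definition _ (R : realType) :=
  [SubChoice_isSubLmodule of V1 R by <:].

Definition V1_norm (R : realType) (u : V1 R) : R :=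
  sup (range (fun x => `|u x|)) + sup (range (fun x => `|derive1 u x|)) +
  Num.sqrt (\int[@lebesgue_measure R]_x (u x ^+ 2) +
            \int[@lebesgue_measure R]_x (derive1 u x ^+ 2)).

Section norm.
Variable R : realType.
Implicit Types (u v : V1 R) (a : R).
Local Notation mu := (@lebesgue_measure R).
Local Notation J f := (\int[mu]_x (f x ^+ 2)).

Lemma V1_has_ubound u : has_ubound (range (fun x => `|u x|)).
Proof.
have [du cu [M bu] iu iu' _ _] := V1P u.
have cu0 := is_V1_cont (V1P u).
exists (Num.max (2 * M) (1 + 4 * J u)) => _ [x _ <-].
rewrite le_max -implyNb; apply/implyP; rewrite -ltNge => Mx.
have M0 : 0 <= M by rewrite (le_trans _ (bu 0)).
have h y : y \in `[x, x + 1] -> (`|u x| / 2) ^+ 2 <= u y ^+ 2.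
  rewrite in_itv/= => /andP[xy yx].
  have [c _ uc] : exists2 c, c \in `[x, y]%R & u y - u x = derive1 u c * (y - x).
    apply: MVT_segment => //; last exact: continuous_subspaceT.
    by move=> z _; rewrite derive1E; exact/derivableP.
  have b : `|u y - u x| <= M.
    by rewrite uc normrM (le_trans (ler_pM _ _ (bu c) (_ : _ <= 1)))// ?mulr1//
      ger0_norm; lra.
  rewrite -[leRHS]real_normK ?num_real// lerXn2r ?nnegrE ?divr_ge0//.
  have := ler_distD (u y) (u x) 0; rewrite !subr0 distrC; lra.
pose I := `[x, x + 1]%classic; pose k := (`|u x| / 2) ^+ 2.
have i01 : mu I = 1%E.
  by rewrite lebesgue_measure_itv/= lte_fin ltrDl ltr01 -EFinD addrC addKr.
have le : k <= J u.
  rewrite -lee_fin /Rintegral fineK//; last first.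
    exact: (integrable_fin_num _ iu).
  have -> : k%:E = (\int[mu]_(y in I) k%:E)%E.
    rewrite integral_cst/=; last exact: measurable_itv.
    by rewrite [X in (_ * X)%E]i01 mule1.
  have mu2 : measurable_fun setT (fun y => (u y ^+ 2)%:E).
    exact: (measurable_int mu).
  apply: (@le_trans _ _ (\int[mu]_(y in I) (u y ^+ 2)%:E)%E).
    apply: ge0_le_integral.
    - exact: measurable_itv.
    - by move=> y _; rewrite lee_fin sqr_ge0.
    - exact: measurable_cst.
    - exact: measurable_funS mu2.
    - by move=> y /= yx; rewrite lee_fin h.
  apply: ge0_subset_integral => //; first exact: measurable_itv.
  by move=> y _; rewrite lee_fin sqr_ge0.
move: le (sqr_ge0 (`|u x| - 1)) (normr_ge0 (u x)); rewrite /k.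
by move: (`|u x|) (J u) => K L; lra.
Qed.

Lemma V1_has_ubound' u : has_ubound (range (fun x => `|derive1 u x|)).
Proof. by have [_ _ [M bu] _ _ _ _] := V1P u; exists M => _ [x _ <-]. Qed.

Lemma sup_normD (f g : R -> R) :
  has_ubound (range (fun x => `|f x|)) ->
  has_ubound (range (fun x => `|g x|)) ->
  sup (range (fun x => `|f x + g x|)) <=
  sup (range (fun x => `|f x|)) + sup (range (fun x => `|g x|)).
Proof.
move=> uf ug; apply: ge_sup; first by exists `|f 0 + g 0|, 0.
move=> _ [x _ <-]; apply: (le_trans (ler_normD _ _)).
by apply: lerD; apply: ub_le_sup => //; exists x.
Qed.

Lemma sup_normZ a (f : R -> R) : has_ubound (range (fun x => `|f x|)) ->
  sup (range (fun x => `|a * f x|)) = `|a| * sup (range (fun x => `|f x|)).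
Proof.
move=> uf; have le : sup (range (fun x => `|a * f x|)) <=
    `|a| * sup (range (fun x => `|f x|)).
  apply: ge_sup; first by exists `|a * f 0|, 0.
  by move=> _ [x _ <-]; rewrite normrM ler_wpM2l// ub_le_sup//; exists x.
apply/eqP; rewrite eq_le le/=; have [->|a0] := eqVneq a 0.
  rewrite normr0 mul0r (le_trans _ (ub_le_sup _ (_ : _ 0)))//; last first.
    by exists 0; rewrite // mul0r normr0.
  by exists 0 => _ [x _ <-]; rewrite mul0r normr0.
rewrite -ler_pdivlMl ?normr_gt0//; apply: ge_sup; first by exists `|f 0|, 0.
move=> _ [x _ <-]; rewrite ler_pdivlMl ?normr_gt0// -normrM.
apply: ub_le_sup; last by exists x.
have [M fM] := uf; exists (`|a| * M) => _ [y _ <-].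
by rewrite normrM ler_wpM2l// fM//; exists y.
Qed.

Lemma JD (l : R) (f g : R -> R) : 0 < l -> continuous f -> continuous g ->
  mu.-integrable setT (EFin \o (fun x => f x ^+ 2)) ->
  mu.-integrable setT (EFin \o (fun x => g x ^+ 2)) ->
  \int[mu]_x ((f x + g x) ^+ 2) <= (1 + l) * J f + (1 + l^-1) * J g.
Proof.
move=> l0 cf cg jf jg.
have jZ k (h : R -> R) : mu.-integrable setT (EFin \o (fun x => h x ^+ 2)) ->
    mu.-integrable setT (EFin \o (fun x => k * h x ^+ 2)).
  move=> jh; rewrite (_ : _ \o _ = (fun x => k%:E * (h x ^+ 2)%:E)%E)//.
  exact: integrableZl.
rewrite -!RintegralZl//= -RintegralD//=; last 2 first.
  exact: jZ.
  exact: jZ.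
apply: le_Rintegral => //=.
- have := L2_lin 1 cf cg jf jg.
  by under eq_fun do rewrite /= scale1r.
- rewrite (_ : _ \o _ = (fun x => ((1 + l) * f x ^+ 2)%:E +
    ((1 + l^-1) * g x ^+ 2)%:E)%E)//.
  by apply: integrableD => //; exact: jZ.
- move=> x _; rewrite -subr_ge0.
  have -> : (1 + l) * f x ^+ 2 + (1 + l^-1) * g x ^+ 2 - (f x + g x) ^+ 2 =
      l^-1 * (l * f x - g x) ^+ 2 by field; rewrite gt_eqF.
  by rewrite mulr_ge0 ?invr_ge0 ?sqr_ge0 ?ltW.
Qed.

Lemma J_ge0 (f : R -> R) : 0 <= J f.
Proof. by apply: Rintegral_ge0 => x _; exact: sqr_ge0. Qed.

Lemma ler_sqrtD_weighted (b c A : R) : 0 <= b -> 0 <= c ->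
  (forall l, 0 < l -> A <= (1 + l) * b + (1 + l^-1) * c) ->
  Num.sqrt A <= Num.sqrt b + Num.sqrt c.
Proof.
move=> b0 c0 h; pose B := Num.sqrt b; pose C := Num.sqrt c.
have B0 : 0 <= B by exact: sqrtr_ge0.
have C0 : 0 <= C by exact: sqrtr_ge0.
move: h; rewrite -/B -/C -(sqr_sqrtr b0) -(sqr_sqrtr c0) -/B -/C.
move: B C B0 C0 => {b0 c0 b c} B C B0 C0 h.
apply/ler_addgt0Pr => _/posnumP[e].
have [d d0 ->] : exists2 d, 0 < d & B + C + e%:num = (B + d) + (C + d).
  by exists (e%:num / 2); [rewrite divr_gt0|lra].
have Bd : 0 < B + d by lra.
have Cd : 0 < C + d by lra.
rewrite -[leRHS]ger0_norm; last by rewrite addr_ge0// ltW.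
rewrite -sqrtr_sqr ler_wsqrtr//.
apply: (le_trans (h ((C + d) / (B + d)) _)); first by rewrite divr_gt0.
have -> : (1 + (C + d) / (B + d)) * B ^+ 2 +
    (1 + ((C + d) / (B + d))^-1) * C ^+ 2 =
    ((B + d) + (C + d)) * (B ^+ 2 / (B + d) + C ^+ 2 / (C + d)).
  by field; rewrite !gt_eqF.
rewrite expr2; apply: ler_wpM2l; first by rewrite addr_ge0// ltW.
by apply: lerD; rewrite ler_pdivrMr// -expr2; apply: lerXn2r;
  rewrite ?nnegrE//; lra.
Qed.

Lemma V1_normD u v : V1_norm (u + v) <= V1_norm u + V1_norm v.
Proof.
have [du cu _ iu iu' _ _] := V1P u; have [dv cv _ iv iv' _ _] := V1P v.
have cu0 := is_V1_cont (V1P u); have cv0 := is_V1_cont (V1P v).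
have -> : V1_norm (u + v) =
    sup (range (fun x => `|u x + v x|)) +
    sup (range (fun x => `|derive1 u x + derive1 v x|)) +
    Num.sqrt (\int[mu]_x ((u x + v x) ^+ 2) +
            \int[mu]_x ((derive1 u x + derive1 v x) ^+ 2)).
  have := derive1_lin 1 du dv; rewrite !scale1r => d.
  by rewrite /V1_norm -[V1_fun (u + v)]/(V1_fun u + V1_fun v) d.
rewrite /V1_norm [leRHS]addrACA [X in _ <= X + _]addrACA.
apply: lerD; first apply: lerD.
- exact: sup_normD (V1_has_ubound u) (V1_has_ubound v).
- exact: sup_normD (V1_has_ubound' u) (V1_has_ubound' v).
- apply: ler_sqrtD_weighted => [||l l0].
  + exact: addr_ge0 (J_ge0 _) (J_ge0 _).
  + exact: addr_ge0 (J_ge0 _) (J_ge0 _).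
  + apply: (le_trans (lerD (JD l0 cu0 cv0 iu iv) (JD l0 cu cv iu' iv'))).
    by rewrite addrACA !mulrDr.
Qed.

Lemma V1_normZ a u : V1_norm (a *: u) = `|a| * V1_norm u.
Proof.
have [du cu _ iu iu' _ _] := V1P u.
have d : derive1 (a *: (u : R -> R)) = a *: derive1 u.
  by apply/funext => x; rewrite derive1E deriveZ// -derive1E.
have JZ (f : R -> R) : mu.-integrable setT (EFin \o (fun x => f x ^+ 2)) ->
    J (a *: f) = a ^+ 2 * J f.
  move=> jf; rewrite -RintegralZl//; apply: eq_Rintegral => x _.
  by rewrite -exprMn.
rewrite /V1_norm -[V1_fun (a *: u)]/(a *: V1_fun u) d JZ// JZ//.
rewrite -mulrDr sqrtrM ?sqr_ge0// sqrtr_sqr.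
rewrite (sup_normZ a (V1_has_ubound u)) (sup_normZ a (V1_has_ubound' u)).
by rewrite !mulrDr.
Qed.

Lemma V1_norm0_eq0 u : V1_norm u = 0 -> u = 0.
Proof.
move=> u0; apply/val_inj/funext => x /=; apply/eqP.
rewrite -normr_le0 -[leRHS]u0.
apply: (@le_trans _ _ (sup (range (fun x => `|u x|)))).
  by apply: ub_le_sup; [exact: V1_has_ubound|exists x].
rewrite /V1_norm -addrA lerDl addr_ge0 ?sqrtr_ge0//.
rewrite (le_trans (normr_ge0 (derive1 u 0)))// ub_le_sup//.
  exact: V1_has_ubound'.
Qed.

End norm.

HB.instance Definition _ (R : realType) :=
  Lmodule_isNormed.Build R (V1 R)
    (@V1_normD R) (@V1_normZ R) (@V1_norm0_eq0 R).


Record is_D (R : realType) (eta : R -> R) : Prop := IsD {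
  is_D_derivable : forall x, derivable eta x 1 ;
  is_D_continuous : continuous (derive1 eta) ;
  is_D_bounds : exists a b, [/\ 0 < a, a < b &
    forall x, a <= derive1 eta x <= b] ;
  is_D_L2 :
    (@lebesgue_measure R).-integrable setT
      (EFin \o (fun x => (eta x - x) ^+ 2)) ;
  is_D_L2' :
    (@lebesgue_measure R).-integrable setT
      (EFin \o (fun x => (derive1 eta x - 1) ^+ 2)) ;
  is_D_cvgy : derive1 eta x @[x --> +oo] --> (1 : R) ;
  is_D_cvgNy : derive1 eta x @[x --> -oo] --> (1 : R) }.

Structure D (R : realType) := MkD {
  D_fun :> R -> R ;
  D_funP : is_D D_fun }.

Lemma derive1_subid (R : realType) (eta : R -> R) x : derivable eta x 1 ->
  derivable (fun x => eta x - x) x 1 /\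
  derive1 (fun x => eta x - x) x = derive1 eta x - 1.
Proof.
move=> d; have did : derivable (id : R -> R) x 1 by exact: derivable_id.
split; first exact: derivableB d did.
by rewrite derive1E (deriveB d did) derive_id -derive1E.
Qed.

Lemma D_chart_subproof (R : realType) (eta : D R) :
  (fun x => eta x - x) \in @V1_pred R.
Proof.
apply/mem_set; have [d c [a [b [a0 ab h]]] i i' cy cNy] := D_funP eta.
have E : derive1 (fun x => eta x - x) = fun x => derive1 eta x - 1.
  by apply/funext => x; have [] := derive1_subid (d x).
split; rewrite ?E.
- by move=> x; have [] := derive1_subid (d x).
- by move=> x; apply: continuousB; [exact: c|exact: cvg_cst].
- exists (b + 1) => x; have /andP[h1 h2] := h x.
  by rewrite ler_norml; apply/andP; split; lra.
- exact: i.
- exact: i'.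
- by have := cvgB cy (cvg_cst (1 : R)); rewrite subrr; exact.
- by have := cvgB cNy (cvg_cst (1 : R)); rewrite subrr; exact.
Qed.

(* The global chart [eta |-> eta - Id] of D(R); the distance on D(R) is the
   norm of the difference of the chart images. *)
Definition D_chart (R : realType) (eta : D R) : V1 R :=
  MkV1 (D_chart_subproof eta).

Definition D_chart_domain (R : realType) : set (V1 R) :=
  [set v | -1 < inf (range (derive1 v))].

Lemma range_D_chart (R : realType) :
  range (@D_chart R) = @D_chart_domain R.
Proof.
apply/seteqP; split=> [_ [eta _ <-]|v /= v1].
  have [d c [a [b [a0 ab h]]] i i' cy cNy] := D_funP eta.
  rewrite /D_chart_domain/=.
  have le : a - 1 <= inf (range (derive1 (D_chart eta))).
    apply: lb_le_inf; first by exists (derive1 (D_chart eta) 0), 0.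
    move=> _ [x _ <-]; have [_ ->] := derive1_subid (d x).
    by have /andP[ax _] := h x; rewrite lerB.
  by apply: lt_le_trans le; lra.
have [d c [M bM] i i' cy cNy] := V1P v.
have lb x : inf (range (derive1 v)) <= derive1 v x.
  apply: ge_inf; last by exists x.
  exists (- M) => _ [y _ <-].
  by have := bM y; rewrite ler_norml => /andP[].
pose eta x := v x + x.
have dE x : derivable eta x 1 by apply: derivableD.
have E x : derive1 eta x = derive1 v x + 1.
  by rewrite derive1E (deriveD (d x))// derive_id -derive1E.
have etaD : is_D eta.
  split.
  - exact: dE.
  - rewrite (_ : derive1 eta = fun x => derive1 v x + 1); last exact/funext.
    by move=> x; apply: continuousD; [exact: c|exact: cvg_cst].
  - exists (1 + inf (range (derive1 v))), (M + 2); split.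
    + by move: v1; rewrite /D_chart_domain/=; lra.
    + have := lb 0; have := bM 0; rewrite ler_norml => /andP[]; lra.
    + move=> x; rewrite E; have := lb x.
      have := bM x; rewrite ler_norml => /andP[] ? ? ?.
      by apply/andP; split; lra.
  - by under eq_fun do rewrite /eta addrK.
  - by under eq_fun do rewrite E addrK.
  - under eq_fun do rewrite E.
    by have := cvgD cy (cvg_cst (1 : R)); rewrite add0r; exact.
  - under eq_fun do rewrite E.
    by have := cvgD cNy (cvg_cst (1 : R)); rewrite add0r; exact.
exists (MkD etaD) => //; apply/val_inj/funext => x /=.
by rewrite /eta addrK.
Qed.

(* [D_bij], [D_invK] and [D_Kinv] below show that this is the two-sided
   inverse of [eta]. *)
Definition D_inv (R : realType) (eta : D R) : R -> R := pinv setT eta.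

Lemma D_bij (R : realType) (eta : D R) : set_bij setT setT eta.
Proof.
have [d c [a [b [a0 ab h]]] i i' cy cNy] := D_funP eta.
have ceta : continuous eta.
  by move=> x; apply/differentiable_continuous/derivable1_diffP.
have lip x y : x <= y -> a * (y - x) <= eta y - eta x.
  move=> xy.
  have [z _ ->] : exists2 z, z \in `[x, y]%R &
      eta y - eta x = derive1 eta z * (y - x).
    apply: MVT_segment => //; last exact: continuous_subspaceT.
    by move=> z _; rewrite derive1E; exact/derivableP.
  by rewrite ler_wpM2r ?subr_ge0//; have /andP[] := h z.
split => //.
- move=> x y _ _ exy; apply/eqP; rewrite eq_le.
  apply/andP; split; rewrite leNgt; apply/negP => xy; have := lip _ _ (ltW xy);
    rewrite exy subrr pmulr_rle0//; lra.
- move=> y _; pose r := `|y - eta 0| / a.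
  have r0 : 0 <= r by rewrite divr_ge0// ltW.
  have ar : a * r = `|y - eta 0| by rewrite /r mulrC divfK// gt_eqF.
  have h1 := lip _ _ r0.
  have h2 : a * (0 - - r) <= eta 0 - eta (- r) by apply: lip; rewrite oppr_le0.
  move: h1 h2; rewrite sub0r opprK subr0 ar => h1 h2.
  have : y <= eta 0 + `|y - eta 0| by rewrite addrC -lerBlDr ler_norm.
  have : eta 0 - `|y - eta 0| <= y by rewrite lerBlDr -lerBlDl distrC ler_norm.
  move=> h3 h4.
  have [z _ zy] : exists2 z, z \in `[(- r), r]%R & eta z = y.
    apply: IVT; [by rewrite ge0_cp|exact: continuous_subspaceT|].
    by rewrite ge_min le_max; apply/andP; split; apply/orP; [left|right]; lra.
  by exists z.
Qed.

Lemma D_invK (R : realType) (eta : D R) : cancel (D_inv eta) eta.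
Proof.
move=> y; apply: pinvK; have [_ _ /(_ y I)[x _ <-]] := D_bij eta.
by apply/mem_set; exists x.
Qed.

Lemma D_Kinv (R : realType) (eta : D R) : cancel eta (D_inv eta).
Proof. by move=> x; apply: pinvKV; [have [] := D_bij eta|exact/mem_set]. Qed.

Section camassa_holm.
Variable R : realType.

(* (1 - d^2/dx^2)^-1 g, for [g] bounded and continuous. *)
Definition helmholtz_inv (g : R -> R) (x : R) : R :=
  2^-1 * \int[@lebesgue_measure R]_y (expR (- `|x - y|) * g y).

(* [helmholtz_inv g] is differentiable everywhere when [g] is bounded and
   continuous, so [derive1] takes no default value there. *)
Definition Lop (g : R -> R) : R -> R := derive1 (helmholtz_inv g).

Definition Lconj (eta : D R) (phi : R -> R) : R -> R :=
  Lop (phi \o D_inv eta) \o eta.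

Definition source (eta : D R) (U : V1 R) (x : R) : R :=
  U x ^+ 2 + derive1 U x ^+ 2 / (2 * derive1 eta x ^+ 2).

(* The interval [0, T), where [T] may be +oo. *)
Definition itv0 (T : \bar R) : set R := [set t | 0 <= t /\ (t%:E < T)%E].

(* Derivative relative to [A]: one-sided at an end point of an interval. *)
Definition is_derive_within (W : normedModType R) (A : set R) (g : R -> W)
    (t : R) (l : W) : Prop :=
  (s - t)^-1 *: (g s - g t) @[s --> within A (dnbhs t)] --> l.

Definition C1_curve (W : normedModType R) (A : set R) (g dg : R -> W) : Prop :=
  (forall t, A t -> is_derive_within A g t (dg t)) /\
  {within A, continuous dg}.

(* Frechet C^1 on an open set [A]; the differential is continuous for the
   operator norm. *)
Definition C1_on (V W : normedModType R) (A : set V) (F : V -> W) : Prop :=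
  (forall p, A p -> differentiable F p) /\
  (forall p, A p -> forall e : R, 0 < e ->
    \forall q \near within A (nbhs p),
      forall h, `|'d F q h - 'd F p h| <= e * `|h|).

(* C^1 maps on D(R) * V1(R), read in the chart [D_chart]; the values of [F]
   off the open set [D_chart_domain `*` setT] are irrelevant. *)
Definition C1_TD (W : normedModType R) (X : D R * V1 R -> W) : Prop :=
  exists2 F : V1 R * V1 R -> W,
    (forall eta U, F (D_chart eta, U) = X (eta, U)) &
    C1_on (D_chart_domain (R := R) `*` setT) F.

(* [dU] is the derivative of the curve [U] in V1(R); the first clause says
   that (eta, U) is a C^1 curve in D(R) * V1(R) with velocity (U, dU). *)
Definition system_solution (T : \bar R) (u0 : V1 R)
    (eta : R -> D R) (U : R -> V1 R) : Prop :=
  exists dU : R -> V1 R,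
    [/\ C1_curve (itv0 T) (fun t => (D_chart (eta t), U t))
                          (fun t => (U t, dU t)),
        forall t, itv0 T t ->
          dU t = - Lconj (eta t) (source (eta t) (U t)) :> (R -> R),
        eta 0 = id :> (R -> R) & U 0 = u0].

(* [u] is C^1 on [A * R], with partial derivatives [ut] and [ux]. *)
Definition C1_strip (A : set R) (u ut ux : R -> R -> R) : Prop :=
  [/\ forall t x, A t -> is_derive_within A (u^~ x) t (ut t x),
      forall t (x : R), A t -> is_derive x 1 (u t) (ux t x),
      {within A `*` setT, continuous (fun p : R * R => ut p.1 p.2)} &
      {within A `*` setT, continuous (fun p : R * R => ux p.1 p.2)}].

Definition CH_solution (T : \bar R) (u0 : V1 R) (u : R -> R -> R) : Prop :=
  exists ut ux : R -> R -> R,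
    [/\ C1_strip (itv0 T) u ut ux,
        forall t x, itv0 T t ->
          ut t x + u t x * ux t x =
          - Lop (fun y => u t y ^+ 2 + 2^-1 * ux t y ^+ 2) x &
        u 0 = u0].

Definition corresponds (T : \bar R) (u : R -> V1 R)
    (eta : R -> D R) (U : R -> V1 R) : Prop :=
  [/\ forall t x, itv0 T t ->
        is_derive_within (itv0 T) (fun s => eta s x) t (u t (eta t x)),
      eta 0 = id :> (R -> R),
      forall t, itv0 T t -> U t = u t \o eta t :> (R -> R) &
      forall t, itv0 T t -> u t = U t \o D_inv (eta t) :> (R -> R)].

End camassa_holm.

(* Main.v *)
Require Import Defs.
From HB Require Import structures.
From mathcomp Require Import all_boot all_order all_algebra.
From mathcomp Require Import all_classical all_reals all_analysis.
From mathcomp Require Import measurable_realfun ring lra.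

(** The equation loses a derivative, because of the term [u u_x], but in the
  variables [eta] and [U = u o eta] that term disappears, and what is left is an
  ordinary differential equation with a C^1 right-hand side in a Banach space.

  Regularity of the field. In the chart [v = eta - Id] the second component of the
  field is
    [1/2 (e^-v Km(e^v q) - e^v Kp(e^-v q))],
    [q = U^2 (1 + v') + U'^2 / (2 (1 + v'))],
  where [Km] and [Kp] are the integrals against [e^-|x - z|] over the left and the
  right of [x] ([force_fun], [force_Lconj]). The diffeomorphism no longer enters
  through a composition, which would not be differentiable in [eta], but through
  products, exponentials and an inverse, and the linear operators [Km] and [Kp] are
  fixed. Since [U^2] and [U'^2] are integrable, so is [q]; the kernels gain a
  derivative; so the formula is a composite of bounded multilinear maps and of
  superposition operators, and it is C^1, with a locally Lipschitz differential
  ([C11_density], [C11_force], [field_C1], [field_spec]). The two kernels are only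
  used through the equations [y' = f - y] and [y' = y - f], whose bounded
  solutions are unique.

  Existence, uniqueness and dependence. V1 is complete ([V1_geo_complete]), and the
  force is locally Lipschitz ([force_local]); Euler polygons and Gronwall's
  inequality give a solution on an interval that serves all nearby data, and the
  Lipschitz dependence on the datum ([ode_exists], [local_flow],
  [flow_curve_unique]). The map [(eta, U) |-> U o eta^-1] is continuous, though not
  locally Lipschitz ([comp_inv_cont]), so that [u] is continuous in [u0]
  ([dependence]).

  Equivalence. From [(eta, U)] to [u], the relation [u(t, eta(t, x)) = U(t, x)] is
  differentiated in time with slopes taken along the trajectories; this gives
  [u_t + u u_x] as the force transported by [eta^-1], a continuous function
  ([eulerian_of_lagrangian]). From [u] to [(eta, U)], each particle solves a scalar
  equation; the flow is a C^1 diffeomorphism in [x] ([flow_diffeo]). That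
  [eta - Id] and [U] are C^1 curves in V1, and not only at each [x], holds because
  their pointwise derivatives [u o eta] and the force are continuous curves in
  V1, whose primitives in V1 exist by completeness and agree with them at each [x]
  ([flow_chart], [lagrangian_of_eulerian]). *)

Import Order.TTheory GRing.Theory Num.Theory.
Import numFieldNormedType.Exports.
Local Open Scope classical_set_scope.
Local Open Scope ring_scope.

Set Implicit Arguments.
Unset Strict Implicit.
Unset Printing Implicit Defensive.

(** * Linear identities in modules *)

Section module_identities.
Variables (R : comRingType) (W : lmodType R).

(** Identities between linear combinations in a module are proved by reflection:
  both sides are read as formal combinations of atoms, and it is enough that each
  atom has the same coefficient on both sides, an identity in the ring of scalars. *)
Inductive mexp :=
  MVar of nat | MZero | MAdd of mexp & mexp | MOpp of mexp | MScale of R & mexp.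

Fixpoint meval (env : seq W) e : W :=
  match e with
  | MVar i => env`_i
  | MZero => 0
  | MAdd a b => meval env a + meval env b
  | MOpp a => - meval env a
  | MScale c a => c *: meval env a
  end.

Fixpoint mcoef e (j : nat) : R :=
  match e with
  | MVar i => if i == j then 1 else 0
  | MZero => 0
  | MAdd a b => mcoef a j + mcoef b j
  | MOpp a => - mcoef a j
  | MScale c a => c * mcoef a j
  end.

Lemma mevalE env e : meval env e = \sum_(j < size env) mcoef e j *: env`_j.
Proof.
elim: e => [i||a IHa b IHb|a IHa|c a IHa] /=.
- have [ls|ls] := ltnP i (size env).
    rewrite (bigD1 (Ordinal ls))//= eqxx scale1r big1 ?addr0// => j.
    rewrite -val_eqE/= => /negbTE ji; rewrite eq_sym ji scale0r; done.
  rewrite nth_default// big1// => j _; rewrite ifN ?scale0r//.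
  by apply: contraTN ls => /eqP ->; rewrite -ltnNge.
- by rewrite big1// => j _; rewrite scale0r.
- by rewrite IHa IHb -big_split/=; apply: eq_bigr => j _; rewrite scalerDl.
- by rewrite IHa -sumrN; apply: eq_bigr => j _; rewrite scaleNr.
- by rewrite IHa scaler_sumr; apply: eq_bigr => j _; rewrite scalerA.
Qed.

(** Bounded quantification that computes to a conjunction. *)
Fixpoint mall (n : nat) (P : nat -> Prop) : Prop :=
  if n is m.+1 then P m /\ mall m P else True.

Lemma mallP n P : mall n P -> forall j, (j < n)%N -> P j.
Proof.
elim: n => //= n IH [Pn /IH h] j; rewrite ltnS leq_eqVlt => /predU1P[->//|].
exact: h.
Qed.

Lemma meval_eq env e f : mall (size env) (fun j => mcoef e j = mcoef f j) ->
  meval env e = meval env f.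
Proof.
by move=> /mallP h; rewrite !mevalE; apply: eq_bigr => j _; rewrite h.
Qed.

End module_identities.

Ltac madd x env :=
  lazymatch env with
  | context [x :: _] => env
  | _ => constr:(x :: env)
  end.
Ltac menv t env :=
  lazymatch t with
  | @GRing.add _ ?a ?b => let env' := menv a env in menv b env'
  | @Algebra.add _ ?a ?b => let env' := menv a env in menv b env'
  | @GRing.opp _ ?a => menv a env
  | @Algebra.opp _ ?a => menv a env
  | @GRing.scale _ _ _ ?a => menv a env
  | @GRing.zero _ => env
  | @Algebra.zero _ => env
  | _ => madd t env
  end.
Ltac mindex x env :=
  lazymatch env with
  | x :: _ => constr:(0%N)
  | _ :: ?env' => let n := mindex x env' in constr:(n.+1)
  end.
Ltac mreify R t env :=
  lazymatch t with
  | @GRing.add _ ?a ?b =>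
    let a' := mreify R a env in let b' := mreify R b env in
    constr:(@MAdd R a' b')
  | @Algebra.add _ ?a ?b =>
    let a' := mreify R a env in let b' := mreify R b env in
    constr:(@MAdd R a' b')
  | @GRing.opp _ ?a => let a' := mreify R a env in constr:(@MOpp R a')
  | @Algebra.opp _ ?a => let a' := mreify R a env in constr:(@MOpp R a')
  | @GRing.scale _ _ ?c ?a => let a' := mreify R a env in constr:(@MScale R c a')
  | @GRing.zero _ => constr:(@MZero R)
  | @Algebra.zero _ => constr:(@MZero R)
  | _ => let n := mindex t env in constr:(@MVar R n)
  end.
(* [R] is the ring of scalars of the module in which the identity is stated *)
Ltac lmod R :=
  lazymatch goal with
  | |- @eq ?T ?x ?y =>
    let env := menv x (@nil T) in let env := menv y env in
    let a := mreify R x env in let b := mreify R y env in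
    apply: (@meval_eq R _ env a b);
    rewrite /=; repeat (split; first by ring); done
  end.

(** * Calculus on the line *)

Section calculus.
Variable R : realType.
Implicit Types (f g h F G H k : R -> R).
Local Notation mu := (@lebesgue_measure R).

Definition hderiv F f := forall x : R, is_derive x 1 F (f x).

Lemma hderiv_cont F f : hderiv F f -> continuous F.
Proof.
move=> d x; have [dx _] := d x.
exact/differentiable_continuous/derivable1_diffP.
Qed.

Lemma hderiv1E F f : hderiv F f -> derive1 F = f.
Proof. by move=> d; apply/funext => x; rewrite derive1E; have [] := d x. Qed.

Lemma derivable_hderiv F : (forall x, derivable F x 1) -> hderiv F (derive1 F).
Proof. by move=> d x; rewrite derive1E; exact/derivableP. Qed.

Lemma mvt F f : hderiv F f -> forall x y, x <= y ->
  exists2 c, x <= c <= y & F y - F x = f c * (y - x).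
Proof.
move=> d x y xy.
have [c cI E] : exists2 c, c \in `[x, y]%R & F y - F x = f c * (y - x).
  apply: MVT_segment => //; apply: continuous_subspaceT; exact: (hderiv_cont d).
by exists c => //; rewrite in_itv/= in cI.
Qed.

Lemma mvt_near F f : hderiv F f -> forall x y,
  exists2 c, `|c - x| <= `|y - x| & F y - F x = f c * (y - x).
Proof.
move=> d x y; have [xy|/ltW yx] := leP x y.
  have [c /andP[xc cy] E] := mvt d xy; exists c => //.
  by rewrite !ger0_norm ?subr_ge0// lerD2r.
have [c /andP[yc cx] E] := mvt d yx; exists c.
  by rewrite !ler0_norm ?subr_le0// lerN2 lerD2r.
by rewrite -opprB E; ring.
Qed.

Lemma mvt_le F f (c x y : R) : hderiv F f -> x <= y ->
  (forall z, x <= z <= y -> f z <= c) -> F y - F x <= c * (y - x).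
Proof.
move=> d xy h; have [z zI ->] := mvt d xy.
by rewrite ler_wpM2r ?subr_ge0// h.
Qed.

Lemma mvt_ge F f (c x y : R) : hderiv F f -> x <= y ->
  (forall z, x <= z <= y -> c <= f z) -> c * (y - x) <= F y - F x.
Proof.
move=> d xy h; have [z zI ->] := mvt d xy.
by rewrite ler_wpM2r ?subr_ge0// h.
Qed.

Lemma mvt_norm F f (c x y : R) : hderiv F f ->
  (forall z, `|f z| <= c) -> `|F y - F x| <= c * `|y - x|.
Proof.
move=> d h; wlog xy : x y / x <= y.
  move=> W; have [/W//|yx] := leP x y.
  by rewrite distrC (distrC y); apply: W; exact: ltW.
have [z zI ->] := mvt d xy.
by rewrite normrM ler_wpM2r.
Qed.

Lemma mvt_nd F f (x y : R) : hderiv F f -> (forall z, 0 <= f z) -> x <= y ->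
  F x <= F y.
Proof.
by move=> d h xy; rewrite -subr_ge0 (le_trans _ (mvt_ge (c := 0) d xy _))// mul0r.
Qed.

Lemma hderiv0_const F : hderiv F (fun=> 0) -> forall x y, F x = F y.
Proof.
move=> d x y; apply/eqP; rewrite eq_sym -subr_eq0 -normr_le0.
by rewrite (le_trans (mvt_norm (c := 0) x y d _)) ?mul0r// => z; rewrite normr0.
Qed.

Lemma hderivD F f G g : hderiv F f -> hderiv G g ->
  hderiv (fun x => F x + G x) (fun x => f x + g x).
Proof. by move=> dF dG x; apply: is_deriveD. Qed.

Lemma hderivB F f G g : hderiv F f -> hderiv G g ->
  hderiv (fun x => F x - G x) (fun x => f x - g x).
Proof. by move=> dF dG x; apply: is_deriveB. Qed.

Lemma hderivN F f : hderiv F f -> hderiv (fun x => - F x) (fun x => - f x).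
Proof. by move=> dF x; apply: is_deriveN. Qed.

Lemma hderivZ (c : R) F f : hderiv F f ->
  hderiv (fun x => c * F x) (fun x => c * f x).
Proof. by move=> dF x; apply: is_deriveZ. Qed.

Lemma hderivM F f G g : hderiv F f -> hderiv G g ->
  hderiv (fun x => F x * G x) (fun x => f x * G x + F x * g x).
Proof.
move=> dF dG x; apply: (is_derive_eq (is_deriveM (dF x) (dG x))).
by rewrite /GRing.scale/=; ring.
Qed.

Lemma hderiv_id : hderiv (fun x => x) (fun=> 1).
Proof. by move=> x; apply: is_derive_id. Qed.

Lemma hderiv_cst (c : R) : hderiv (fun=> c) (fun=> 0).
Proof. by move=> x; apply: is_derive_cst. Qed.

Lemma hderiv_comp F f G g : hderiv F f -> hderiv G g ->
  hderiv (fun x => F (G x)) (fun x => f (G x) * g x).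
Proof.
move=> dF dG x.
by apply: (is_derive_eq (@is_derive1_comp _ F G x _ _ (dF (G x)) (dG x))); ring.
Qed.

Lemma hderiv_exp F f : hderiv F f ->
  hderiv (fun x => expR (F x)) (fun x => f x * expR (F x)).
Proof.
move=> dF x.
apply: (is_derive_eq
  (@is_derive1_comp _ expR F x _ _ (is_derive_expR (F x)) (dF x))); ring.
Qed.

Lemma hderiv_eq F f g : hderiv F f -> f =1 g -> hderiv F g.
Proof. by move=> d /funext <-. Qed.

Lemma hderiv_eq2 F G f : hderiv F f -> F =1 G -> hderiv G f.
Proof. by move=> d /funext <-. Qed.

Lemma contD f g : continuous f -> continuous g -> continuous (fun x => f x + g x).
Proof. by move=> cf cg x; apply: continuousD; [exact: cf|exact: cg]. Qed.
Lemma contB f g : continuous f -> continuous g -> continuous (fun x => f x - g x).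
Proof. by move=> cf cg x; apply: continuousB; [exact: cf|exact: cg]. Qed.
Lemma contM f g : continuous f -> continuous g -> continuous (fun x => f x * g x).
Proof. by move=> cf cg x; apply: continuousM; [exact: cf|exact: cg]. Qed.
Lemma contN f : continuous f -> continuous (fun x => - f x).
Proof. by move=> cf x; apply: continuousN; exact: cf. Qed.
Lemma contZ (c : R) f : continuous f -> continuous (fun x => c * f x).
Proof. by move=> cf x; apply: continuousM; [exact: cvg_cst|exact: cf]. Qed.
Lemma cont_cst (c : R) : continuous (fun _ : R => c).
Proof. by move=> x; exact: cvg_cst. Qed.
Lemma contV f : continuous f -> (forall x, f x != 0) -> continuous (fun x => (f x)^-1).
Proof. by move=> cf f0 x; apply: continuousV; [exact: f0|exact: cf]. Qed.
Lemma cont_comp f g : continuous f -> continuous g -> continuous (fun x => f (g x)).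
Proof. by move=> cf cg x; apply: (@continuous_comp _ _ _ g f); [exact: cg|exact: cf]. Qed.
Lemma cont_norm f : continuous f -> continuous (fun x => `|f x|).
Proof. by move=> cf x; apply: continuous_comp; [exact: cf|exact: norm_continuous]. Qed.
(** Integrals are handled through primitives: this lemma and the next one say that
  a continuous nonnegative function has an integral at most [c] if and only if it
  has a continuous majorant with a primitive whose increments are at most [c].
  Sums, products, changes of variables and tails of integrals then become
  computations with primitives. *)
Lemma int_le_primitive g h H (c : R) : continuous g -> (forall x, 0 <= g x) ->
  continuous h -> (forall x, g x <= h x) -> hderiv H h ->
  (forall x y, H y - H x <= c) ->
  (\int[mu]_x (g x)%:E <= c%:E)%E.
Proof.
move=> cg g0 ch gh dH Hc.
pose I (n : nat) := `[- n%:R, n%:R]%classic : set R.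
have UI : \bigcup_n I n = setT.
  apply/seteqP; split=> // x _.
  exists (Num.truncn `|x|).+1 => //=; rewrite /I/= in_itv/= -ler_norml ltW//.
  by rewrite truncnS_gt.
have mg : measurable_fun setT (EFin \o g).
  by apply/measurable_EFinP; exact: continuous_measurable_fun.
have ndI : nondecreasing_seq I.
  move=> m n mn; apply/subsetPset => x; rewrite /I/= !in_itv/= => /andP[a b].
  have : m%:R <= n%:R :> R by rewrite ler_nat.
  by move=> ?; apply/andP; split; lra.
have : ((\int[mu]_(x in I i) (g x)%:E)%E @[i --> \oo] -->
    (\int[mu]_(x in \bigcup_i I i) (g x)%:E)%E).
  apply: ge0_nondecreasing_set_cvg_integral => //.
  - by move=> i; exact: measurable_itv.
  - by move=> i; exact: measurable_funS mg.
  - by move=> i x _; rewrite lee_fin.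
rewrite UI => /(cvg_lim (@ereal_hausdorff R)) <-.
apply: lime_le.
  apply: ereal_nondecreasing_is_cvgn => m n mn.
  apply: ge0_subset_integral => //=; try exact: measurable_itv.
  - exact: measurable_funS mg.
  - by move=> x _; rewrite lee_fin.
  - exact/subsetPset/ndI.
near=> n.
have n0 : (0 < n)%N by near: n; exists 1%N.
apply: (@le_trans _ _ (\int[mu]_(x in I n) (h x)%:E)%E).
  apply: ge0_le_integral.
  - exact: measurable_itv.
  - by move=> x _; rewrite lee_fin.
  - exact: measurable_funS mg.
  - apply: measurableT_comp => //; apply: (measurable_funS measurableT) => //.
    exact: continuous_measurable_fun.
  - by move=> x _; rewrite lee_fin.
rewrite (@continuous_FTC2 _ h H).
- by rewrite -EFinB lee_fin.
- by rewrite -subr_gt0 opprK ltr_wpDr// ltr0n.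
- exact: continuous_subspaceT.
- split.
  + by move=> x _; have [] := dH x.
  + by apply: cvg_at_right_filter; exact: (hderiv_cont dH).
  + by apply: cvg_at_left_filter; exact: (hderiv_cont dH).
- by move=> x _; rewrite (hderiv1E dH).
Unshelve. all: by end_near. Qed.

Lemma primitive_of_int f (c : R) : continuous f -> (forall x, 0 <= f x) ->
  (\int[mu]_x (f x)%:E <= c%:E)%E ->
  exists2 F, hderiv F f & forall x y, F y - F x <= c.
Proof.
move=> cf f0 ic.
have mf : measurable_fun setT f by exact: continuous_measurable_fun.
have iF : mu.-integrable setT (EFin \o f).
  apply/integrableP; split; first exact/measurable_EFinP.
  under eq_integral do rewrite /= ger0_norm//.
  exact: le_lt_trans ic (ltry _).
have iS A : measurable A -> mu.-integrable A (EFin \o f).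
  by move=> mA; apply: integrableS iF.
pose F x := (\int[mu]_(t in `]-oo, x]) f t)%R.
have dF : hderiv F f.
  move=> x; have [||d E] := @continuous_FTC1 R f -oo%O x (x + 1) _ _ (ltNyr _) (cf x).
    by rewrite ltrDl.
    by apply: iS; exact: measurable_itv.
  by rewrite -E derive1E; exact/derivableP.
have F0 x : 0 <= F x by apply: Rintegral_ge0 => y _.
have Fc x : F x <= c.
  rewrite -lee_fin /F /Rintegral fineK; last first.
    by apply: integrable_fin_num; [exact: measurable_itv|exact: iS].
  apply: le_trans ic; apply: ge0_subset_integral => //=.
  - exact/measurable_EFinP.
  - by move=> y _; rewrite lee_fin.
by exists F => // x y; rewrite lerBlDr ler_wpDr.
Qed.

End calculus.

(** * Approximate derivatives and Gronwall's inequality *)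

Section halves.
Variable R : realType.
Definition hpow (n : nat) : R := 2^-1 ^+ n.
Lemma hpow_gt0 n : 0 < hpow n. Proof. by rewrite exprn_gt0// invr_gt0. Qed.
Lemma hpow_ge0 n : 0 <= hpow n. Proof. exact: ltW (hpow_gt0 n). Qed.
Lemma hpowS n : hpow n.+1 = hpow n / 2. Proof. by rewrite /hpow exprSr. Qed.

Lemma hpow_small (K e : R) (m : nat) : 0 < e -> exists2 n, (m <= n)%N & K * hpow n <= e.
Proof.
move=> e0.
have h : geometric K (2^-1 : R) n @[n --> \oo] --> (0 : R).
  by apply: cvg_geometric; rewrite ger0_norm; lra.
have : \forall n \near \oo, K * hpow n <= e.
  have /cvgrPdist_le/(_ e e0) := h; apply: filterS => n.
  by rewrite sub0r normrN; apply: le_trans; exact: ler_norm.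
move=> [N _ hN]; exists (maxn m N); first exact: leq_maxl.
by apply: hN; exact: leq_maxr.
Qed.

Lemma le_hpow_lim (a b K : R) (n : nat) :
  (forall m, (n <= m)%N -> a <= b + K * hpow m) -> a <= b.
Proof.
move=> h; apply/ler_addgt0Pr => e e0.
have [m nm Km] := hpow_small K n e0.
by rewrite (le_trans (h _ nm))// lerD2l.
Qed.
End halves.
Arguments hpow : clear implicits.
Arguments hpow_gt0 : clear implicits.
Arguments hpow_ge0 : clear implicits.

Section ode.
Variables (R : realType).

Definition seg (a b : R) : set R := [set t | a <= t <= b].

(** Induction along a segment: the supremum of the points up to which [P] holds is
  reached by the limit step and passed by the successor step. *)
Lemma real_ind (P : R -> Prop) (a b : R) : P a ->
  (forall t, a <= t -> t < b -> (forall s, a <= s -> s <= t -> P s) ->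
    exists2 d, 0 < d & forall s, t <= s -> s <= t + d -> s <= b -> P s) ->
  (forall t, a < t -> t <= b -> (forall s, a <= s -> s < t -> P s) -> P t) ->
  forall t, a <= t -> t <= b -> P t.
Proof.
move=> Pa Pstep Plim t0 at0 t0b.
have ab : a <= b by exact: le_trans t0b.
pose E : set R := [set t | [/\ a <= t, t <= b & forall s, a <= s -> s <= t -> P s]].
have Ea : E a by split=> // s sa sa'; have -> : s = a by apply/eqP; rewrite eq_le sa sa'.
have supE : has_sup E by split; [exists a|exists b => t []].
pose m := sup E.
have am : a <= m by apply: ub_le_sup => //; case: supE.
have mb : m <= b by apply: ge_sup; [exists a|move=> t []].
have Plt s : a <= s -> s < m -> P s.
  move=> as' sm; have [|t [_ _ h] mt] := @sup_adherent _ E (m - s) _ supE.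
    by rewrite subr_gt0.
  by apply: h => //; move: mt; rewrite -/m subKr => /ltW.
have Pm : P m.
  by move: am; rewrite le_eqVlt => /predU1P[<-//|am']; exact: Plim.
have Ple s : a <= s -> s <= m -> P s.
  by move=> as'; rewrite le_eqVlt => /predU1P[->//|]; exact: Plt.
have [mb'|bm] := ltP m b; last by apply: Ple => //; exact: le_trans bm.
have [d d0 hd] := Pstep m am mb' Ple.
pose e := Num.min d (b - m).
have e0 : 0 < e by rewrite lt_min d0 subr_gt0.
have Eme : E (m + e).
  have h : m + e <= b by rewrite -lerBrDl ge_min lexx orbT.
  split => //; first by rewrite ler_wpDr// ltW.
  move=> s as' sm; have [/Ple|ms] := leP s m; first exact.
  apply: hd => //; [exact: ltW| |exact: le_trans h].
  by apply: (le_trans sm); rewrite lerD2l ge_min lexx.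
have : m + e <= m by apply: ub_le_sup => //; case: supE.
by rewrite gerDl leNgt e0.
Qed.

Variable W : normedModType R.
Implicit Types (f g : R -> W) (A : set R) (t s : R).

(** A derivative up to a relative error [e]. Euler polygons satisfy a differential
  equation in this sense at every point, corners included, so that approximate and
  exact solutions obey the same Gronwall inequality. *)
Definition ederiv A f t (l : W) (e : R) : Prop :=
  exists2 d, 0 < d & forall s, A s -> `|s - t| < d ->
    `|f s - f t - (s - t) *: l| <= e * `|s - t|.

Definition tderiv A f t (l : W) := forall e, 0 < e -> ederiv A f t l e.

Lemma ederivB A f g t l m e d : ederiv A f t l e -> ederiv A g t m d ->
  ederiv A (fun t => f t - g t) t (l - m) (e + d).
Proof.
move=> [d1 d10 h1] [d2 d20 h2]; exists (Num.min d1 d2); first by rewrite lt_min d10.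
move=> s As; rewrite lt_min => /andP[/(h1 _ As) h1' /(h2 _ As) h2'].
rewrite mulrDl; apply: le_trans (lerD h1' h2').
rewrite (le_trans _ (ler_normB _ _))// le_eqVlt; apply/orP; left; apply/eqP.
by congr (`|_|); lmod R.
Qed.

Lemma ederiv_sub A A' f t l e : A' `<=` A -> ederiv A f t l e -> ederiv A' f t l e.
Proof. by move=> AA [d d0 h]; exists d => // s /AA; exact: h. Qed.

Lemma ederiv_growth A f t l e : ederiv A f t l e ->
  exists2 d, 0 < d & forall s, A s -> `|s - t| < d ->
    `|f s - f t| <= (`|l| + e) * `|s - t|.
Proof.
move=> [d d0 h]; exists d => // s As /(h _ As) h'.
have -> : f s - f t = (f s - f t - (s - t) *: l) + (s - t) *: l by lmod R.
rewrite (le_trans (ler_normD _ _))// normrZ mulrDl addrC mulrC lerD//.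
Qed.

(** Gronwall's inequality for approximate derivatives: the majorant is convex,
  so that its tangents lie below it. *)
Lemma gronwall f (a b L k c : R) : 0 <= L -> 0 <= k -> `|f a| <= c ->
  (forall t, a <= t -> t <= b -> exists l e,
    `|l| + e <= L * `|f t| + k /\ ederiv (seg a b) f t l e) ->
  forall t, a <= t -> t <= b -> `|f t| <= (c + k * (t - a)) * expR (L * (t - a)).
Proof.
move=> L0 k0 fa h.
have c0 : 0 <= c by exact: le_trans fa.
pose p t := (c + k * (t - a)) * expR (L * (t - a)).
have pnd s t : a <= s -> s <= t -> p s <= p t.
  move=> as' st; apply: ler_pM; rewrite ?expR_ge0//.
  - by rewrite addr_ge0// mulr_ge0// subr_ge0.
  - by rewrite lerD2l ler_wpM2l// lerD2r.
  - by rewrite ler_expR ler_wpM2l// lerD2r.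
apply: real_ind; first by rewrite subrr !mulr0 addr0 expR0 mulr1.
- move=> t at' tb /(_ t at' (lexx _)) ft.
  have [l [e [le /ederiv_growth[d d0 hd]]]] := h t at' (ltW tb).
  exists (d / 2); first by rewrite divr_gt0.
  move=> s ts sd sb.
  have st0 : 0 <= s - t by rewrite subr_ge0.
  have := hd s _ _; rewrite /seg/= sb (le_trans at' ts) ger0_norm// => /(_ isT).
  have -> : s - t < d by lra.
  move=> /(_ isT) hs.
  have h1 : `|f s| <= p t + (L * p t + k) * (s - t).
    have := ler_normD (f s - f t) (f t); rewrite subrK => h1.
    apply: (le_trans h1); rewrite addrC lerD// (le_trans hs)// ler_wpM2r//.
    by rewrite (le_trans le)// lerD2r ler_wpM2l.
  apply: (le_trans h1); rewrite /p.
  have P0 : 0 <= c + k * (t - a) by rewrite addr_ge0// mulr_ge0// subr_ge0.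
  have E1 : 1 <= expR (L * (t - a)).
    by rewrite -expR0 ler_expR mulr_ge0// subr_ge0.
  have -> : L * (s - a) = L * (t - a) + L * (s - t) by ring.
  have -> : k * (s - a) = k * (t - a) + k * (s - t) by ring.
  rewrite expRD addrA.
  have E2 : 1 + L * (s - t) <= expR (L * (s - t)) by exact: expR_ge1Dx.
  move: (c + k * (t - a)) P0 (expR _) E1 (expR _) E2 => P P0 E E1 E' E2.
  have Lx : 0 <= L * (s - t) by exact: mulr_ge0.
  have kx : 0 <= k * (s - t) by exact: mulr_ge0.
  have E0 : 0 <= E by lra.
  have -> : P * E + (L * (P * E) + k) * (s - t) =
    P * (E * (1 + L * (s - t))) + k * (s - t) * 1 by ring.
  rewrite mulrDl; apply: lerD.
    by rewrite ler_wpM2l// ler_wpM2l.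
  rewrite ler_wpM2l//; apply: (le_trans E1); rewrite ler_peMr//; lra.
- move=> t at' tb hs.
  have [l [e [le /ederiv_growth[d d0 hd]]]] := h t (ltW at') tb.
  rewrite -/(p t); apply/ler_addgt0Pr => e' e'0.
  pose K := `| (`|l| + e) | + 1; have K0 : 0 < K by rewrite ltr_wpDl.
  pose s := t - Num.min (Num.min (d / 2) (t - a)) (e' / K).
  have m0 : 0 < Num.min (Num.min (d / 2) (t - a)) (e' / K).
    by rewrite !lt_min !divr_gt0//= subr_gt0 at'.
  have st : s < t by rewrite gtrBl.
  have as' : a <= s.
    by rewrite lerBrDr -lerBrDl !ge_min lexx !orbT.
  have ts : `|s - t| = Num.min (Num.min (d / 2) (t - a)) (e' / K).
    by rewrite /s addrAC subrr add0r normrN gtr0_norm.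
  have := hd s _ _; rewrite /seg/= as' (le_trans (ltW st) tb) => /(_ isT).
  rewrite ts !gt_min ltr_pdivrMr// ltr_pMr// ltr1n/= => /(_ isT) hs'.
  have := ler_normB (f s) (f s - f t); rewrite subKr => h1.
  apply: (le_trans h1); apply: lerD.
    by rewrite (le_trans (hs _ as' st))// pnd// ltW.
  apply: (le_trans hs').
  apply: (@le_trans _ _ (K * Num.min (Num.min (d / 2) (t - a)) (e' / K))).
    by rewrite ler_wpM2r ?(ltW m0)// (le_trans (ler_norm _))// lerDl.
  by rewrite mulrC -ler_pdivlMr// ge_min lexx orbT.
Qed.

End ode.

(** * Ordinary differential equations in normed modules *)

Section ode_existence.
Variables (R : realType) (W : normedModType R).
Implicit Types (f g x y : R -> W) (A : set R) (t s : R).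

(** Completeness is only needed for sequences with geometric increments, and comes
  with a rate of convergence. *)
Definition geo_complete := forall (C : R) (u : nat -> W),
  (forall n, `|u n.+1 - u n| <= C * hpow R n) ->
  exists l, forall n, `|u n - l| <= 2 * C * hpow R n.

(** Gronwall's inequality with a zero Lipschitz constant. *)
Lemma mean_value f (a b k : R) : a <= b -> 0 <= k ->
  (forall t, a <= t -> t <= b -> exists l e,
    `|l| + e <= k /\ ederiv (seg a b) f t l e) ->
  `|f b - f a| <= k * (b - a).
Proof.
move=> ab k0 h.
have := @gronwall _ _ (fun t => f t - f a) a b 0 k 0 (lexx _) k0.
rewrite subrr normr0 => /(_ (lexx _)) G.
have := G _ b ab (lexx _); rewrite mul0r expR0 mulr1 add0r; apply.
move=> t at' tb; have [l [e [le [d d0 hd]]]] := h t at' tb.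
exists l, e; rewrite mul0r add0r; split => //; exists d => // s As /(hd _ As).
by apply: le_trans; rewrite le_eqVlt; apply/orP; left; apply/eqP; congr (`|_|); lmod R.
Qed.

Lemma hpow_cauchy (u : nat -> W) C :
  (forall n, `|u n.+1 - u n| <= C * hpow R n) ->
  forall m n, (n <= m)%N -> `|u n - u m| <= 2 * C * hpow R n.
Proof.
move=> h.
have C0 : 0 <= C by have := h 0%N; rewrite /hpow expr0 mulr1; exact: le_trans.
have H k n : `|u n - u (n + k)%N| <= 2 * C * (hpow R n - hpow R (n + k)%N).
  elim: k => [|k IH]; first by rewrite addn0 !subrr normr0 mulr0.
  rewrite (_ : u n - _ = (u n - u (n + k)%N) - (u (n + k.+1)%N - u (n + k)%N));
    last by lmod R.
  rewrite (le_trans (ler_normB _ _))// addnS.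
  apply: (le_trans (lerD IH (h _))); rewrite hpowS.
  move: (hpow R (n + k)) (hpow R n) => p q. lra.
move=> m n nm; have := H (m - n)%N n; rewrite subnKC// => /le_trans; apply.
by rewrite ler_wpM2l ?mulr_ge0// gerBl hpow_ge0.
Qed.

Variables (x0 : W) (a b M L : R) (B : set W) (f : R -> W -> W).
Hypothesis complete : geo_complete.
Hypotheses (ab : a <= b) (M0 : 0 <= M) (L0 : 0 <= L).
Hypothesis hB : forall y : W, `|y - x0| <= M * (b - a) -> B y.
Hypothesis hM : forall t (y : W), seg a b t -> B y -> `|f t y| <= M.
Hypothesis hL : forall t (y z : W), seg a b t -> B y -> B z ->
  `|f t y - f t z| <= L * `|y - z|.
Hypothesis hC : forall (t e : R), seg a b t -> 0 < e -> exists2 d : R, 0 < d &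
  forall s, seg a b s -> `|s - t| < d -> forall y : W, B y -> `|f s y - f t y| <= e.

(** Solutions on [seg a c] up to an error [e] in the derivative. *)
Definition esol (e c : R) (x : R -> W) := x a = x0 /\
  forall t, seg a c t -> `|x t - x0| <= M * (t - a) /\
    ederiv (seg a c) x t (f t (x t)) e.

Lemma esol_in e c x t : c <= b -> esol e c x -> seg a c t -> B (x t).
Proof.
move=> cb [_ h] tc; have [h1 _] := h t tc; apply: hB; apply: (le_trans h1).
by rewrite ler_wpM2l// lerD2r; move: tc => /andP[_ tc]; exact: le_trans cb.
Qed.

(** One step of Euler's method. On the new interval the velocity is frozen at its
  value at [t0], and both the time and the state of [f] have moved little. *)
Lemma esol_step (e : R) x (t0 t1 : R) : 0 < e -> a <= t0 -> t0 <= t1 -> t1 <= b ->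
  esol e t0 x ->
  (forall t, t0 <= t -> t <= t1 -> forall y : W, B y -> `|f t0 y - f t y| <= e / 2) ->
  L * M * (t1 - t0) <= e / 2 -> exists y, esol e t1 y.
Proof.
move=> e0 at0 t01 t1b xs hf hLM.
have t0b : t0 <= b by exact: le_trans t1b.
pose l := f t0 (x t0).
pose y s := if s <= t0 then x s else x t0 + (s - t0) *: l.
have yx s : s <= t0 -> y s = x s by move=> h; rewrite /y h.
have yl s : t0 <= s -> y s = x t0 + (s - t0) *: l.
  rewrite le_eqVlt => /predU1P[<-|h]; first by rewrite yx// subrr scale0r addr0.
  by rewrite /y leNgt h.
have t0s : seg a t0 t0 by rewrite /seg/= at0 lexx.
have [xa xe] := xs.
have lM : `|l| <= M.
  by apply: hM; [rewrite /seg/= at0|exact: esol_in xs _].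
have [xt0 [d00 d000 hd00]] := xe _ t0s.
have yM t : a <= t -> t <= t1 -> `|y t - x0| <= M * (t - a).
  move=> at' tt1; have [tt0|/ltW t0t] := leP t t0.
    by rewrite yx//; have [] := xe t; rewrite /seg/= ?at'.
  rewrite yl// addrAC (le_trans (ler_normD _ _))// normrZ.
  rewrite (_ : M * (t - a) = M * (t0 - a) + (t - t0) * M); last by ring.
  by rewrite lerD// ger0_norm ?subr_ge0// ler_wpM2l// subr_ge0.
have yB t : a <= t -> t <= t1 -> B (y t).
  move=> at' tt1; apply: hB; apply: (le_trans (yM _ at' tt1)).
  by rewrite ler_wpM2l// lerD2r (le_trans tt1).
exists y; split; first by rewrite yx.
move=> t /andP[at' tt1]; split; first exact: yM.
have [tt0|t0t|tt0] := ltgtP t t0.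
- have tc : seg a t0 t by rewrite /seg/= at' ltW.
  have [_ [d d0 hd]] := xe t tc.
  exists (Num.min d (t0 - t)); first by rewrite lt_min d0 subr_gt0.
  move=> s /andP[as' st1]; rewrite lt_min => /andP[sd st].
  have st0 : s <= t0.
    by rewrite -(subrK t s) -lerBrDr (le_trans (ler_norm _))// ltW.
  by rewrite !yx ?(ltW tt0)//; apply: hd => //; rewrite /seg/= as'.
- exists (t - t0); first by rewrite subr_gt0.
  move=> s /andP[as' st1] st.
  have st0 : t0 <= s.
    have : t - s < t - t0 by rewrite (le_lt_trans (ler_norm _))// distrC.
    by rewrite ltrD2l ltrN2 => /ltW.
  have -> : y s - y t - (s - t) *: f t (y t) = (s - t) *: (l - f t (y t)).
    by rewrite (yl s)// (yl t (ltW t0t)); lmod R.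
  rewrite normrZ mulrC ler_wpM2r//.
  have -> : l - f t (y t) = (l - f t (x t0)) + (f t (x t0) - f t (y t)) by lmod R.
  have -> : e = e / 2 + e / 2 by lra.
  have Bx : B (x t0) by exact: esol_in xs _.
  rewrite (le_trans (ler_normD _ _))// lerD//; first by apply: hf => //; exact: ltW.
  apply: (le_trans (hL _ Bx (yB _ at' tt1))); first by rewrite /seg/= at' (le_trans tt1).
  rewrite (yl t (ltW t0t)) (_ : x t0 - _ = (t0 - t) *: l); last by lmod R.
  apply: (le_trans _ hLM); rewrite normrZ -mulrA ler_wpM2l//.
  rewrite mulrC; apply: ler_pM => //; rewrite ltr0_norm ?subr_lt0//; lra.
- rewrite tt0 yx//; exists d00 => // s /andP[as' st1] sd.
  have [ss|ss] := leP s t0.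
    by rewrite !yx//; apply: hd00 => //; rewrite /seg/= as'.
  rewrite yl ?(ltW ss)// yx// -/l.
  rewrite (_ : _ - _ = 0); first by rewrite normr0 mulr_ge0// ltW.
  by lmod R.
Qed.

(** By induction along the segment. At a limit time [t] a single step from a point
  shortly before [t] reaches [t], since the length of the admissible steps near [t]
  is bounded below. *)
Lemma esol_exists (e : R) : 0 < e -> forall c, a <= c -> c <= b -> exists x, esol e c x.
Proof.
move=> e0.
have e20 : 0 < e / 2 by rewrite divr_gt0.
have e40 : 0 < e / 4 by rewrite divr_gt0.
have LM1 : 0 < L * M + 1 by rewrite ltr_wpDl// mulr_ge0.
pose r := e / 2 / (L * M + 1).
have r0 : 0 < r by rewrite divr_gt0.
have rLM t : t <= r -> L * M * t <= e / 2.
  move=> tr; rewrite (@le_trans _ _ (L * M * r))// ?ler_wpM2l ?mulr_ge0//.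
  rewrite /r mulrA ler_pdivrMr// mulrC ler_wpM2l ?(ltW e20)// lerDl//.
apply: real_ind.
- exists (fun=> x0); split => // t /andP[at' ta].
  have -> : t = a by apply/eqP; rewrite eq_le at' ta.
  rewrite /= !subrr normr0 mulr0; split => //; exists 1 => // s /andP[as' sa] _.
  have -> : s = a by apply/eqP; rewrite eq_le as' sa.
  by rewrite /= !subrr scale0r subr0 !normr0 mulr0.
- move=> t at' tb /(_ t at' (lexx _))[x xs].
  have tab : seg a b t by rewrite /seg/= at' ltW.
  have [d d0 hd] := hC tab e20.
  exists (Num.min (d / 2) r); first by rewrite lt_min divr_gt0.
  move=> s ts; rewrite -lerBlDl le_min => /andP[sd sr] sb.
  apply: (esol_step e0 at' ts sb xs); last exact: rLM.
  move=> u tu us y By; rewrite distrC; apply: hd => //.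
    by rewrite /seg/= (le_trans at' tu) (le_trans us).
  by rewrite ger0_norm ?subr_ge0//; lra.
- move=> t at' tb hs.
  have tab : seg a b t by rewrite /seg/= ltW.
  have [d d0 hd] := hC tab e40.
  pose m := Num.min (Num.min (d / 2) r) (t - a).
  have m0 : 0 < m by rewrite !lt_min divr_gt0// r0 subr_gt0.
  have [md mr ma] : [/\ m <= d / 2, m <= r & m <= t - a].
    by rewrite /m !ge_min !lexx ?orbT.
  have [||x xs] := hs (t - m); [by lra|by lra|].
  have tmt : t - m <= t by lra.
  apply: (esol_step e0 _ tmt tb xs); [by lra| |by apply: rLM; lra].
  have H u (y : W) : t - m <= u -> u <= t -> B y -> `|f u y - f t y| <= e / 4.
    move=> mu ut By; apply: hd => //; first by rewrite /seg/=; lra.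
    by rewrite ler0_norm; lra.
  move=> u tu ut y By.
  have -> : f (t - m) y - f u y = (f (t - m) y - f t y) - (f u y - f t y) by lmod R.
  have := H _ _ (lexx _) tmt By; have := H _ _ tu ut By.
  have := ler_normB (f (t - m) y - f t y) (f u y - f t y); lra.
Qed.

Lemma esol_diff (e1 e2 : R) x y : 0 <= e1 -> 0 <= e2 -> esol e1 b x -> esol e2 b y ->
  forall t, seg a b t ->
  `|x t - y t| <= (e1 + e2) * ((b - a) * expR (L * (b - a))).
Proof.
move=> e10 e20 xs ys t /andP[at' tb].
have [xa hx] := xs; have [ya hy] := ys.
have := @gronwall _ _ (fun t => x t - y t) a b L (e1 + e2) 0 L0 (addr_ge0 e10 e20).
rewrite /= xa ya subrr normr0 => /(_ (lexx _)) G.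
have {}G := G _ t at' tb.
apply: (le_trans (G _)) => [{t at' tb G} t at' tb|].
  have tab : seg a b t by rewrite /seg/= at'.
  have [_ dx] := hx t tab; have [_ dy] := hy t tab.
  exists (f t (x t) - f t (y t)), (e1 + e2); split; last exact: ederivB.
  by rewrite lerD2r; apply: hL => //; [exact: esol_in xs _|exact: esol_in ys _].
rewrite add0r -mulrA ler_wpM2l ?addr_ge0//.
apply: ler_pM; rewrite ?subr_ge0 ?expR_ge0 ?lerD2r//.
by rewrite ler_expR ler_wpM2l// lerD2r.
Qed.

(** Existence for [x' = f t x], [x a = x0]. The approximate solutions with errors
  [hpow n] form, by Gronwall's inequality, a sequence with geometric increments.
  The mean value inequality for the difference of two of them makes the convergence
  uniform relative to [t - s], so that the limit is differentiable. *)
Lemma ode_exists : exists x, [/\ x a = x0,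
  forall t, seg a b t -> `|x t - x0| <= M * (b - a) &
  forall t, seg a b t -> tderiv (seg a b) x t (f t (x t))].
Proof.
have [x xs] := choice (fun n => esol_exists (hpow_gt0 R n) ab (lexx b)).
pose D := (b - a) * expR (L * (b - a)).
have D0 : 0 <= D by rewrite mulr_ge0 ?expR_ge0 ?subr_ge0.
have hdiff n t : seg a b t -> `|x n.+1 t - x n t| <= 2 * D * hpow R n.
  move=> tab; apply: (le_trans (esol_diff _ _ (xs n.+1) (xs n) tab));
    rewrite ?hpow_ge0//.
  rewrite -/D hpowS (_ : 2 * D * _ = (hpow R n + hpow R n) * D); last by ring.
  by rewrite ler_wpM2r//; have := hpow_ge0 R n; lra.
have : forall t, exists l, seg a b t ->
    forall n, `|x n t - l| <= 2 * (2 * D) * hpow R n.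
  move=> t; have [tab|ntab] := pselect (seg a b t); last by exists 0.
  by have [l hl] := complete (fun n => hdiff n t tab); exists l.
move=> /choice[X hX].
have xM n t : seg a b t -> `|x n t - x0| <= M * (b - a).
  move=> tab; have [_ /(_ t tab)[h _]] := xs n; apply: (le_trans h).
  by rewrite ler_wpM2l// lerD2r; case/andP: tab.
have XM t : seg a b t -> `|X t - x0| <= M * (b - a).
  move=> tab; apply: (@le_hpow_lim _ _ _ (2 * (2 * D)) 0) => m _.
  rewrite (_ : X t - x0 = (x m t - x0) - (x m t - X t)); last by lmod R.
  by rewrite (le_trans (ler_normB _ _))// lerD ?xM ?hX.
have aab : seg a b a by rewrite /seg/= lexx.
exists X; split => //.
  apply/eqP; rewrite -subr_eq0 -normr_le0.
  apply: (@le_hpow_lim _ _ _ (2 * (2 * D)) 0) => m _; rewrite add0r.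
  by have := hX _ aab m; have [-> _] := xs m; rewrite distrC.
have hinc n m s t : (n <= m)%N -> s <= t -> seg a b s -> seg a b t ->
    `|(x n t - x m t) - (x n s - x m s)| <= (L * (4 * D) + 2) * hpow R n * (t - s).
  move=> nm st sab tab.
  have h0 := hpow_ge0 R n.
  apply: (@mean_value (fun t => x n t - x m t)) => //.
    by rewrite mulr_ge0// addr_ge0// mulr_ge0// mulr_ge0.
  move=> u su ut; have uab : seg a b u.
    move: sab tab => /andP[as' _] /andP[_ tb].
    by rewrite /seg/= (le_trans as' su) (le_trans ut).
  have [_ /(_ u uab)[_ dn]] := xs n; have [_ /(_ u uab)[_ dm]] := xs m.
  exists (f u (x n u) - f u (x m u)), (hpow R n + hpow R m); split.
    rewrite mulrDl lerD//.
      have := hL uab (esol_in (lexx _) (xs n) uab) (esol_in (lexx _) (xs m) uab).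
      move/le_trans; apply; rewrite -mulrA ler_wpM2l//.
      have := hpow_cauchy (fun n => hdiff n u uab) nm.
      by rewrite mulrA (_ : 2 * 2 = 4) // -natrM.
    rewrite (_ : 2 * _ = hpow R n + hpow R n); last by lra.
    by rewrite lerD2l; apply: ler_wiXn2l => //; lra.
  apply: ederiv_sub (ederivB dn dm) => v /andP[sv vt].
  move: sab tab => /andP[as' _] /andP[_ tb].
  by rewrite /seg/= (le_trans as' sv) (le_trans vt).
have hincX n s t : s <= t -> seg a b s -> seg a b t ->
    `|(x n t - X t) - (x n s - X s)| <= (L * (4 * D) + 2) * hpow R n * (t - s).
  move=> st sab tab.
  apply: (@le_hpow_lim _ _ _ (8 * D) n) => m nm.
  rewrite (_ : _ - _ = ((x n t - x m t) - (x n s - x m s)) +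
    ((x m t - X t) - (x m s - X s))); last by lmod R.
  rewrite (le_trans (ler_normD _ _))// lerD ?hinc//.
  rewrite (le_trans (ler_normB _ _))// (le_trans (lerD (hX t tab m) (hX s sab m)))//; lra.
have hincX' n s t : seg a b s -> seg a b t ->
    `|(x n t - X t) - (x n s - X s)| <= (L * (4 * D) + 2) * hpow R n * `|t - s|.
  move=> sab tab; have [st|/ltW ts] := leP s t.
    by rewrite ger0_norm ?subr_ge0//; exact: hincX.
  by rewrite distrC (distrC t) ger0_norm ?subr_ge0//; exact: hincX.
move=> t tab e e0.
pose K := (L * (4 * D) + 2) + 1 + L * (4 * D).
have [n _ hn] := hpow_small K 0 e0.
have [xa /(_ t tab)[_ [d d0 hd]]] := xs n.
exists d => // s sab st.
have -> : X s - X t - (s - t) *: f t (X t) =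
  (x n s - x n t - (s - t) *: f t (x n t)) - ((x n s - X s) - (x n t - X t)) +
  (s - t) *: (f t (x n t) - f t (X t)) by lmod R.
rewrite (le_trans (ler_normD _ _))// normrZ.
apply: (@le_trans _ _ (K * hpow R n * `|s - t|)); last by rewrite ler_wpM2r.
have -> : K * hpow R n * `|s - t| = (hpow R n * `|s - t| +
  (L * (4 * D) + 2) * hpow R n * `|s - t|) + `|s - t| * (L * (4 * D * hpow R n)).
  by rewrite /K; ring.
rewrite lerD//.
  by rewrite (le_trans (ler_normB _ _))// lerD ?hd// hincX'.
rewrite ler_wpM2l//.
apply: (le_trans (hL tab _ _)); [exact: esol_in (xs n) tab|exact/hB/XM|].
by rewrite ler_wpM2l// (le_trans (hX t tab n))//; lra.
Qed.

End ode_existence.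

(** * Integrability through primitives *)

Section L1.
Variable R : realType.
Implicit Types (f g h F G H k : R -> R) (c d e : R).
Local Notation mu := (@lebesgue_measure R).

Definition vanish f := forall e, 0 < e -> exists N, forall x, N <= `|x| -> `|f x| <= e.

(** The bound [c] for the integral of [|f|], witnessed by the primitive [F] of a
  majorant [k]. For continuous [f] it is equivalent to the bound for the integral by
  [L1le_int] and [int_L1le]. *)
Definition L1le f c := exists k F, [/\ continuous k, (forall x, `|f x| <= k x),
  hderiv F k & forall x y, F y - F x <= c].

Lemma L1le_mono f c d : L1le f c -> c <= d -> L1le f d.
Proof.
move=> [k [F [ck fk dF Fc]]] cd; exists k, F; split => // x y.
exact: le_trans (Fc x y) cd.
Qed.

Lemma L1le_dom f g c : L1le f c -> (forall x, `|g x| <= `|f x|) -> L1le g c.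
Proof.
move=> [k [F [ck fk dF Fc]]] gf; exists k, F; split => // x.
exact: le_trans (gf x) (fk x).
Qed.

Lemma L1leD f g c d : L1le f c -> L1le g d -> L1le (fun x => f x + g x) (c + d).
Proof.
move=> [k [F [ck fk dF Fc]]] [l [G [cl gl dG Gd]]].
exists (fun x => k x + l x), (fun x => F x + G x); split.
- exact: contD.
- by move=> x; rewrite (le_trans (ler_normD _ _))// lerD.
- exact: hderivD.
- by move=> x y; have := Fc x y; have := Gd x y; lra.
Qed.

Lemma L1leZ f c (a : R) : L1le f c -> L1le (fun x => a * f x) (`|a| * c).
Proof.
move=> [k [F [ck fk dF Fc]]].
exists (fun x => `|a| * k x), (fun x => `|a| * F x); split.
- exact: contZ.
- by move=> x; rewrite normrM ler_wpM2l.
- exact: hderivZ.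
- by move=> x y; rewrite -mulrBr ler_wpM2l.
Qed.

Lemma L1leM f g c d : L1le f c -> (forall x, `|g x| <= d) ->
  L1le (fun x => g x * f x) (d * c).
Proof.
move=> L1f gd; have d0 : 0 <= d by exact: le_trans (gd 0).
have := L1leZ d L1f; rewrite ger0_norm// => /L1le_dom; apply => x.
by rewrite !normrM (ger0_norm d0) ler_wpM2r.
Qed.

Lemma L1le_int f c : continuous f -> L1le f c ->
  (\int[mu]_x (`|f x|)%:E <= c%:E)%E.
Proof.
move=> cf [k [F [ck fk dF Fc]]].
by apply: (int_le_primitive (cont_norm cf) _ ck fk dF Fc) => x.
Qed.

Lemma int_L1le f c : continuous f -> (\int[mu]_x (`|f x|)%:E <= c%:E)%E -> L1le f c.
Proof.
move=> cf h; have [F dF Fc] := primitive_of_int (cont_norm cf) (fun=> normr_ge0 _) h.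
by exists (fun x => `|f x|), F; split => //; exact: cont_norm.
Qed.

(** The chain rule gives the primitive; the slope of [phi], at least [a], is
  absorbed by the constant. *)
Lemma L1le_comp f c (phi dphi : R -> R) a : 0 < a -> hderiv phi dphi ->
  continuous dphi -> (forall x, a <= dphi x) -> L1le f c ->
  L1le (fun x => f (phi x)) (a^-1 * c).
Proof.
move=> a0 dp cdp ap [k [F [ck fk dF Fc]]].
have ai0 : 0 <= a^-1 by rewrite invr_ge0 ltW.
have cp := hderiv_cont dp.
exists (fun x => a^-1 * (k (phi x) * dphi x)), (fun x => a^-1 * F (phi x)); split.
- by apply: contZ; apply: contM => //; exact: cont_comp.
- move=> x; rewrite ler_pdivlMl// mulrC.
  apply: ler_pM => //; exact: ltW.
- exact/hderivZ/hderiv_comp.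
- by move=> x y; rewrite -mulrBr ler_wpM2l.
Qed.

(** A bounded monotone function comes close to its infimum and to its supremum. *)
Lemma primitive_tail F k c : hderiv F k -> (forall x, 0 <= k x) ->
  (forall x y, F y - F x <= c) -> forall e, 0 < e ->
  exists2 N, 0 <= N & forall x y, (N <= x /\ N <= y) \/ (x <= - N /\ y <= - N) ->
    F y - F x <= e.
Proof.
move=> dF k0 Fc e e0.
have supF : has_sup (range F).
  split; first by exists (F 0), 0.
  by exists (c + F 0) => _ [x _ <-]; rewrite -lerBlDr.
have infF : has_inf (range F).
  split; first by exists (F 0), 0.
  by exists (F 0 - c) => _ [x _ <-]; rewrite lerBlDr addrC -lerBlDr.
have [_ [p _ <-] hp] := sup_adherent e0 supF.
have [_ [q _ <-] hq] := inf_adherent e0 infF.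
have nd := mvt_nd dF k0.
pose N := Num.max 0 (Num.max p (- q)).
have [N0 pN qN] : [/\ 0 <= N, p <= N & - q <= N] by rewrite !le_max !lexx !orbT.
exists N => // x y [[Nx Ny]|[xN yN]].
- have := nd _ _ (le_trans pN Nx); have : F y <= sup (range F).
    by apply: ub_le_sup; [case: supF|exists y].
  lra.
- have yq : y <= q by lra.
  have := nd _ _ yq; have : inf (range F) <= F x.
    by apply: ge_inf; [case: infF|exists x].
  lra.
Qed.

(** If [|f x| >= e] far out, then [|f| >= e / 2] on an interval of fixed length, on
  which the primitive grows by more than its oscillation far out. *)
Lemma L1_vanish f c M : L1le f c -> (forall x y, `|f x - f y| <= M * `|x - y|) ->
  vanish f.
Proof.
move=> [k [F [ck fk dF Fc]]] fM e e0.
have k0 x : 0 <= k x by exact: le_trans (fk x).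
pose K := `|M| + 1; have K0 : 0 < K by rewrite ltr_wpDl.
pose d := e / (2 * K); have d0 : 0 < d by rewrite divr_gt0// mulr_gt0.
have Kd : K * d = e / 2 by rewrite /d; field; rewrite gt_eqF.
pose e' := e / 4 * d; have e'0 : 0 < e' by rewrite mulr_gt0// divr_gt0.
have [N N0 hN] := primitive_tail dF k0 Fc e'0.
exists (N + d) => x Nx; rewrite leNgt; apply/negP => ex.
have lb z : `|z - x| <= d -> e / 2 <= k z.
  move=> zx; apply: le_trans (fk z).
  have h : `|f x - f z| <= e / 2.
    apply: (le_trans (fM x z)); rewrite distrC -Kd.
    apply: (@le_trans _ _ (K * `|z - x|)); last by rewrite ler_wpM2l// ltW.
    by rewrite ler_wpM2r// (le_trans (ler_norm _))// lerDl.
  have := ler_normB (f x) (f x - f z); rewrite subKr.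
  have := ler_normD (f x - f z) (f z); rewrite subrK; lra.
have ed : e' < e / 2 * d by rewrite /e' ltr_pM2r//; lra.
have [x0|x0] := leP 0 x.
  move: Nx; rewrite ger0_norm// => Nx.
  have h1 : F (x + d) - F x <= e' by apply: hN; left; split; lra.
  suff : e / 2 * ((x + d) - x) <= F (x + d) - F x.
    have -> : x + d - x = d by ring.
    by lra.
  apply: (mvt_ge dF); first by lra.
  by move=> z /andP[xz zd]; apply: lb; rewrite ger0_norm; lra.
move: Nx; rewrite ltr0_norm// => Nx.
have h1 : F x - F (x - d) <= e' by apply: hN; right; split; lra.
suff : e / 2 * (x - (x - d)) <= F x - F (x - d) by rewrite subKr; lra.
apply: (mvt_ge dF); first by lra.
by move=> z /andP[xz zd]; apply: lb; rewrite ler0_norm; lra.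
Qed.

Lemma vanishD f g : vanish f -> vanish g -> vanish (fun x => f x + g x).
Proof.
move=> vf vg e e0; have e20 : 0 < e / 2 by rewrite divr_gt0.
have [N hN] := vf _ e20; have [M hM] := vg _ e20.
exists (Num.max N M) => x; rewrite ge_max => /andP[/hN h1 /hM h2].
by rewrite (le_trans (ler_normD _ _))//; lra.
Qed.

Lemma vanishM f g d : vanish f -> (forall x, `|g x| <= d) ->
  vanish (fun x => g x * f x).
Proof.
move=> vf gd e e0; have d0 : 0 <= d by exact: le_trans (gd 0).
have d10 : 0 < d + 1 by rewrite ltr_wpDl.
have [N hN] := vf (e / (d + 1)) (divr_gt0 e0 d10).
exists N => x /hN h; rewrite normrM (@le_trans _ _ ((d + 1) * (e / (d + 1))))//.
  by apply: ler_pM => //; rewrite (le_trans (gd x))// lerDl.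
by rewrite mulrC divfK// gt_eqF.
Qed.

Lemma vanish_le f g : vanish f -> (forall x, `|g x| <= `|f x|) -> vanish g.
Proof.
by move=> vf gf e /vf[N hN]; exists N => x /hN; exact: le_trans.
Qed.

Lemma vanish_cvg f : vanish f ->
  f x @[x --> +oo] --> (0 : R) /\ f x @[x --> -oo] --> (0 : R).
Proof.
move=> vf; split; apply/cvgrPdist_le => e /vf[N hN].
  near=> x; rewrite sub0r normrN; apply: hN; apply: le_trans (ler_norm _).
  by near: x; apply: nbhs_pinfty_ge; exact: num_real.
near=> x; rewrite sub0r normrN; apply: hN; rewrite -normrN.
apply: le_trans (ler_norm _); rewrite lerNr.
by near: x; apply: nbhs_ninfty_le; exact: num_real.
Unshelve. all: by end_near. Qed.

Lemma cvg_vanish f : f x @[x --> +oo] --> (0 : R) -> f x @[x --> -oo] --> (0 : R) ->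
  vanish f.
Proof.
move=> hy hNy e e0.
have /cvgrPdist_le/(_ e e0)[N [_ hN]] := hy.
have /cvgrPdist_le/(_ e e0)[M [_ hM]] := hNy.
exists (Num.max (N + 1) (1 - M)) => x; rewrite ge_max => /andP[Nx Mx].
have [x0|x0] := leP 0 x.
  rewrite -normrN -sub0r; apply: hN.
  by move: Nx; rewrite (ger0_norm x0); lra.
rewrite -normrN -sub0r; apply: hM.
by move: Mx; rewrite (ltr0_norm x0); lra.
Qed.

(** The majorant [2 w / (1 + (x / m)^2)] has an explicit primitive. *)
Lemma L1_compact f m (w : R) : 0 < m -> 0 <= w -> (forall x, `|f x| <= w) ->
  (forall x, m < `|x| -> f x = 0) -> L1le f (8 * m * w).
Proof.
move=> m0 w0 fw f0.
have d0 x : 0 < 1 + (x / m) ^+ 2 by rewrite ltr_wpDr// sqr_ge0.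
have datan : hderiv (@atan R) (fun x => (1 + x ^+ 2)^-1).
  by move=> x; exact: is_derive1_atan.
have dx : hderiv (fun x => x / m) (fun=> m^-1).
  by apply: (hderiv_eq (hderiv_eq2 (hderivZ m^-1 (@hderiv_id R)) (fun x => mulrC _ _))) => x; rewrite mulr1.
exists (fun x => 2 * w * m * ((1 + (x / m) ^+ 2)^-1 * m^-1)),
  (fun x => 2 * w * m * atan (x / m)); split.
- apply: contZ; apply: contM; last exact: cont_cst.
  apply: contV => [|x]; last by rewrite gt_eqF.
  have cx := hderiv_cont dx.
  by apply: contD; [exact: cont_cst|exact: contM].
- move=> x; have [xm|mx] := leP `|x| m; last first.
    rewrite f0// normr0 !mulr_ge0// ?invr_ge0 ?ltW//.
  apply: (le_trans (fw x)).
  have -> : 2 * w * m * ((1 + (x / m) ^+ 2)^-1 * m^-1) = w * (2 / (1 + (x / m) ^+ 2)).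
    by field; rewrite gt_eqF//=; have := d0 x; rewrite expr_div_n => h; 
     apply/eqP; nra.
  rewrite ler_peMr// ler_pdivlMr// mul1r.
  have : (x / m) ^+ 2 <= 1.
    rewrite -(expr1n _ 2) -real_normK ?num_real//.
    by rewrite lerXn2r ?nnegrE// normrM normfV (gtr0_norm m0) ler_pdivrMr ?mul1r.
  lra.
- exact/hderivZ/(hderiv_comp datan dx).
- move=> x y; rewrite -mulrBr.
  have h1 := atan_ltpi2 (y / m); have h2 := atan_gtNpi2 (x / m).
  have p4 : pi <= 4 :> R by have := pihalf_lt2 R; lra.
  apply: (@le_trans _ _ (2 * w * m * 4)); last by lra.
  by rewrite ler_wpM2l ?mulr_ge0 ?(ltW m0)//; lra.
Qed.

Definition cutoff (N x : R) : R := Num.max 0 (Num.min 1 (N + 1 - `|x|)).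

Lemma cutoff_ge0 N x : 0 <= cutoff N x. Proof. by rewrite le_max lexx. Qed.
Lemma cutoff_le1 N x : cutoff N x <= 1.
Proof. by rewrite ge_max ler01 ge_min lexx. Qed.
Lemma cutoff_in N x : `|x| <= N -> cutoff N x = 1.
Proof.
by move=> xN; rewrite /cutoff min_l ?max_r//; lra.
Qed.
Lemma cutoff_out N x : N + 1 < `|x| -> cutoff N x = 0.
Proof.
by move=> xN; rewrite /cutoff max_l// ge_min; apply/orP; right; lra.
Qed.
Lemma cutoff_cont N : continuous (cutoff N).
Proof.
apply: (@max_fun_continuous _ _ R (fun=> 0)); first exact: cont_cst.
apply: (@min_fun_continuous _ _ R (fun=> 1)); first exact: cont_cst.
by apply: contB; [exact: cont_cst|exact: norm_continuous].
Qed.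

(** Only the tails of [f] remain, where the primitive of the majorant is almost
  constant. *)
Lemma L1_cutoff f c : continuous f -> L1le f c -> forall e, 0 < e ->
  exists2 N, 0 <= N & L1le (fun x => f x * (1 - cutoff N x)) e.
Proof.
move=> cf [k [F [ck fk dF Fc]]] e e0.
have k0 x : 0 <= k x by exact: le_trans (fk x).
have e20 : 0 < e / 2 by rewrite divr_gt0.
have [N N0 hN] := primitive_tail dF k0 Fc e20.
exists N => //.
have b0 x : 0 <= 1 - cutoff N x by rewrite subr_ge0 cutoff_le1.
pose l x := k x * (1 - cutoff N x).
have cl : continuous l.
  by apply: contM => //; apply: contB; [exact: cont_cst|exact: cutoff_cont].
have l0 x : 0 <= l x by exact: mulr_ge0.
have lk x : l x <= k x by rewrite ler_piMr// gerBl cutoff_ge0.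
have [G dG Gc] : exists2 G, hderiv G l & forall x y, G y - G x <= c.
  apply: primitive_of_int => //.
  exact: int_le_primitive cl l0 ck lk dF Fc.
exists l, G; split => //.
  by move=> x; rewrite normrM (ger0_norm (b0 x)) ler_wpM2r.
have ndG := mvt_nd dG l0.
have GF x y : x <= y -> G y - G x <= F y - F x.
  move=> xy; have := @mvt_nd _ _ _ x y (hderivB dF dG) _ xy.
  rewrite /= => h; suff : F x - G x <= F y - G y by lra.
  by apply: h => z; rewrite subr_ge0.
have GN : G N = G (- N).
  apply/eqP; rewrite eq_le; apply/andP; split; last by apply: ndG; lra.
  have := @mvt_le _ G l 0 (- N) N dG _ _; rewrite mul0r subr_le0; apply; first by lra.
  by move=> z; rewrite -ler_norml => zN; rewrite /l cutoff_in// subrr mulr0.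
move=> x y.
pose y' := Num.max y N; pose x' := Num.min x (- N).
have : G y <= G y' by apply: ndG; rewrite le_max lexx.
have : G x' <= G x by apply: ndG; rewrite ge_min lexx.
have : G y' - G N <= e / 2.
  have h : N <= y' by rewrite le_max lexx orbT.
  by apply: (le_trans (GF _ _ h)); apply: hN; left.
have : G (- N) - G x' <= e / 2.
  have h : x' <= - N by rewrite ge_min lexx orbT.
  by apply: (le_trans (GF _ _ h)); apply: hN; right.
rewrite GN; lra.
Qed.

End L1.

(** * Differentiable families of functions *)

Section gauges.
Variable R : realType.
Implicit Types (f g : R -> R) (c d : R).

(** A gauge [N f c] reads: [f] lies in a certain space of functions, with norm at
  most [c]. The proof meets several such spaces (bounded, integrable or square
  integrable functions, with or without a derivative), and differential calculus
  with values in them needs nothing more than these four rules. *)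
Record gauge := Gauge {
  gauge_ball :> (R -> R) -> R -> Prop;
  gauge_le : forall f c d, gauge_ball f c -> c <= d -> gauge_ball f d;
  gauge0 : gauge_ball (fun=> 0) 0;
  gaugeD : forall f g c d, gauge_ball f c -> gauge_ball g d ->
    gauge_ball (fun x => f x + g x) (c + d);
  gaugeZ : forall f c a, gauge_ball f c -> gauge_ball (fun x => a * f x) (`|a| * c) }.

Lemma gaugeB (N : gauge) f g c d : N f c -> N g d -> N (fun x => f x - g x) (c + d).
Proof.
move=> Nf Ng; have := gaugeD Nf (gaugeZ (- 1) Ng).
rewrite normrN1 mul1r (_ : (fun x => _) = (fun x => f x - g x))//.
by apply/funext => x; rewrite mulN1r.
Qed.

Section C11.
Variables V : normedModType R.
Implicit Types (N : gauge) (p q h : V) (Phi Psi : V -> R -> R).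

(** A quantitative form of continuous differentiability near [p]. With a Lipschitz
  differential and a quadratic remainder it passes through products and bounded
  operators with explicit constants. *)
Definition C11_in N p Phi (dPhi : V -> V -> R -> R) (r C : R) :=
  [/\ 0 < r, 0 <= C & forall q, `|q - p| < r ->
  [/\ N (Phi q) C,
      (forall a h k, dPhi q (a *: h + k) = (fun x => a * dPhi q h x + dPhi q k x)),
      (forall h, N (dPhi q h) (C * `|h|)) &
      forall q', `|q' - p| < r ->
      [/\ N (fun x => Phi q' x - Phi q x) (C * `|q' - q|),
          (forall h, N (fun x => dPhi q' h x - dPhi q h x) (C * `|q' - q| * `|h|)) &
          N (fun x => Phi q' x - Phi q x - dPhi q (q' - q) x) (C * `|q' - q| ^+ 2)]]].

Definition C11 N p Phi := exists dPhi r C, C11_in N p Phi dPhi r C.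

Lemma C11_in_shrink N p Phi dPhi r C r' C' : 0 < r' -> r' <= r -> C <= C' ->
  C11_in N p Phi dPhi r C -> C11_in N p Phi dPhi r' C'.
Proof.
move=> r'0 r'r CC' [r0 C0 H]; split => //; first exact: le_trans CC'.
move=> q qr; have [h1 h2 h3 h4] := H q (lt_le_trans qr r'r); split => //.
- exact: gauge_le h1 CC'.
- by move=> h; apply: gauge_le (h3 h) _; rewrite ler_wpM2r.
- move=> q' q'r; have [h5 h6 h7] := h4 q' (lt_le_trans q'r r'r); split.
  + by apply: gauge_le h5 _; rewrite ler_wpM2r.
  + by move=> h; apply: gauge_le (h6 h) _; rewrite ler_wpM2r// ler_wpM2r.
  + by apply: gauge_le h7 _; rewrite ler_wpM2r// exprn_ge0.
Qed.

Lemma C11_ext N p Phi Psi (r : R) : 0 < r ->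
  (forall q, `|q - p| < r -> Phi q = Psi q) -> C11 N p Phi -> C11 N p Psi.
Proof.
move=> r0 E [dPhi [r1 [C H]]]; have [r10 _ _] := H.
have m0 : 0 < Num.min r r1 by rewrite lt_min r0.
exists dPhi, (Num.min r r1), C.
have : C11_in N p Phi dPhi (Num.min r r1) C.
  by apply: C11_in_shrink H => //; rewrite ge_min lexx orbT.
move=> [_ C0 {}H]; split => // q qm.
have Eq q' : `|q' - p| < Num.min r r1 -> Psi q' = Phi q'.
  by rewrite lt_min => /andP[/E].
have [h1 h2 h3 h4] := H q qm; rewrite (Eq _ qm); split => // q' q'm.
by rewrite (Eq _ q'm); exact: h4.
Qed.

(** The remainder of a product consists of the two remainders, each with a bounded
  factor, and of a product of two increments. *)
Lemma C11_in_mul N1 N2 N3 p Phi Psi dPhi dPsi r1 r2 C1 C2 (K : R) : 0 <= K ->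
  (forall f g c d, N1 f c -> N2 g d -> N3 (fun x => f x * g x) (K * (c * d))) ->
  C11_in N1 p Phi dPhi r1 C1 -> C11_in N2 p Psi dPsi r2 C2 ->
  C11_in N3 p (fun q x => Phi q x * Psi q x)
    (fun q h x => dPhi q h x * Psi q x + Phi q x * dPsi q h x)
    (Num.min r1 r2) (4 * (K * (C1 * C2))).
Proof.
move=> K0 mulN H1 H2.
have [r10 C10 _] := H1; have [r20 C20 _] := H2.
pose r := Num.min r1 r2; rewrite -/r.
have r0 : 0 < r by rewrite lt_min r10.
have [_ _ {}H1] : C11_in N1 p Phi dPhi r C1.
  by apply: C11_in_shrink H1 => //; rewrite ge_min lexx.
have [_ _ {}H2] : C11_in N2 p Psi dPsi r C2.
  by apply: C11_in_shrink H2 => //; rewrite ge_min lexx orbT.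
have C12 : 0 <= K * (C1 * C2) by rewrite !mulr_ge0.
have le (D x : R) : 0 <= x -> D <= 4 -> D * (K * (C1 * C2) * x) <= 4 * (K * (C1 * C2)) * x.
  by move=> x0 D4; rewrite -(mulrA 4) ler_wpM2r// mulr_ge0.
split => //; first by rewrite mulr_ge0.
move=> q qr; have [a1 a2 a3 a4] := H1 q qr; have [b1 b2 b3 b4] := H2 q qr.
have e (f g : R -> R) c d : N3 f c -> f =1 g -> c <= d -> N3 g d.
  by move=> Nf /funext <-; exact: gauge_le.
split.
- apply: (e _ _ _ _ (mulN _ _ _ _ a1 b1)) => //.
  by have := le 1 1 ler01; rewrite mul1r mulr1 mulr1; apply; lra.
- by move=> a h k; apply/funext => x; rewrite a2 b2; ring.
- move=> h; apply: (e _ _ _ _ (gaugeD (mulN _ _ _ _ (a3 h) b1) (mulN _ _ _ _ a1 (b3 h)))) => //.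
  rewrite (_ : _ + _ = 2 * (K * (C1 * C2) * `|h|)); last by ring.
  by apply: le => //; lra.
- move=> q' q'r.
  have [c1 _ c3 _] := H1 q' q'r; have [d1 _ d3 _] := H2 q' q'r.
  have [a5 a6 a7] := a4 q' q'r; have [b5 b6 b7] := b4 q' q'r.
  split.
  + apply: (e _ _ _ _ (gaugeD (mulN _ _ _ _ a5 d1) (mulN _ _ _ _ a1 b5))).
      by move=> x /=; ring.
    rewrite (_ : _ + _ = 2 * (K * (C1 * C2) * `|q' - q|)); last by ring.
    by apply: le => //; lra.
  + move=> h.
    apply: (e _ _ _ _ (gaugeD (gaugeD (mulN _ _ _ _ (a6 h) d1) (mulN _ _ _ _ (a3 h) b5))
      (gaugeD (mulN _ _ _ _ a5 (d3 h)) (mulN _ _ _ _ a1 (b6 h))))).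
      by move=> x /=; ring.
    rewrite (_ : _ + _ = 4 * (K * (C1 * C2) * (`|q' - q| * `|h|))); last by ring.
    by rewrite -(mulrA (4 * _)); apply: le => //; rewrite mulr_ge0.
  + apply: (e _ _ _ _ (gaugeD (gaugeD (mulN _ _ _ _ a7 d1)
      (mulN _ _ _ _ (a3 (q' - q)) b5)) (mulN _ _ _ _ a1 b7))).
      by move=> x /=; ring.
    rewrite (_ : _ + _ = 3 * (K * (C1 * C2) * `|q' - q| ^+ 2)); last by ring.
    by apply: le; [rewrite exprn_ge0|lra].
Qed.

Lemma C11_mul N1 N2 N3 p Phi Psi (K : R) : 0 <= K ->
  (forall f g c d, N1 f c -> N2 g d -> N3 (fun x => f x * g x) (K * (c * d))) ->
  C11 N1 p Phi -> C11 N2 p Psi -> C11 N3 p (fun q x => Phi q x * Psi q x).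
Proof.
move=> K0 mulN [dPhi [r1 [C1 H1]]] [dPsi [r2 [C2 H2]]].
by do 3 eexists; exact: C11_in_mul K0 mulN H1 H2.
Qed.

Lemma product_const1 N1 N2 N3 :
  (forall f g c d, N1 f c -> N2 g d -> N3 (fun x => f x * g x) (c * d)) ->
  forall f g c d, N1 f c -> N2 g d -> N3 (fun x => f x * g x) (1 * (c * d)).
Proof. by move=> mulN f g c d Nf Ng; rewrite mul1r; exact: mulN. Qed.

(** A bounded linear operator can be applied to differentials and to remainders. *)
Lemma C11_linop N1 N2 p Phi (T : (R -> R) -> R -> R) (K : R) : 0 <= K ->
  (forall f c, N1 f c -> N2 (T f) (K * c)) ->
  (forall f g a c d, N1 f c -> N1 g d ->
    T (fun x => a * f x + g x) = (fun x => a * T f x + T g x)) ->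
  C11 N1 p Phi -> C11 N2 p (fun q => T (Phi q)).
Proof.
move=> K0 TN Tlin [dPhi [r [C [r0 C0 H]]]].
have TB f g c d : N1 f c -> N1 g d -> T (fun x => f x - g x) = (fun x => T f x - T g x).
  move=> Nf Ng; rewrite (_ : (fun x => f x - g x) = (fun x => (-1) * g x + f x)).
    by rewrite (Tlin _ _ _ _ _ Ng Nf); apply/funext => x; ring.
  by apply/funext => x; ring.
have TNB f g c d e : N1 f c -> N1 g d -> N1 (fun x => f x - g x) e ->
    N2 (fun x => T f x - T g x) (K * e).
  move=> Nf Ng Ne.
  exact: (eq_ind _ (fun z => N2 z (K * e)) (TN _ _ Ne) _ (TB _ _ _ _ Nf Ng)).
exists (fun q h => T (dPhi q h)), r, (K * C); split => //; first exact: mulr_ge0.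
move=> q qr; have [h1 h2 h3 h4] := H q qr; split.
- exact: TN.
- by move=> a h k; rewrite h2 (Tlin _ _ _ _ _ (h3 h) (h3 k)).
- by move=> h; rewrite -mulrA; apply: TN.
- move=> q' q'r; have [h5 h6 h7] := h4 q' q'r.
  have [g1 _ g3 _] := H q' q'r.
  split.
  + by rewrite -mulrA; exact: TNB g1 h1 _.
  + by move=> h; rewrite -!mulrA (mulrA C); exact: TNB (g3 h) (h3 h) _.
  + rewrite -mulrA; have := TNB _ _ _ _ _ h5 (h3 (q' - q)) h7.
    by rewrite (TB _ _ _ _ g1 h1).
Qed.

Lemma C11_incl N1 N2 p Phi (K : R) : 0 <= K ->
  (forall f c, N1 f c -> N2 f (K * c)) -> C11 N1 p Phi -> C11 N2 p Phi.
Proof. by move=> K0 NN; exact: (@C11_linop N1 N2 p Phi id K). Qed.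

Lemma C11_scale N p Phi (a : R) : C11 N p Phi -> C11 N p (fun q x => a * Phi q x).
Proof.
apply: (@C11_linop _ _ _ _ (fun f x => a * f x) `|a|) => // [f c|f g b c d _ _].
  exact: gaugeZ.
by apply/funext => x; ring.
Qed.

Lemma C11_add N p Phi Psi : C11 N p Phi -> C11 N p Psi ->
  C11 N p (fun q x => Phi q x + Psi q x).
Proof.
move=> [dPhi [r1 [C1 H1]]] [dPsi [r2 [C2 H2]]].
have [r10 C10 _] := H1; have [r20 C20 _] := H2.
pose r := Num.min r1 r2.
have r0 : 0 < r by rewrite lt_min r10.
have [_ _ {}H1] : C11_in N p Phi dPhi r C1.
  by apply: C11_in_shrink H1 => //; rewrite ge_min lexx.
have [_ _ {}H2] : C11_in N p Psi dPsi r C2.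
  by apply: C11_in_shrink H2 => //; rewrite ge_min lexx orbT.
exists (fun q h x => dPhi q h x + dPsi q h x), r, (C1 + C2).
split => //; first by rewrite addr_ge0.
have e (f g : R -> R) c d : N f c -> f =1 g -> c <= d -> N g d.
  by move=> Nf /funext <-; exact: gauge_le.
move=> q qr; have [a1 a2 a3 a4] := H1 q qr; have [b1 b2 b3 b4] := H2 q qr.
split.
- exact: gaugeD.
- by move=> a h k; apply/funext => x; rewrite a2 b2; ring.
- by move=> h; rewrite mulrDl; exact: gaugeD.
- move=> q' q'r.
  have [a5 a6 a7] := a4 q' q'r; have [b5 b6 b7] := b4 q' q'r.
  split.
  + by apply: (e _ _ _ _ (gaugeD a5 b5)) => [x|]; [ring|rewrite mulrDl].
  + by move=> h; apply: (e _ _ _ _ (gaugeD (a6 h) (b6 h))) => [x|]; [ring|rewrite !mulrDl].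
  + by apply: (e _ _ _ _ (gaugeD a7 b7)) => [x|]; [ring|rewrite !mulrDl].
Qed.

Lemma C11_in_linear N p (l : V -> R -> R) (K : R) : 0 <= K ->
  (forall a h k, l (a *: h + k) = (fun x => a * l h x + l k x)) ->
  (forall h, N (l h) (K * `|h|)) ->
  C11_in N p l (fun=> l) 1 (K * (`|p| + 1)).
Proof.
move=> K0 lin Nl.
have lB h k x : l h x - l k x = l (h - k) x.
  have -> : h - k = (-1) *: k + h by lmod R.
  by rewrite lin; ring.
have N0 c : 0 <= c -> N (fun=> 0) c by move=> c0; exact: gauge_le (gauge0 N) c0.
have p1 : 1 <= `|p| + 1 by rewrite lerDr.
have p0 : 0 <= `|p| + 1 by rewrite addr_ge0.
have KK x : 0 <= x -> K * x <= K * (`|p| + 1) * x.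
  by move=> x0; rewrite -mulrA ler_wpM2l// ler_peMl.
split => //; first by rewrite mulr_ge0.
move=> q qp; split => //.
- apply: gauge_le (Nl q) _; rewrite ler_wpM2l//.
  have := ler_normD (q - p) p; rewrite subrK => /le_trans; apply.
  by rewrite addrC lerD2l ltW.
- by move=> h; apply: gauge_le (Nl h) _; exact: KK.
- move=> q' _; split.
  + rewrite (_ : (fun x => _) = l (q' - q)); last by apply/funext => x; rewrite lB.
    by apply: gauge_le (Nl _) _; exact: KK.
  + move=> h; rewrite (_ : (fun x => _) = fun=> 0); last by apply/funext => x; rewrite subrr.
    by apply: N0; rewrite !mulr_ge0.
  + rewrite (_ : (fun x => _) = fun=> 0); last by apply/funext => x; rewrite lB subrr.
    by apply: N0; rewrite !mulr_ge0// exprn_ge0.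
Qed.

Lemma C11_linear N p (l : V -> R -> R) (K : R) : 0 <= K ->
  (forall a h k, l (a *: h + k) = (fun x => a * l h x + l k x)) ->
  (forall h, N (l h) (K * `|h|)) -> C11 N p l.
Proof.
by move=> K0 lin Nl; do 3 eexists; exact: C11_in_linear K0 lin Nl.
Qed.

Lemma C11_cst N p f c : 0 <= c -> N f c -> C11 N p (fun=> f).
Proof.
move=> c0 Nf; have N0 d : 0 <= d -> N (fun=> 0) d.
  by move=> d0; exact: gauge_le (gauge0 N) d0.
exists (fun _ _ _ => 0), 1, c; split => // q _; split => //.
- by move=> a h k; apply/funext => x; rewrite mulr0 addr0.
- by move=> h; apply: N0; rewrite mulr_ge0.
- move=> q' _; split => [|h|].
  + rewrite (_ : (fun x => _) = fun=> 0); last by apply/funext => x; rewrite subrr.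
    by apply: N0; rewrite !mulr_ge0.
  + by rewrite (_ : (fun x => _) = fun=> 0); [apply: N0; rewrite !mulr_ge0|
      apply/funext => x; rewrite subrr].
  + rewrite (_ : (fun x => _) = fun=> 0); last by apply/funext => x; rewrite !subrr.
    by apply: N0; rewrite !mulr_ge0// exprn_ge0.
Qed.

End C11.
End gauges.

(** * Gauges, products and Nemytskii operators *)

Section concrete_gauges.
Variable R : realType.
Implicit Types (f g : R -> R) (c d : R).

(** The gauges in use: [Gsup] for bounded continuous functions, [G1] and [G2] for
  those that moreover vanish at infinity and are integrable, respectively square
  integrable, and [GC1 N] for functions controlled by [N] with their derivatives. *)
Definition supB f c := continuous f /\ forall x, `|f x| <= c.

Lemma supB_ge0 f c : supB f c -> 0 <= c.
Proof. by move=> [_ /(_ 0)]; exact: le_trans. Qed.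

Program Definition Gsup : gauge R := @Gauge R supB _ _ _ _.
Next Obligation.
by move=> f c d [cf fc] cd; split=> // x; exact: le_trans (fc x) cd.
Qed.
Next Obligation. by split; [exact: cont_cst|move=> x; rewrite normr0]. Qed.
Next Obligation.
move=> f g c d [cf fc] [cg gd]; split; first exact: contD.
by move=> x; rewrite (le_trans (ler_normD _ _))// lerD.
Qed.
Next Obligation.
move=> f c a [cf fc]; split; first exact: contZ.
by move=> x; rewrite normrM ler_wpM2l.
Qed.

Lemma supM f g c d : Gsup f c -> Gsup g d -> Gsup (fun x => f x * g x) (c * d).
Proof.
move=> [cf fc] [cg gd]; split; first exact: contM.
by move=> x; rewrite normrM; exact: ler_pM.
Qed.

Definition L1B f c := [/\ supB f c, L1le f c & vanish f].

Program Definition G1 : gauge R := @Gauge R L1B _ _ _ _.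
Next Obligation.
move=> f c d [sf lf vf] cd; split=> //; first exact: (@gauge_le R Gsup) sf cd.
exact: L1le_mono lf cd.
Qed.
Next Obligation.
split; first exact: (gauge0 Gsup).
  exists (fun=> 0), (fun=> 0); split.
  - exact: cont_cst.
  - by move=> x; rewrite normr0.
  - exact: hderiv_cst.
  - by move=> x y; rewrite subrr.
by move=> e e0; exists 0 => x _; rewrite normr0 ltW.
Qed.
Next Obligation.
move=> f g c d [sf lf vf] [sg lg vg]; split.
- exact: (@gaugeD R Gsup) sf sg.
- exact: L1leD.
- exact: vanishD.
Qed.
Next Obligation.
move=> f c a [sf lf vf]; split; first exact: (@gaugeZ R Gsup) sf.
  exact: L1leZ.
exact: (@vanishM _ _ (fun=> a) `|a|).
Qed.

Lemma L1M f g c d : Gsup f c -> G1 g d -> G1 (fun x => f x * g x) (c * d).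
Proof.
move=> sf [sg lg vg]; split; first exact: supM.
  by case: sf => _; exact: L1leM.
by case: sf => _; exact: vanishM.
Qed.

(** The Cauchy-Schwarz inequality, by weighting the arithmetic-geometric mean
  inequality. *)
Lemma L1_cs f g c d : (forall x, `|f x| <= c) -> (forall x, `|g x| <= d) ->
  L1le (fun x => f x ^+ 2) (c ^+ 2) -> L1le (fun x => g x ^+ 2) (d ^+ 2) ->
  L1le (fun x => f x * g x) (c * d).
Proof.
move=> fc gd lf lg.
have c0 : 0 <= c by exact: le_trans (fc 0).
have d0 : 0 <= d by exact: le_trans (gd 0).
have z : (forall x, f x * g x = 0) -> L1le (fun x => f x * g x) (c * d).
  move=> /funext ->; have [_ h _] := gauge0 G1.
  by apply: L1le_mono h _; exact: mulr_ge0.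
move: c0; rewrite le_eqVlt => /predU1P[c0|c0].
  by apply: z => x; have := fc x; rewrite -c0 normr_le0 => /eqP ->; rewrite mul0r.
move: d0; rewrite le_eqVlt => /predU1P[d0|d0].
  by apply: z => x; have := gd x; rewrite -d0 normr_le0 => /eqP ->; rewrite mulr0.
have := L1leD (L1leZ (d / (2 * c)) lf) (L1leZ (c / (2 * d)) lg).
rewrite (_ : _ + _ = c * d); last first.
  rewrite !gtr0_norm ?divr_gt0 ?mulr_gt0//.
  by field; rewrite !gt_eqF.
move=> /L1le_dom; apply => x; rewrite [leRHS]ger0_norm; last first.
  by rewrite addr_ge0// mulr_ge0 ?sqr_ge0// divr_ge0 ?mulr_ge0 ?ltW.
rewrite -(real_normK (num_real (f x))) -(real_normK (num_real (g x))) normrM.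
rewrite -subr_ge0 (_ : _ - _ = (d * `|f x| - c * `|g x|) ^+ 2 / (2 * c * d)).
  by rewrite divr_ge0 ?sqr_ge0 ?mulr_ge0 ?ltW.
by field; rewrite !gt_eqF.
Qed.

Definition L2B f c := [/\ supB f c, L1le (fun x => f x ^+ 2) (c ^+ 2) & vanish f].

Program Definition G2 : gauge R := @Gauge R L2B _ _ _ _.
Next Obligation.
move=> f c d [sf lf vf] cd; split=> //; first exact: (@gauge_le R Gsup) sf cd.
apply: L1le_mono lf _; have c0 := supB_ge0 sf.
by rewrite lerXn2r// nnegrE; exact: le_trans cd.
Qed.
Next Obligation.
have [h1 h2 h3] := gauge0 G1; split => //.
by apply: L1le_mono (L1le_dom h2 _) _ => [x|]; rewrite !expr0n//= ?normr0.
Qed.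
Next Obligation.
move=> f g c d [sf lf vf] [sg lg vg]; split.
- exact: (@gaugeD R Gsup) sf sg.
- have [_ bf] := sf; have [_ bg] := sg.
  have := L1leD (L1leD lf lg) (L1leZ 2 (L1_cs bf bg lf lg)).
  rewrite (_ : (fun x => _) = (fun x => (f x + g x) ^+ 2)); last first.
    by apply/funext => x; ring.
  by rewrite (_ : _ + _ = (c + d) ^+ 2)//; rewrite ger0_norm//; ring.
- exact: vanishD.
Qed.
Next Obligation.
move=> f c a [sf lf vf]; split; first exact: (@gaugeZ R Gsup) sf.
  have := L1leZ (a ^+ 2) lf.
  rewrite (_ : (fun x => _) = (fun x => (a * f x) ^+ 2)); last first.
    by apply/funext => x; ring.
  by rewrite exprMn real_normK ?num_real// ger0_norm ?sqr_ge0.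
exact: (@vanishM _ _ (fun=> a) `|a|).
Qed.

Lemma L2M f g c d : G2 f c -> G2 g d -> G1 (fun x => f x * g x) (c * d).
Proof.
move=> [sf lf vf] [sg lg vg]; split; first exact: supM.
  by case: sf sg => _ bf [_ bg]; exact: L1_cs.
by case: sf => _ bf; exact: vanishM bf.
Qed.

Lemma G1_G2 f c : G1 f c -> G2 f c.
Proof.
move=> [sf lf vf]; split => //; case: sf => _ bf.
by have := L1leM lf bf; rewrite -expr2.
Qed.

Definition C1B (N : gauge R) f c := exists f', [/\ hderiv f f', N f c & N f' c].

Program Definition GC1 (N : gauge R) : gauge R := @Gauge R (C1B N) _ _ _ _.
Next Obligation.
move=> N f c d [f' [df sf sf']] cd; exists f'; split => //; exact: gauge_le cd.
Qed.
Next Obligation.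
by move=> N; exists (fun=> 0); split; [exact: hderiv_cst|exact: gauge0..].
Qed.
Next Obligation.
move=> N f g c d [f' [df sf sf']] [g' [dg sg sg']].
exists (fun x => f' x + g' x); split; first exact: hderivD.
  exact: gaugeD.
exact: gaugeD.
Qed.
Next Obligation.
move=> N f c a [f' [df sf sf']].
exists (fun x => a * f' x); split; first exact: hderivZ.
  exact: gaugeZ.
exact: gaugeZ.
Qed.

Lemma C1M f g c d : GC1 Gsup f c -> GC1 G1 g d ->
  GC1 G1 (fun x => f x * g x) (2 * (c * d)).
Proof.
move=> [f' [df sf sf']] [g' [dg sg sg']].
have c0 := supB_ge0 sf; have d0 : 0 <= d by case: sg => /supB_ge0.
exists (fun x => f' x * g x + f x * g' x); split; first exact: hderivM.
  by apply: gauge_le (L1M sf sg) _; rewrite ler_peMl ?mulr_ge0//; lra.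
rewrite (_ : 2 * _ = c * d + c * d); last by ring.
by apply: gaugeD; exact: L1M.
Qed.

Section nemytskii.
Variables (V : normedModType R).
Implicit Types (p q h : V).

(** [GC1 N] is [N] for the function and for its derivative, and differentiation in
  [x] commutes with the differential in the parameter. *)
Lemma C11_derivative (N : gauge R) p (Phi Psi : V -> R -> R) dPhi dPsi r1 r2 C1 C2 :
  (forall q, hderiv (Phi q) (Psi q)) ->
  (forall q h, hderiv (dPhi q h) (dPsi q h)) ->
  C11_in N p Phi dPhi r1 C1 -> C11_in N p Psi dPsi r2 C2 ->
  C11 (GC1 N) p Phi.
Proof.
move=> d1 d2 H1 H2.
have [r10 C10 _] := H1; have [r20 C20 _] := H2.
pose r := Num.min r1 r2; pose C := Num.max C1 C2.
have r0 : 0 < r by rewrite lt_min r10.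
have [_ _ {}H1] : C11_in N p Phi dPhi r C.
  by apply: C11_in_shrink H1; rewrite // ?ge_min ?le_max lexx.
have [_ C0 {}H2] : C11_in N p Psi dPsi r C.
  by apply: C11_in_shrink H2; rewrite // ?ge_min ?le_max lexx orbT.
exists dPhi, r, C; split => // q qr.
have [a1 a2 a3 a4] := H1 q qr; have [b1 b2 b3 b4] := H2 q qr.
split => //.
- by exists (Psi q).
- by move=> h; exists (dPsi q h).
- move=> q' q'r; have [a5 a6 a7] := a4 q' q'r; have [b5 b6 b7] := b4 q' q'r.
  split.
  + by exists (fun x => Psi q' x - Psi q x); split => //; exact: hderivB.
  + by move=> h; exists (fun x => dPsi q' h x - dPsi q h x); split => //; exact: hderivB.
  + exists (fun x => Psi q' x - Psi q x - dPsi q (q' - q) x); split => //.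
    by apply: hderivB => //; exact: hderivB.
Qed.

Variables (l : V -> R -> R) (K : R).
Hypothesis K0 : 0 <= K.
Hypothesis linl : forall a h k, l (a *: h + k) = (fun x => a * l h x + l k x).
Hypothesis supl : forall h, Gsup (l h) (K * `|h|).

Let lB h k x : l (h - k) x = l h x - l k x.
Proof.
have -> : h - k = (-1) *: k + h by lmod R.
by rewrite linl; ring.
Qed.

Let lbound p q x : `|q - p| < 1 -> `|l q x| <= K * (`|p| + 1).
Proof.
move=> qp; have [_ /(_ x) h] := supl q; apply: (le_trans h).
rewrite ler_wpM2l//; have := ler_normD (q - p) p; rewrite subrK; lra.
Qed.

Lemma exp_taylor (M u v : R) : u <= M -> v <= M ->
  `|expR v - expR u| <= expR M * `|v - u| /\
  `|expR v - expR u - expR u * (v - u)| <= expR M * `|v - u| ^+ 2.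
Proof.
move=> uM vM.
have dexp : hderiv (@expR R) (@expR R) by move=> x; exact: is_derive_expR.
have A (a b : R) : a <= M -> b <= M -> `|expR b - expR a| <= expR M * `|b - a|.
  move=> aM bM; wlog ab : a b aM bM / a <= b.
    move=> W; have [/W|/ltW ba] := leP a b; first exact.
    by rewrite distrC (distrC b); exact: W.
  have [c /andP[ac cb] ->] := mvt dexp ab.
  rewrite normrM ler_wpM2r// ger0_norm ?expR_ge0// ler_expR.
  exact: le_trans bM.
split; first exact: A.
have [c cI ->] : exists2 c, c <= M /\ `|c - u| <= `|v - u| & expR v - expR u = expR c * (v - u).
  have [uv|/ltW vu] := leP u v.
    have [c /andP[uc cv] E] := mvt dexp uv; exists c => //.
    by split; [exact: le_trans vM|rewrite !ger0_norm ?lerD2r// subr_ge0//; exact: le_trans cv].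
  have [c /andP[vc cu] E] := mvt dexp vu; exists c.
    split; first exact: le_trans uM.
    by rewrite !ler0_norm ?lerN2 ?lerD2r// subr_le0.
  by rewrite -opprB E; ring.
have [cM cu] := cI; rewrite -mulrBl normrM expr2 mulrA ler_wpM2r//.
by rewrite (le_trans (A _ _ uM cM))// ler_wpM2l// expR_ge0.
Qed.

(** Superposition operators [q |-> g (l q)]. The values of [l q] stay in a set [I] on
  which [g] satisfies first and second order Taylor estimates; since [l] is bounded
  for the uniform norm, these pointwise estimates are uniform in [x]. *)
Lemma C11_in_superposition p (g g' : R -> R) (I : set R) (r C : R) : 0 < r -> 0 <= C ->
  (forall q x, `|q - p| < r -> I (l q x)) ->
  (forall u v, I u -> I v -> [/\ `|g u| <= C, `|g' u| <= C, `|g v - g u| <= C * `|v - u|,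
    `|g' v - g' u| <= C * `|v - u| &
    `|g v - g u - g' u * (v - u)| <= C * `|v - u| ^+ 2]) ->
  C11_in Gsup p (fun q x => g (l q x)) (fun q h x => g' (l q x) * l h x) r
    (C * (1 + K) ^+ 2).
Proof.
move=> r0 C0 Il H; have K0' := K0.
have bl h x : `|l h x| <= K * `|h| by have [_ /(_ x)] := supl h.
have cl h : continuous (l h) by have [] := supl h.
have KK : 0 <= K ^+ 2 by exact: exprn_ge0.
have KE : (1 + K) ^+ 2 = 1 + 2 * K + K ^+ 2 by ring.
have K1 : 1 <= (1 + K) ^+ 2 by rewrite KE; lra.
have K2 : K <= (1 + K) ^+ 2 by rewrite KE; lra.
have K3 : K ^+ 2 <= (1 + K) ^+ 2 by rewrite KE; lra.
have cI q (G : R -> R) : `|q - p| < r ->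
    (forall u v, I u -> I v -> `|G v - G u| <= C * `|v - u|) ->
    continuous (fun x => G (l q x)).
  move=> qr GL x; have C1 : 0 < C + 1 by rewrite ltr_wpDl.
  apply/cvgrPdist_le => e e0; have ce : 0 < e / (C + 1) by rewrite divr_gt0.
  have /cvgrPdist_le/(_ _ ce) := cl q x; apply: filterS => y h.
  apply: (le_trans (GL _ _ (Il q y qr) (Il q x qr))).
  apply: (@le_trans _ _ ((C + 1) * `|l q x - l q y|)); first by rewrite ler_wpM2r// lerDl.
  by rewrite mulrC -ler_pdivlMr.
have cg q (qr : `|q - p| < r) : continuous (fun x => g (l q x)).
  by apply: cI => // u v Iu Iv; have [] := H u v Iu Iv.
have cg' q (qr : `|q - p| < r) : continuous (fun x => g' (l q x)).
  by apply: cI => // u v Iu Iv; have [] := H u v Iu Iv.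
split => //; first by rewrite mulr_ge0// exprn_ge0// addr_ge0.
move=> q qp; split.
- split=> [|x]; first exact: cg.
  have [h _ _ _ _] := H _ _ (Il q x qp) (Il q x qp).
  by rewrite (le_trans h)// ler_peMr.
- by move=> a h k; apply/funext => x; rewrite linl; ring.
- move=> h; split; first by apply: contM => //; exact: cg'.
  move=> x; have [_ h1 _ _ _] := H _ _ (Il q x qp) (Il q x qp).
  rewrite normrM (@le_trans _ _ (C * (K * `|h|)))//; first exact: ler_pM.
  by rewrite -mulrA ler_wpM2l// ler_wpM2r.
- move=> q' q'p.
  have hx x := H _ _ (Il q x qp) (Il q' x q'p).
  split.
  + split=> [|x]; first by apply: contB; exact: cg.
    have [_ _ h1 _ _] := hx x; rewrite -lB in h1.
    rewrite (le_trans h1)// -mulrA ler_wpM2l// (le_trans (bl _ _))//.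
    by rewrite ler_wpM2r.
  + move=> h; split; first by apply: contB; apply: contM => //; exact: cg'.
    move=> x; have [_ _ _ h1 _] := hx x; rewrite -lB in h1.
    rewrite -mulrBl normrM.
    apply: (@le_trans _ _ ((C * (K * `|q' - q|)) * (K * `|h|))).
      by apply: ler_pM => //; apply: (le_trans h1); rewrite ler_wpM2l.
    rewrite (_ : _ * _ * _ = C * K ^+ 2 * `|q' - q| * `|h|); last by ring.
    by rewrite !ler_wpM2r// ler_wpM2l.
  + split=> [|x].
      by apply: contB; [apply: contB; exact: cg|apply: contM => //; exact: cg'].
    have [_ _ _ _ h1] := hx x; rewrite lB (le_trans h1)// -lB.
    apply: (@le_trans _ _ (C * (K * `|q' - q|) ^+ 2)).
      by rewrite ler_wpM2l// lerXn2r// nnegrE// mulr_ge0.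
    by rewrite exprMn mulrA ler_wpM2r ?exprn_ge0// ler_wpM2l.
Qed.

Let C11_in_exp p : C11_in Gsup p (fun q x => expR (l q x))
  (fun q h x => expR (l q x) * l h x) 1 (expR (K * (`|p| + 1)) * (1 + K) ^+ 2).
Proof.
set M := K * _.
apply: (@C11_in_superposition p expR expR [set u | u <= M] 1 (expR M)) => //.
  by move=> q x qp; exact: le_trans (ler_norm _) (lbound _ qp).
move=> u v uM vM; have [h1 h2] := exp_taylor uM vM.
by split => //; rewrite ger0_norm ?expR_ge0// ler_expR.
Qed.

Lemma C11_exp p (l' : V -> R -> R) :
  (forall h, hderiv (l h) (l' h)) -> (forall h, Gsup (l' h) (K * `|h|)) ->
  C11 (GC1 Gsup) p (fun q x => expR (l q x)).
Proof.
move=> dl supl'.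
have linl' a h k : l' (a *: h + k) = (fun x => a * l' h x + l' k x).
  rewrite -(hderiv1E (dl (a *: h + k))) linl.
  exact/hderiv1E/(hderivD (hderivZ a (dl h)) (dl k)).
apply: (C11_derivative _ _ (C11_in_exp p)
  (C11_in_mul ler01 (product_const1 (N1:=Gsup) (N2:=Gsup) (N3:=Gsup) supM)
    (C11_in_linear p K0 linl' supl') (C11_in_exp p))).
- by move=> q; exact: hderiv_exp.
- move=> q h; apply: hderiv_eq (hderivM (hderiv_exp (dl q)) (dl h)) _ => x /=.
  by ring.
Qed.

Lemma inv_taylor (a u v : R) : 0 < a -> a <= 1 + u -> a <= 1 + v ->
  let C := 2 * (1 + a^-1) ^+ 3 in
  [/\ `|(1 + u)^-1| <= C, `|- ((1 + u)^-1 ^+ 2)| <= C,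
    `|(1 + v)^-1 - (1 + u)^-1| <= C * `|v - u|,
    `|- ((1 + v)^-1 ^+ 2) - - ((1 + u)^-1 ^+ 2)| <= C * `|v - u| &
    `|(1 + v)^-1 - (1 + u)^-1 - - ((1 + u)^-1 ^+ 2) * (v - u)| <= C * `|v - u| ^+ 2].
Proof.
move=> a0 au av; set b := a^-1; move=> C.
have b0 : 0 <= b by rewrite invr_ge0 ltW.
have b2 : 0 <= b ^+ 2 by exact: exprn_ge0.
have b3 : 0 <= b ^+ 3 by exact: exprn_ge0.
have CE : C = 2 + 6 * b + 6 * b ^+ 2 + 2 * b ^+ 3 by rewrite /C; ring.
have bd w : a <= 1 + w -> `|(1 + w)^-1| <= b.
  move=> aw; rewrite ger0_norm ?invr_ge0; last by rewrite (le_trans _ aw)// ltW.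
  by rewrite lef_pV2// posrE (lt_le_trans a0).
have u0 : 1 + u != 0 by rewrite gt_eqF// (lt_le_trans a0).
have v0 : 1 + v != 0 by rewrite gt_eqF// (lt_le_trans a0).
have D1 : (1 + v)^-1 - (1 + u)^-1 = - ((1 + u)^-1 * (1 + v)^-1 * (v - u)).
  by field; rewrite u0 v0.
have D2 : - ((1 + v)^-1 ^+ 2) - - ((1 + u)^-1 ^+ 2) =
    ((1 + u)^-1 + (1 + v)^-1) * ((1 + u)^-1 * (1 + v)^-1) * (v - u).
  by field; rewrite u0 v0.
have D3 : (1 + v)^-1 - (1 + u)^-1 - - ((1 + u)^-1 ^+ 2) * (v - u) =
    (1 + u)^-1 ^+ 2 * (1 + v)^-1 * (v - u) ^+ 2.
  by field; rewrite u0 v0.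
rewrite D3 D1 D2 !normrN.
move: (bd u au) (bd v av); move: (1 + u)^-1 (1 + v)^-1 => x y xb yb.
have xx : `|x ^+ 2| <= b ^+ 2 by rewrite normrX lerXn2r ?nnegrE.
have xy : `|x * y| <= b ^+ 2 by rewrite normrM expr2 ler_pM.
split; [lra|lra|..].
- by rewrite normrM ler_wpM2r//; lra.
- rewrite normrM ler_wpM2r// normrM (@le_trans _ _ ((b + b) * b ^+ 2))//.
    by rewrite ler_pM// (le_trans (ler_normD _ _))// lerD.
  by rewrite (_ : _ * _ = 2 * b ^+ 3); [lra|ring].
- rewrite normrM normrX ler_wpM2r ?exprn_ge0// normrM (@le_trans _ _ (b ^+ 2 * b))//.
    exact: ler_pM.
  by rewrite (_ : _ * b = b ^+ 3); [lra|ring].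
Qed.

Lemma C11_inv p (a : R) : 0 < a -> (forall x, a * 2 <= 1 + l p x) ->
  C11 Gsup p (fun q x => (1 + l q x)^-1).
Proof.
move=> a0 la.
pose r := a / (K + 1).
have K1 : 0 < K + 1 by rewrite ltr_wpDl.
have r0 : 0 < r by rewrite divr_gt0.
have Kr : K * r <= a.
  by rewrite /r mulrA ler_pdivrMr// mulrC ler_wpM2l ?lerDl// ltW.
have lqa q x : `|q - p| < r -> a <= 1 + l q x.
  move=> qr; have [_ /(_ x)] := supl (q - p); rewrite lB => h.
  have : K * `|q - p| <= a by rewrite (le_trans _ Kr)// ler_wpM2l// ltW.
  by have := la x; move: h; rewrite ler_norml => /andP[]; lra.
have b0 : 0 <= a^-1 by rewrite invr_ge0 ltW.
do 3 eexists.
apply: (@C11_in_superposition p (fun u => (1 + u)^-1) (fun u => - ((1 + u)^-1 ^+ 2))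
  [set u | a <= 1 + u] r (2 * (1 + a^-1) ^+ 3)) => //.
  by rewrite mulr_ge0// exprn_ge0// addr_ge0.
by move=> u v au av; exact: inv_taylor.
Qed.

End nemytskii.
End concrete_gauges.

(** * The one-sided exponential kernels *)

Section kernels.
Variable R : realType.
Implicit Types (f g w : R -> R) (c d x : R).
Local Notation mu := (@lebesgue_measure R).

Definition ker x (t : R) : R := expR (- `|x - t|).

Lemma ker_cont x : continuous (ker x).
Proof.
apply: (@cont_comp _ (@expR R)); first exact: continuous_expR.
apply: contN; apply: cont_norm; apply: contB; first exact: cont_cst.
by move=> t; exact: cvg_id.
Qed.

(** The majorant has an explicit primitive; the inequality is
  [e^s >= 1 + s^2 / 2] for [s >= 0]. *)
Lemma ker_le x t : ker x t <= 2 * (1 + (t - x) ^+ 2)^-1.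
Proof.
have p : 0 < 1 + (t - x) ^+ 2 by rewrite ltr_wpDr// sqr_ge0.
rewrite /ker expRN ler_pdivlMr// ler_pdivrMl ?expR_gt0//.
have := expR_ge1Dxn 1 (normr_ge0 (x - t)).
rewrite real_normK ?num_real// (_ : (x - t) ^+ 2 = (t - x) ^+ 2); last by ring.
rewrite (_ : 2`! = 2%N)//; lra.
Qed.

Lemma ker_L1 x : L1le (ker x) 8.
Proof.
have datan : hderiv (@atan R) (fun x => (1 + x ^+ 2)^-1).
  by move=> y; exact: is_derive1_atan.
have dx : hderiv (fun t => t - x) (fun=> 1).
  by apply: (hderiv_eq (hderivB (@hderiv_id R) (hderiv_cst x))) => y; rewrite subr0.
exists (fun t => 2 * ((1 + (t - x) ^+ 2)^-1 * 1)), (fun t => 2 * atan (t - x)); split.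
- apply: contZ; apply: contM; last exact: cont_cst.
  apply: contV => [|y]; last by rewrite gt_eqF// ltr_wpDr// sqr_ge0.
  have cx := hderiv_cont dx.
  by apply: contD; [exact: cont_cst|exact: contM].
- by move=> t; rewrite mulr1 ger0_norm ?expR_ge0// ker_le.
- exact/hderivZ/(hderiv_comp datan dx).
- move=> y z.
  have h1 := atan_ltpi2 (z - x); have h2 := atan_gtNpi2 (y - x).
  have p4 : pi <= 4 :> R by have := pihalf_lt2 R; lra.
  lra.
Qed.

Lemma L1_integrable g c : continuous g -> L1le g c ->
  mu.-integrable setT (EFin \o g).
Proof.
move=> cg lg; apply/integrableP; split.
  by apply/measurable_EFinP; exact: continuous_measurable_fun.
under eq_integral do rewrite /= .
exact: le_lt_trans (L1le_int cg lg) (ltry _).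
Qed.

Lemma ker_int f c x : Gsup R f c -> mu.-integrable setT (EFin \o (fun t => ker x t * f t)).
Proof.
move=> [cf bf]; apply: (@L1_integrable _ (c * 8)).
  by apply: contM => //; exact: ker_cont.
have := L1leM (ker_L1 x) bf; rewrite (_ : (fun _ => _) = (fun t => ker x t * f t))//.
by apply/funext => t; rewrite mulrC.
Qed.

(** The two halves of the convolution with [e^-|x|]. Each of them solves a first order
  equation, which is how they are known in what follows. *)
Definition Km f x := (\int[mu]_(t in `]-oo, x]) (ker x t * f t))%R.
Definition Kp f x := (\int[mu]_(t in `]x, +oo[) (ker x t * f t))%R.

Lemma split_line f c x : Gsup R f c ->
  (\int[mu]_t (ker x t * f t))%R = Km f x + Kp f x.
Proof.
move=> sf.
have E : [set: R] = `]-oo, x]%classic `|` `]x, +oo[%classic.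
  by rewrite -setCitvl setUv.
rewrite {1}E Rintegral_setU//; try exact: measurable_itv.
- by rewrite -E; exact: ker_int sf.
- by apply/disj_setPLR; rewrite -setCitvl setCK.
Qed.

Lemma helmholtz_split f c x : Gsup R f c ->
  helmholtz_inv f x = 2^-1 * (Km f x + Kp f x).
Proof. by move=> sf; rewrite /helmholtz_inv -(split_line x sf). Qed.

Lemma ker_shift (u x t : R) : t <= x -> x <= u -> ker x t = expR (u - x) * ker u t.
Proof.
move=> tx xu; rewrite /ker -expRD !ger0_norm ?subr_ge0//; last exact: le_trans xu.
by congr expR; ring.
Qed.

Lemma ker_shift' (u x t : R) : x <= t -> u <= x -> ker x t = expR (x - u) * ker u t.
Proof.
move=> tx xu; rewrite /ker -expRD !ler0_norm ?subr_le0//; last exact: le_trans tx.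
by congr expR; ring.
Qed.

Lemma primitive_ker f c (u x : R) : Gsup R f c ->
  is_derive x 1 (fun x => \int[mu]_(t in `]-oo, x]) (ker u t * f t))%R (ker u x * f x).
Proof.
move=> sf; have [cf _] := sf.
have cg : continuous (fun t => ker u t * f t) by apply: contM => //; exact: ker_cont.
have [||d E] := @continuous_FTC1 R (fun t => ker u t * f t) -oo%O x (x + 1) _ _
    (ltNyr _) (cg x).
- by rewrite ltrDl.
- by apply: integrableS (ker_int u sf) => //; exact: measurable_itv.
- by rewrite -E derive1E; exact/derivableP.
Qed.

Lemma exp_deriv (a u : R) :
  hderiv (fun x => expR (a * x + u)) (fun x => a * expR (a * x + u)).
Proof.
apply: (hderiv_eq (hderiv_exp (hderivD (hderivZ a (@hderiv_id R)) (hderiv_cst u)))).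
by move=> y /=; rewrite mulr1 addr0.
Qed.

(** For [x] on the left of a fixed [u] the kernel is [e^(u - x) e^-|u - t|], so that [x]
  only enters through a factor and through the end point of the integral. *)
Lemma Km_deriv f c : Gsup R f c -> hderiv (Km f) (fun x => f x - Km f x).
Proof.
move=> sf x; pose u := x + 1.
pose G (y : R) := expR (-1 * y + u) * (\int[mu]_(t in `]-oo, y]) (ker u t * f t))%R.
have E y : y <= u -> Km f y = G y.
  move=> yu; rewrite /G -RintegralZl//; first last.
  - by apply: integrableS (ker_int u sf) => //; exact: measurable_itv.
  apply: eq_Rintegral => t; rewrite inE/= in_itv/= => ty.
  by rewrite (ker_shift ty yu) mulrA mulN1r addrC.
apply: (@near_eq_is_derive _ _ _ G).
  near=> y; rewrite E// ltW//; near: y.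
  by apply: lt_nbhsl; rewrite /u ltrDl.
apply: (is_derive_eq (is_deriveM (exp_deriv (-1) u x) (primitive_ker u x sf))).
rewrite E; last by rewrite lerDl.
rewrite /G /GRing.scale/= mulrA /ker -expRD ger0_norm ?subr_ge0 ?lerDl//.
rewrite (_ : -1 * x + u - (u - x) = 0); last by ring.
by rewrite expR0; ring.
Unshelve. all: by end_near. Qed.

(** As for [Km], with [u] on the left of [x]; the integral over a right half-line is
  the complement of an integral over a left one. *)
Lemma Kp_deriv f c : Gsup R f c -> hderiv (Kp f) (fun x => Kp f x - f x).
Proof.
move=> sf x; pose u := x - 1.
pose T := (\int[mu]_t (ker u t * f t))%R.
pose G (y : R) := expR (1 * y + - u) * (T - (\int[mu]_(t in `]-oo, y]) (ker u t * f t))%R).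
have E y : u <= y -> Kp f y = G y.
  move=> uy; rewrite /G.
  have -> : T - (\int[mu]_(t in `]-oo, y]) (ker u t * f t))%R =
      (\int[mu]_(t in `]y, +oo[) (ker u t * f t))%R.
    have F : [set: R] = `]-oo, y]%classic `|` `]y, +oo[%classic.
      by rewrite -setCitvl setUv.
    rewrite /T {1}F Rintegral_setU; try exact: measurable_itv.
    - by rewrite addrC addKr.
    - by rewrite -F; exact: ker_int sf.
    - by apply/disj_setPLR; rewrite -setCitvl setCK.
  rewrite -RintegralZl//; first last.
  - by apply: integrableS (ker_int u sf) => //; exact: measurable_itv.
  apply: eq_Rintegral => t; rewrite inE/= in_itv/= andbT => /ltW ty.
  by rewrite (ker_shift' ty uy) mulrA mul1r.
apply: (@near_eq_is_derive _ _ _ G).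
  near=> y; rewrite E// ltW//; near: y.
  by apply: lt_nbhsr; rewrite /u gtrBl.
apply: (is_derive_eq (is_deriveM (exp_deriv 1 (- u) x)
  (is_deriveB (is_derive_cst T x 1) (primitive_ker u x sf)))).
rewrite E; last by rewrite gerBl.
rewrite /G /GRing.scale/= sub0r mulrN mulrA /ker -expRD ler0_norm ?subr_le0 ?gerBl//.
rewrite (_ : 1 * x - u - - (u - x) = 0); last by ring.
rewrite expR0 -[(cst T - _) x]/(T - _); ring.
Unshelve. all: by end_near. Qed.

(** In the derivative of [Km f + Kp f] the two local terms [f] cancel. *)
Lemma Lop_split f c x : Gsup R f c -> Lop f x = 2^-1 * (Kp f x - Km f x).
Proof.
move=> sf; rewrite /Lop.
have -> : helmholtz_inv f = fun x => 2^-1 * (Km f x + Kp f x).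
  by apply/funext => y; exact: helmholtz_split sf.
rewrite (hderiv1E (hderivZ 2^-1 (hderivD (Km_deriv sf) (Kp_deriv sf)))).
by congr (_ * _); ring.
Qed.

Lemma Kint_le f c x (A : set (measurableTypeR R)) : measurable A -> Gsup R f c ->
  `|(\int[mu]_(t in A) (ker x t * f t))%R| <= 8 * c.
Proof.
move=> mA sf; have [cf bf] := sf.
have iA : mu.-integrable A (EFin \o (fun t => ker x t * f t)).
  by apply: integrableS (ker_int x sf).
apply: (le_trans (le_normr_Rintegral mA iA)).
have [cn lk] : continuous (fun t => ker x t * f t) /\ L1le (fun t => ker x t * f t) (8 * c).
  split; first by apply: contM => //; exact: ker_cont.
  rewrite mulrC; have := L1leM (ker_L1 x) bf.
  by rewrite (_ : (fun _ => _) = (fun t => ker x t * f t))//; apply/funext => t; rewrite mulrC.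
rewrite -lee_fin /Rintegral fineK; last first.
  apply: integrable_fin_num => //.
  have /integrable_norm := iA; rewrite /comp/=; exact.
apply: le_trans (L1le_int cn lk).
apply: ge0_subset_integral => //.
- apply/measurable_EFinP; apply: continuous_measurable_fun; exact: cont_norm.
Qed.

Lemma Km_le f c x : Gsup R f c -> `|Km f x| <= 8 * c.
Proof. by move=> sf; apply: Kint_le => //; exact: measurable_itv. Qed.
Lemma Kp_le f c x : Gsup R f c -> `|Kp f x| <= 8 * c.
Proof. by move=> sf; apply: Kint_le => //; exact: measurable_itv. Qed.

Lemma Gsup_norm f c : Gsup R f c -> Gsup R (fun x => `|f x|) c.
Proof.
by move=> [cf bf]; split; [exact: cont_norm|move=> x; rewrite normr_id].
Qed.

Lemma Kint_norm f c x (A : set (measurableTypeR R)) : measurable A -> Gsup R f c ->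
  `|(\int[mu]_(t in A) (ker x t * f t))%R| <= (\int[mu]_(t in A) (ker x t * `|f t|))%R.
Proof.
move=> mA sf.
have iA : mu.-integrable A (EFin \o (fun t => ker x t * f t)).
  by apply: integrableS (ker_int x sf).
apply: (le_trans (le_normr_Rintegral mA iA)).
rewrite le_eqVlt; apply/orP; left; apply/eqP; apply: eq_Rintegral => t _.
by rewrite normrM ger0_norm ?expR_ge0.
Qed.

(** The function [w e^phi] is constant, and [e^phi] takes arbitrarily small values
  while [w] stays bounded. *)
Lemma bounded_decay w (phi dphi : R -> R) M : hderiv phi dphi ->
  hderiv w (fun x => - dphi x * w x) -> (forall x, `|w x| <= M) ->
  (forall y, exists x, phi x = y) -> forall x, w x = 0.
Proof.
move=> dp dw wM onto x.
have d0 : hderiv (fun x => w x * expR (phi x)) (fun=> 0).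
  by apply: (hderiv_eq (hderivM dw (hderiv_exp dp))) => y /=; ring.
pose k := w x * expR (phi x).
have M0 : 0 <= M by exact: le_trans (wM 0).
have kM e : 0 < e -> `|k| <= M * e.
  move=> e0; have [z ze] := onto (ln e).
  rewrite /k (hderiv0_const d0 x z) normrM ze lnK// (gtr0_norm e0).
  by rewrite ler_wpM2r// ltW.
suff /eqP : k = 0 by rewrite mulf_eq0 (gt_eqF (expR_gt0 _)) orbF => /eqP.
apply/eqP; rewrite -normr_le0; apply/ler_addgt0Pr => e e0.
have M1 : 0 < M + 1 by rewrite ltr_wpDl.
apply: (le_trans (kM _ (divr_gt0 e0 M1))).
rewrite add0r mulrA ler_pdivrMr// mulrC ler_wpM2l ?lerDl//.
exact: ltW.
Qed.

(** The two kernels are treated together: [K f] is the bounded solution of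
  [y' = s (f - y)], with [s = 1] for [Km] and [s = -1] for [Kp]. *)
Section one_sided.
Variables (K : (R -> R) -> R -> R) (s : R).
Hypothesis ss : s * s = 1.
Hypothesis K_deriv : forall f c, Gsup R f c ->
  hderiv (K f) (fun x => s * (f x - K f x)).
Hypothesis K_le : forall f c x, Gsup R f c -> `|K f x| <= 8 * c.
Hypothesis K_norm : forall f c x, Gsup R f c -> `|K f x| <= K (fun t => `|f t|) x.

Let s1 : `|s| = 1.
Proof. by apply/eqP; rewrite -(@eqrXn2 _ 2)// expr1n real_normK ?num_real// expr2 ss. Qed.

(** The difference of two bounded solutions solves [w' = - s w]. *)
Lemma K_unique f c (y : R -> R) M : Gsup R f c ->
  hderiv y (fun x => s * (f x - y x)) -> (forall x, `|y x| <= M) -> y = K f.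
Proof.
move=> sf dy yM; apply/funext => x; apply/eqP; rewrite -subr_eq0; apply/eqP.
apply: (@bounded_decay (fun x => y x - K f x) (fun x => s * x) (fun=> s * 1) (M + 8 * c)).
- exact: (hderivZ s (@hderiv_id R)).
- by apply: (hderiv_eq (hderivB dy (K_deriv sf))) => z /=; ring.
- by move=> z; rewrite (le_trans (ler_normB _ _))// lerD// (K_le _ sf).
- by move=> z; exists (s * z); rewrite mulrA ss mul1r.
Qed.

(** By uniqueness, as both sides solve the same equation. *)
Lemma K_lin f g a c d : Gsup R f c -> Gsup R g d ->
  K (fun x => a * f x + g x) = (fun x => a * K f x + K g x).
Proof.
move=> sf sg; apply/esym.
apply: (@K_unique _ (`|a| * c + d) _ (`|a| * (8 * c) + 8 * d)).
- exact: (gaugeD (gaugeZ a sf) sg).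
- by apply: (hderiv_eq (hderivD (hderivZ a (K_deriv sf)) (K_deriv sg))) => x /=; ring.
- move=> x; rewrite (le_trans (ler_normD _ _))// normrM.
  by rewrite lerD ?ler_wpM2l// ?(K_le _ sf)// (K_le _ sg).
Qed.

(** Integrability of [K f]: for [y = K |f|] and a primitive [F] of a majorant of
  [|f|], the function [F - s y] is bounded and its derivative bounds [y], since
  [y' = s (|f| - y)]; this avoids Fubini's theorem. *)
Lemma K_L1 f c : G1 R f c -> L1le (K f) (9 * c).
Proof.
move=> [sf lf vf]; have [k [F [ck fk dF Fc]]] := lf; have [cf _] := sf.
have sn := Gsup_norm sf; have dy := K_deriv sn; have ss1 := ss.
have y0 x : 0 <= K (fun t => `|f t|) x by exact: le_trans (K_norm x sf).
exists (fun x => k x - s * (s * (`|f x| - K (fun t => `|f t|) x))),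
  (fun x => F x - s * K (fun t => `|f t|) x); split.
- apply: contB => //; do 2 apply: contZ.
  by apply: contB; [exact: cont_norm|exact: hderiv_cont dy].
- move=> x; apply: (le_trans (K_norm x sf)).
  by rewrite mulrA ss mul1r; have := fk x; lra.
- by apply: hderivB => //; exact: hderivZ.
- move=> x z; have := Fc x z.
  have := K_le x sn; have := K_le z sn.
  rewrite (ger0_norm (y0 x)) (ger0_norm (y0 z)) => h1 h2.
  have : `|K (fun t => `|f t|) x - K (fun t => `|f t|) z| <= 8 * c.
    by rewrite ler_norml; have := y0 x; have := y0 z; lra.
  have := ler_norm (s * (K (fun t => `|f t|) x - K (fun t => `|f t|) z)).
  by rewrite normrM s1 mul1r mulrBr; lra.
Qed.

Lemma K_G1 f c : G1 R f c -> GC1 (G1 R) (K f) (10 * c).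
Proof.
move=> Gf; have [sf lf vf] := Gf; have c0 := supB_ge0 sf; have [cf fb] := sf.
have d := K_deriv sf; have LK := K_L1 Gf.
have GK : G1 R (K f) (9 * c).
  split => //.
    split; first exact: hderiv_cont d.
    by move=> x; rewrite (le_trans (K_le _ sf))//; lra.
  apply: (L1_vanish (M := 9 * c) LK) => u v; apply: mvt_norm d _ => x.
  rewrite normrM s1 mul1r (le_trans (ler_normB _ _))//.
  by have := fb x; have := K_le x sf; lra.
exists (fun x => s * (f x - K f x)); split => //; first by apply: gauge_le GK _; lra.
by apply: gauge_le (gaugeZ s (gaugeB Gf GK)) _; rewrite s1; lra.
Qed.

End one_sided.

Lemma Km_norm f c x : Gsup R f c -> `|Km f x| <= Km (fun t => `|f t|) x.
Proof. by move=> sf; apply: (Kint_norm _ _ sf); exact: measurable_itv. Qed.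
Lemma Kp_norm f c x : Gsup R f c -> `|Kp f x| <= Kp (fun t => `|f t|) x.
Proof. by move=> sf; apply: (Kint_norm _ _ sf); exact: measurable_itv. Qed.

Let Km_ode f c : Gsup R f c -> hderiv (Km f) (fun x => 1 * (f x - Km f x)).
Proof. by move=> /Km_deriv d; apply: hderiv_eq d _ => x; rewrite mul1r. Qed.
Let Kp_ode f c : Gsup R f c -> hderiv (Kp f) (fun x => -1 * (f x - Kp f x)).
Proof. by move=> /Kp_deriv d; apply: hderiv_eq d _ => x; rewrite mulN1r opprB. Qed.
Let mulNN1 : -1 * -1 = 1 :> R. Proof. by rewrite mulrNN mulr1. Qed.

Definition Km_lin := K_lin (mulr1 1) Km_ode Km_le.
Definition Kp_lin := K_lin mulNN1 Kp_ode Kp_le.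
Definition Km_G1 := K_G1 (mulr1 1) Km_ode Km_le Km_norm.
Definition Kp_G1 := K_G1 mulNN1 Kp_ode Kp_le Kp_norm.

End kernels.

(** * The space V1 *)

Section V1_facts.
Variable R : realType.
Implicit Types (f g : R -> R) (c d e : R) (u v w : V1 R).
Local Notation mu := (@lebesgue_measure R).

Lemma V1_hderiv u : hderiv u (derive1 u).
Proof. by apply: derivable_hderiv; case: (V1P u). Qed.

Lemma V1_derive_cont u : continuous (derive1 u).
Proof. by case: (V1P u). Qed.

Lemma V1_normE u : `|u| = V1_norm u. Proof. by []. Qed.

Lemma le_sup_norm u x : `|u x| <= sup (range (fun x => `|u x|)).
Proof. by apply: ub_le_sup; [exact: V1_has_ubound|exists x]. Qed.

Lemma le_sup_norm' u x : `|derive1 u x| <= sup (range (fun x => `|derive1 u x|)).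
Proof. by apply: ub_le_sup; [exact: V1_has_ubound'|exists x]. Qed.

Lemma V1_sup_ge0 u : 0 <= sup (range (fun x => `|u x|)).
Proof. exact: le_trans (le_sup_norm u 0). Qed.

Lemma V1_sup_ge0' u : 0 <= sup (range (fun x => `|derive1 u x|)).
Proof. exact: le_trans (le_sup_norm' u 0). Qed.

Lemma V1_le u x : `|u x| <= `|u|.
Proof.
rewrite V1_normE /V1_norm (le_trans (le_sup_norm u x))// -addrA lerDl.
by rewrite addr_ge0 ?sqrtr_ge0 ?V1_sup_ge0'.
Qed.

Lemma V1_le' u x : `|derive1 u x| <= `|u|.
Proof.
rewrite V1_normE /V1_norm (le_trans (le_sup_norm' u x))// addrAC lerDr.
by rewrite addr_ge0 ?sqrtr_ge0 ?V1_sup_ge0.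
Qed.

Lemma V1_eq u v : u =1 v -> u = v.
Proof. by move=> uv; apply/val_inj/funext. Qed.

Lemma V1_derive1D u v : derive1 (u + v : V1 R) = (fun x => derive1 u x + derive1 v x).
Proof. exact: hderiv1E (hderivD (V1_hderiv u) (V1_hderiv v)). Qed.
Lemma V1_derive1B u v : derive1 (u - v : V1 R) = (fun x => derive1 u x - derive1 v x).
Proof. exact: hderiv1E (hderivB (V1_hderiv u) (V1_hderiv v)). Qed.
Lemma V1_derive1Z c u : derive1 (c *: u : V1 R) = (fun x => c * derive1 u x).
Proof. exact: hderiv1E (hderivZ c (V1_hderiv u)). Qed.

Lemma V1_dist_le u v x : `|derive1 u x - derive1 v x| <= `|u - v|.
Proof. by have := V1_le' (u - v) x; rewrite V1_derive1B. Qed.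

Lemma sq_Rint_L1le f : continuous f -> mu.-integrable setT (EFin \o (fun x => f x ^+ 2)) ->
  L1le (fun x => f x ^+ 2) (\int[mu]_x (f x ^+ 2)).
Proof.
move=> cf h; apply: int_L1le; first by apply: contM.
rewrite /Rintegral fineK; last exact: integrable_fin_num.
by rewrite (_ : (fun x => (`|f x ^+ 2|)%:E) = (fun x => (f x ^+ 2)%:E))//;
  apply/funext => x; rewrite ger0_norm ?sqr_ge0.
Qed.

Lemma sq_L1le_integrable f c : continuous f -> L1le (fun x => f x ^+ 2) c ->
  mu.-integrable setT (EFin \o (fun x => f x ^+ 2)) /\ \int[mu]_x (f x ^+ 2) <= c.
Proof.
move=> cf lf; have cf2 : continuous (fun x => f x ^+ 2) by apply: contM.
have i := L1_integrable cf2 lf; split => //.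
rewrite -lee_fin /Rintegral fineK; last exact: integrable_fin_num.
have := L1le_int cf2 lf.
by rewrite (_ : (fun x => (`|f x ^+ 2|)%:E) = (fun x => (f x ^+ 2)%:E))//;
  apply/funext => x; rewrite ger0_norm ?sqr_ge0.
Qed.

Lemma V1_L2 u : L1le (fun x => u x ^+ 2) (`|u| ^+ 2) /\
  L1le (fun x => derive1 u x ^+ 2) (`|u| ^+ 2).
Proof.
have [du cu bu iu iu' _ _] := V1P u; have cu0 := is_V1_cont (V1P u).
pose I := \int[mu]_x (u x ^+ 2); pose I' := \int[mu]_x (derive1 u x ^+ 2).
have I0 : 0 <= I by exact: J_ge0.
have I'0 : 0 <= I' by exact: J_ge0.
have h : I + I' <= `|u| ^+ 2.
  rewrite -(sqr_sqrtr (addr_ge0 I0 I'0)) lerXn2r// ?nnegrE ?sqrtr_ge0//.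
  by rewrite V1_normE /V1_norm lerDr addr_ge0 ?V1_sup_ge0 ?V1_sup_ge0'.
split; (apply: L1le_mono; first exact: sq_Rint_L1le); rewrite -/I -/I'; lra.
Qed.

(** A function with an integrable square and a bounded derivative tends to zero: its
  square is integrable and Lipschitz. *)
Lemma V1_G2 u : G2 R u `|u|.
Proof.
have [l2 _] := V1_L2 u; have cu := hderiv_cont (V1_hderiv u).
split => //; first by split => // x; exact: V1_le.
have v2 : vanish (fun x => u x ^+ 2).
  apply: (L1_vanish (M := 2 * `|u| ^+ 2) l2) => x y.
  apply: (mvt_norm y x (hderivM (V1_hderiv u) (V1_hderiv u))) => z.
  rewrite (le_trans (ler_normD _ _))// !normrM expr2 mulrDl mul1r.
  by rewrite lerD// ler_pM// ?V1_le ?V1_le'.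
move=> e e0; have [N hN] := v2 (e ^+ 2) (exprn_gt0 _ e0).
exists N => x /hN; rewrite normrX ler_pXn2r// ?nnegrE//; exact: ltW.
Qed.

Lemma V1_G2' u : G2 R (derive1 u) `|u|.
Proof.
have [_ l2] := V1_L2 u; split => //.
  by split => [|x]; [exact: V1_derive_cont|exact: V1_le'].
by have [_ _ _ _ _ hy hNy] := V1P u; exact: cvg_vanish.
Qed.

(** The converse of [V1_G2] and [V1_G2']: the bridge from gauges back to the normed
  space. *)
Lemma V1_intro f f' c : hderiv f f' -> G2 R f c -> G2 R f' c ->
  exists w : V1 R, w = f :> (R -> R) /\ `|w| <= 4 * c.
Proof.
move=> df [[cf bf] lf _] [[cf' bf'] lf' vf'].
have E := hderiv1E df; have c0 : 0 <= c by exact: le_trans (bf 0).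
have [i1 I1] := sq_L1le_integrable cf lf; have [i2 I2] := sq_L1le_integrable cf' lf'.
have H : is_V1 f.
  have [vy vNy] := vanish_cvg vf'.
  split; rewrite ?E//; first by move=> x; have [] := df x.
  by exists c.
exists (MkV1 (mem_set H)); split => //; rewrite V1_normE /V1_norm/= E.
rewrite (_ : 4 * c = c + c + 2 * c); last by ring.
apply: lerD; first apply: lerD.
- by apply: ge_sup => [|_ [x _ <-]]; [exists `|f 0|, 0|].
- by apply: ge_sup => [|_ [x _ <-]]; [exists `|f' 0|, 0|].
- rewrite -[leRHS]ger0_norm ?mulr_ge0// -sqrtr_sqr ler_wsqrtr//.
  have := sqr_ge0 c; rewrite exprMn; lra.
Qed.

Definition V1B f c := exists2 w : V1 R, w = f :> (R -> R) & `|w| <= c.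

Program Definition GV : gauge R := @Gauge R V1B _ _ _ _.
Next Obligation. by move=> f c d [w wf wc] cd; exists w => //; exact: le_trans cd. Qed.
Next Obligation. by exists 0; rewrite ?normr0. Qed.
Next Obligation.
move=> f g c d [v vf vc] [w wf wc]; exists (v + w).
  by apply/funext => x; rewrite -vf -wf.
by rewrite (le_trans (ler_normD _ _))// lerD.
Qed.
Next Obligation.
move=> f c a [w wf wc]; exists (a *: w); first by apply/funext => x; rewrite -wf.
by rewrite normrZ ler_wpM2l.
Qed.

Lemma GC1_GV f c : GC1 (G1 R) f c -> GV f (4 * c).
Proof.
move=> [f' [df /G1_G2 sf /G1_G2 sf']].
by have [w [wf wc]] := V1_intro df sf sf'; exists w.
Qed.

(** The lower bounds [u n - K n] all lie below the upper bounds [u m + K m]; the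
  supremum of the former separates them. *)
Lemma R_geo_complete : geo_complete (R : normedModType R).
Proof.
move=> C u hu.
have h := hpow_cauchy hu.
pose K n := 2 * C * hpow R n.
have hub n m : u n - K n <= u m + K m.
  have C0 : 0 <= C by have := hu 0%N; rewrite /hpow expr0 mulr1; exact: le_trans.
  have K0 k : 0 <= K k by rewrite !mulr_ge0// hpow_ge0.
  have [nm|/ltnW mn] := leqP n m.
    by have := h _ _ nm; rewrite ler_norml => /andP[? ?]; have := K0 m; rewrite /K; lra.
  by have := h _ _ mn; rewrite ler_norml => /andP[? ?]; have := K0 n; rewrite /K; lra.
pose l := sup (range (fun n => u n - K n)); exists l => n.
have l1 : u n - K n <= l.
  by apply: ub_le_sup; [exists (u 0%N + K 0%N) => _ [m _ <-]|exists n].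
have l2 : l <= u n + K n.
  by apply: ge_sup => [|_ [m _ <-]]; [exists (u 0%N - K 0%N), 0%N|].
by rewrite ler_norml -/(K n); apply/andP; split; lra.
Qed.

(** Fatou's lemma. *)
Lemma L1le_limit (f : nat -> R -> R) g c K : (forall n, continuous (f n)) ->
  continuous g -> (forall n x, `|f n x - g x| <= K * hpow R n) ->
  (exists N, forall n, (N <= n)%N -> L1le (f n) c) -> L1le g c.
Proof.
move=> cf cg fg [N lf]; apply: int_L1le => //.
pose h n x := (`|f (n + N)%N x|)%:E.
have hg x : limn_einf (h^~ x) = (`|g x|)%:E.
  have [|->//] := @cvg_limn_einf_sup _ (h^~ x) (`|g x|)%:E.
  apply: cvg_EFin; first by near=> n.
  have : f n x @[n --> \oo] --> g x.
    apply/cvgrPdist_le => e e0; have [m _ hm] := hpow_small K 0 e0.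
    near=> n; rewrite distrC (le_trans (fg n x))//.
    have K0 : 0 <= K.
      by have := fg 0%N x; rewrite /hpow expr0 mulr1; exact: le_trans.
    apply: le_trans hm; rewrite ler_wpM2l//; apply: ler_wiXn2l; first by lra.
      by lra.
    by near: n; exact: nbhs_infty_ge.
  move=> /cvg_norm; rewrite -(cvg_shiftn N); exact.
apply: (@le_trans _ _ (\int[mu]_x limn_einf (h^~ x))%E).
  rewrite le_eqVlt; apply/orP; left; apply/eqP; apply: eq_integral => x _.
  by rewrite hg.
apply: le_trans (fatou _ _ _ _) _ => //.
- move=> n; apply/measurable_EFinP; apply: continuous_measurable_fun.
  exact: cont_norm.
- by move=> n x _; rewrite lee_fin.
rewrite limn_einf_lim; apply: lime_le; first exact: is_cvg_einfs.
near=> n; apply: (@le_trans _ _ (\int[mu]_x h n x)%E); first by apply: ereal_inf_lbound; exists n => /=.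
by apply: L1le_int => //; apply: lf; rewrite leq_addl.
Unshelve. all: by end_near. Qed.

Lemma hderivP (F : R -> R) (x l : R) : is_derive x 1 F l <-> forall e, 0 < e ->
  exists2 d, 0 < d & forall y, `|y - x| < d ->
    `|F y - F x - (y - x) * l| <= e * `|y - x|.
Proof.
split=> [dF e e0|h].
  have [dx E] := dF; have : h^-1 *: (F (h *: 1 + x) - F x) @[h --> 0^'] --> l.
    by rewrite -E /derive; have := dx; rewrite /derivable; exact: cvgP.
  move=> /cvgrPdist_le/(_ e e0)/nbhs_ballP[d d0 hd].
  exists d => // y yx; have [->|yx0] := eqVneq y x.
    by rewrite !subrr mul0r subr0 normr0 mulr0.
  have h0 : y - x != 0 by rewrite subr_eq0.
  have := hd (y - x) _ h0; rewrite /ball/= sub0r normrN => /(_ yx).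
  rewrite /GRing.scale/= mulr1 subrK => H.
  have -> : F y - F x - (y - x) * l = - ((y - x) * (l - (y - x)^-1 * (F y - F x))).
    by field.
  by rewrite normrN normrM mulrC ler_wpM2r.
have lim : h^-1 *: (F (h *: 1 + x) - F x) @[h --> 0^'] --> l.
  apply/cvgrPdist_le => e e0; have [d d0 hd] := h e e0.
  apply/nbhs_ballP; exists d => // y; rewrite /ball/= sub0r normrN => yd y0.
  rewrite /GRing.scale/= mulr1.
  have := hd (y + x); rewrite addrK => /(_ yd) H.
  have -> : l - y^-1 * (F (y + x) - F x) = - (y^-1 * (F (y + x) - F x - y * l)).
    by field.
  by rewrite normrN normrM normfV ler_pdivrMl ?normr_gt0// [leRHS]mulrC.
apply: DeriveDef; first by apply/cvg_ex; exists l.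
exact: cvg_lim lim.
Qed.

Lemma contP (f : R -> R) : continuous f <-> forall x e, 0 < e ->
  exists2 d, 0 < d & forall y, `|y - x| < d -> `|f y - f x| <= e.
Proof.
split=> [cf x e e0|h x].
  have /cvgrPdist_le/(_ e e0)/nbhs_ballP[d d0 hd] := cf x.
  by exists d => // y yx; rewrite distrC; apply: hd; rewrite /ball/= distrC.
apply/cvgrPdist_le => e e0; have [d d0 hd] := h x e e0.
by apply/nbhs_ballP; exists d => // y; rewrite /ball/= distrC => /hd; rewrite distrC.
Qed.

Lemma cont_limit (f : nat -> R -> R) g K : (forall n, continuous (f n)) ->
  (forall n x, `|f n x - g x| <= K * hpow R n) -> continuous g.
Proof.
move=> cf fg; apply/contP => x e e0.
have e30 : 0 < e / 3 by rewrite divr_gt0.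
have [n _ hn] := hpow_small K 0 e30.
have [d d0 hd] := (contP (f n)).1 (cf n) x _ e30.
exists d => // y /hd; have := fg n x; have := fg n y.
rewrite !ler_norml => /andP[? ?] /andP[? ?] /andP[? ?]; apply/andP; split; lra.
Qed.

(** The mean value theorem for [F n], with an intermediate point near [x], gives an
  estimate in which [n] can tend to infinity. *)
Lemma hderiv_limit (F f : nat -> R -> R) G g K : (forall n, hderiv (F n) (f n)) ->
  (forall n x, `|F n x - G x| <= K * hpow R n) ->
  (forall n x, `|f n x - g x| <= K * hpow R n) ->
  continuous g -> hderiv G g.
Proof.
move=> dF FG fg cg x; apply/hderivP => e e0.
have [d d0 hd] := (contP g).1 cg x e e0.
exists d => // y yx.
apply: (@le_hpow_lim _ _ _ (K * `|y - x| + 2 * K) 0) => n _.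
have [c cx E] := mvt_near (dF n) x y.
have -> : G y - G x - (y - x) * g x =
  (f n c - g c + (g c - g x)) * (y - x) - ((F n y - G y) - (F n x - G x)).
  rewrite (_ : F n y - G y - _ = (F n y - F n x) - (G y - G x)); last by ring.
  by rewrite E; ring.
have h1 := FG n y; have h2 := FG n x; have h3 := fg n c.
have h4 := hd c (le_lt_trans cx yx).
rewrite (_ : _ + _ * hpow R n = (K * hpow R n + e) * `|y - x| +
  (K * hpow R n + K * hpow R n)); last by ring.
rewrite (le_trans (ler_normB _ _))// lerD//.
  by rewrite normrM ler_wpM2r// (le_trans (ler_normD _ _))// lerD.
by rewrite (le_trans (ler_normB _ _))// lerD.
Qed.

Lemma vanish_limit (f : nat -> R -> R) g K : (forall n, vanish (f n)) ->
  (forall n x, `|f n x - g x| <= K * hpow R n) -> vanish g.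
Proof.
move=> vf fg e e0.
have e20 : 0 < e / 2 by rewrite divr_gt0.
have [n _ hn] := hpow_small K 0 e20.
have [N hN] := vf n _ e20; exists N => x /hN; have := fg n x.
rewrite !ler_norml => /andP[? ?] /andP[? ?]; apply/andP; split; lra.
Qed.

Lemma G2_limit (s : nat -> R -> R) f K :
  (forall n m, (n <= m)%N -> G2 R (fun x => s m x - s n x) (K * hpow R n)) ->
  (forall n x, `|s n x - f x| <= K * hpow R n) ->
  (forall n, continuous (s n)) -> (forall n, vanish (s n)) ->
  forall n, G2 R (fun x => f x - s n x) (K * hpow R n).
Proof.
move=> hs sf cs vs n.
have K0 : 0 <= K by have := sf 0%N 0; rewrite /hpow expr0 mulr1; exact: le_trans.
have cf : continuous f by exact: cont_limit cs sf.
have bd m x : `|s m x - f x| <= K.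
  rewrite (le_trans (sf m x))// ler_piMr//.
  by rewrite /hpow exprn_ile1//; lra.
split.
- split; first exact: contB.
  by move=> x; rewrite distrC.
- apply: (@L1le_limit (fun m x => (s m x - s n x) ^+ 2) _ _ (4 * K * K)).
  + by move=> m; apply: contM; exact: contB.
  + by apply: contM; exact: contB.
  + move=> m x.
    rewrite (_ : _ - _ = (s m x - f x) * ((s m x - f x) - (s n x - f x) - (s n x - f x))); last by ring.
    rewrite normrM (_ : 4 * K * K * hpow R m = K * hpow R m * (4 * K)); last by ring.
    apply: ler_pM => //.
    have h1 := ler_normB ((s m x - f x) - (s n x - f x)) (s n x - f x).
    have h2 := ler_normB (s m x - f x) (s n x - f x).
    by have := bd m x; have := bd n x; lra.
  + by exists n => m /hs [].
- apply: vanish_le (vanishD (vanish_limit vs sf) _) _; last first.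
    by move=> x; exact: lexx.
  by apply: vanish_le (vs n) _ => x; rewrite normrN.
Qed.

(** The functions and their derivatives converge uniformly, to a function and its
  derivative; by Fatou's lemma the L2 norms of the differences pass to the limit. *)
Lemma V1_geo_complete : geo_complete (V1 R).
Proof.
move=> C u hu; have h := hpow_cauchy hu.
have C0 : 0 <= C by have := hu 0%N; rewrite /hpow expr0 mulr1; exact: le_trans.
have lim (s : nat -> R -> R) : (forall n x, `|s n.+1 x - s n x| <= `|u n.+1 - u n|) ->
    exists f, forall n x, `|s n x - f x| <= 2 * C * hpow R n.
  move=> hs; suff /choice[f hf] : forall x, exists l, forall n, `|s n x - l| <= 2 * C * hpow R n.
    by exists f => n x; exact: hf.
  by move=> x; apply: R_geo_complete => n; exact: le_trans (hs n x) (hu n).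
have [f hf] := lim (fun n => u n) (fun n x => V1_le (u n.+1 - u n) x).
have [|g hg] := lim (fun n => derive1 (u n)).
  by move=> n x; exact: V1_dist_le.
have cu n : continuous (u n) by exact: hderiv_cont (V1_hderiv _).
have cu' n : continuous (derive1 (u n)) by exact: V1_derive_cont.
have cg := cont_limit cu' hg.
have dfg : hderiv f g by exact: hderiv_limit (fun n => V1_hderiv (u n)) hf hg cg.
have Gf : forall n, G2 R (fun x => f x - u n x) (2 * C * hpow R n).
  apply: G2_limit => // [n m nm|n]; last by have [] := V1_G2 (u n).
  by apply: gauge_le (V1_G2 (u m - u n)) _; rewrite distrC; exact: h.
have Gg : forall n, G2 R (fun x => g x - derive1 (u n) x) (2 * C * hpow R n).
  apply: G2_limit => // [n m nm|n]; last by have [] := V1_G2' (u n).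
  have := V1_G2' (u m - u n); rewrite V1_derive1B => h'.
  by apply: gauge_le h' _; rewrite distrC; exact: h.
have W n : exists w : V1 R, w = (fun x => f x - u n x) :> (R -> R) /\
    `|w| <= 4 * (2 * C * hpow R n).
  exact: V1_intro (hderivB dfg (V1_hderiv (u n))) (Gf n) (Gg n).
have [w0 [w0E _]] := W 0%N; exists (u 0%N + w0) => n.
apply: (@le_hpow_lim _ _ _ (4 * (2 * C)) n) => m nm.
have [w [wE wm]] := W m.
have -> : u n - (u 0%N + w0) = (u n - u m) - w.
  apply: V1_eq => x; rewrite -[LHS]/(u n x - (u 0%N x + w0 x)).
  by rewrite -[RHS]/(u n x - u m x - w x) w0E wE; ring.
rewrite (le_trans (ler_normB _ _))// lerD ?h//.
by rewrite -mulrA.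
Qed.

End V1_facts.

(** * The vector field in the chart *)

Section frechet.
Variables (R : realType) (V W : normedModType R).

(** A linear map with a remainder that is quadratic for each increment is the Frechet
  derivative. *)
Lemma frechet (f df : V -> W) (p : V) (C r : R) : 0 < r -> 0 <= C -> linear df ->
  (forall h, `|df h| <= C * `|h|) ->
  (forall q, `|q - p| < r -> `|f q - f p - df (q - p)| <= C * `|q - p| ^+ 2) ->
  differentiable f p /\ 'd f p = df :> (V -> W).
Proof.
move=> r0 C0 lin bd rem.
pose dfM := GRing.isLinear.Build _ _ _ _ _ lin.
pose dfL : {linear _ -> _} := HB.pack df dfM.
have cdf : continuous dfL.
  move=> x; apply/cvgrPdist_le => e e0.
  have C1 : 0 < C + 1 by rewrite ltr_wpDl.
  apply/nbhs_ballP; exists (e / (C + 1)); first by rewrite /= divr_gt0.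
  move=> y; rewrite -ball_normE /ball_/= => yx.
  rewrite -(@linearB _ _ _ _ dfL) (le_trans (bd _))//.
  apply: (@le_trans _ _ ((C + 1) * `|x - y|)); first by rewrite ler_wpM2r// lerDl.
  by rewrite mulrC -ler_pdivlMr// ltW.
have o : f \o shift p = cst (f p) + dfL +o_ 0 id.
  apply/eqaddoP => e e0.
  have C1 : 0 < C + 1 by rewrite ltr_wpDl.
  apply/nbhs_ballP; exists (Num.min r (e / (C + 1))).
    by rewrite /= lt_min r0 divr_gt0.
  move=> y; rewrite -ball_normE /ball_/= sub0r normrN lt_min => /andP[yr ye].
  have := rem (y + p); rewrite addrK => /(_ yr) H.
  rewrite -[(_ - _) y]/(f (y + p) - (f p + df y)) opprD addrA (le_trans H)//.
  rewrite expr2 mulrA ler_wpM2r// (@le_trans _ _ ((C + 1) * `|y|))//.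
    by rewrite ler_wpM2r// lerDl.
  by rewrite mulrC -ler_pdivlMr// ltW.
split; first by apply/diff_locallyP; rewrite (diff_unique cdf o).
exact: diff_unique cdf o.
Qed.

(** Differentials that are Lipschitz in the base point are continuous for the operator
  norm. *)
Lemma C1_on_local (A : set V) (F : V -> W) :
  (forall p, A p -> exists (L : V -> V -> W) (r C : R),
  [/\ 0 < r, 0 <= C & forall q, `|q - p| < r -> [/\ linear (L q),
    (forall h, `|L q h| <= C * `|h|) &
    forall q', `|q' - p| < r -> (forall h, `|L q' h - L q h| <= C * `|q' - q| * `|h|) /\
      `|F q' - F q - L q (q' - q)| <= C * `|q' - q| ^+ 2]]) ->
  C1_on A F.
Proof.
move=> H0.
have loc p : A p -> exists (L : V -> V -> W) (r C : R),
  [/\ 0 < r, 0 <= C & forall q, `|q - p| < r -> [/\ differentiable F q,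
    'd F q = L q :> (V -> W) &
    forall q' h, `|q' - p| < r -> `|L q' h - L q h| <= C * `|q' - q| * `|h|]].
  move=> /H0[L [r [C [r0 C0 H]]]].
  exists L, r, C; split => // q qr.
  have [lin bd loc] := H q qr.
  have [||df dE] := @frechet F (L q) q C (r - `|q - p|) _ C0 lin bd.
  - by rewrite subr_gt0.
  - move=> q' q'q; have [|_ //] := loc q'.
    by apply: (le_lt_trans (ler_distD q _ _)); rewrite -ltrBrDr.
  by split => // q' h /loc[].
split=> [p pA|p pA e e0].
  have [L [r [C [r0 C0 H]]]] := loc p pA.
  by have [|//] := H p; rewrite subrr normr0.
have [L [r [C [r0 C0 H]]]] := loc p pA.
have C1 : 0 < C + 1 by rewrite ltr_wpDl.
have : \forall q \near nbhs p, forall h, `|'d F q h - 'd F p h| <= e * `|h|.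
  apply/nbhs_ballP; exists (Num.min r (e / (C + 1))); first by rewrite /= lt_min r0 divr_gt0.
  move=> q; rewrite -ball_normE /ball_/= distrC lt_min => /andP[qr qe] h.
  have [_ -> _] := H q qr.
  have [|_ -> Lp] := H p; first by rewrite subrr normr0.
  rewrite (le_trans (Lp q h qr))// ler_wpM2r//.
  apply: (@le_trans _ _ ((C + 1) * `|q - p|)); first by rewrite ler_wpM2r// lerDl.
  by rewrite mulrC -ler_pdivlMr// ltW.
by apply: filterS => q hq _.
Qed.

End frechet.

Section pairs.
Variables (R : realType) (V W : normedModType R).
Implicit Types (q : V * W) (c : R).

Lemma norm_fst q : `|q.1| <= `|q|.
Proof. by rewrite prod_normE/= le_max lexx. Qed.
Lemma norm_snd q : `|q.2| <= `|q|.
Proof. by rewrite prod_normE/= le_max lexx orbT. Qed.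
Lemma norm_pair_le q c : `|q.1| <= c -> `|q.2| <= c -> `|q| <= c.
Proof. by move=> h1 h2; rewrite prod_normE/= ge_max h1. Qed.

End pairs.

Section vector_field.
Variable R : realType.
Local Notation TD := (V1 R * V1 R)%type.
Implicit Types (p q h : TD) (u v : V1 R) (eta : D R).

Lemma dom_lower v : D_chart_domain v ->
  exists2 a : R, 0 < a & forall x, a * 2 <= 1 + derive1 v x.
Proof.
rewrite /D_chart_domain/= => h; exists ((1 + inf (range (derive1 v))) / 2).
  by rewrite divr_gt0//; lra.
move=> x; rewrite divfK// lerD2l; apply: ge_inf; last by exists x.
by exists (- `|v|) => _ [y _ <-]; have := V1_le' v y; rewrite ler_norml => /andP[].
Qed.

Lemma dom_intro v (a : R) : 0 < a -> (forall x, a <= 1 + derive1 v x) ->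
  D_chart_domain v.
Proof.
move=> a0 h; rewrite /D_chart_domain/= (@lt_le_trans _ _ (a - 1))//; first by lra.
by apply: lb_le_inf => [|_ [x _ <-]]; [exists (derive1 v 0), 0|have := h x; lra].
Qed.

(** In the chart [v = eta - Id] the change of variables [y = eta z] turns the kernel
  [e^-|eta x - eta z|] into [e^-|x - z|] times [e^-v(x) e^v(z)] for [z < x] and
  [e^v(x) e^-v(z)] for [z > x], and the source, with the
  Jacobian of the change of variables, into this density. The kernels are then
  independent of [eta], and [eta] only enters through products, exponentials and an
  inverse. *)
Definition density q (x : R) : R :=
  q.2 x * q.2 x * (1 + derive1 q.1 x) +
  2^-1 * (derive1 q.2 x * derive1 q.2 x * (1 + derive1 q.1 x)^-1).

Definition force_fun q (x : R) : R :=
  2^-1 * (expR (- q.1 x) * Km (fun z => expR (q.1 z) * density q z) x -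
          expR (q.1 x) * Kp (fun z => expR (- q.1 z) * density q z) x).

Let G1e (N : gauge R) (f g : R -> R) c d : N f c -> f = g -> c <= d -> N g d.
Proof. by move=> Nf <-; exact: gauge_le. Qed.

Lemma fst_sup h : Gsup R h.1 (1 * `|h|).
Proof.
have [s _ _] := V1_G2 h.1.
by apply: (@gauge_le R (Gsup R)) s _; rewrite mul1r norm_fst.
Qed.
Lemma fst_sup' h : Gsup R (derive1 h.1) (1 * `|h|).
Proof.
have [s _ _] := V1_G2' h.1.
by apply: (@gauge_le R (Gsup R)) s _; rewrite mul1r norm_fst.
Qed.
Lemma fst_lin (a : R) h k : (a *: h + k).1 = (fun x => a * h.1 x + k.1 x) :> (R -> R).
Proof. by []. Qed.
Lemma fst_lin' (a : R) h k :
  derive1 (a *: h + k).1 = (fun x => a * derive1 h.1 x + derive1 k.1 x).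
Proof. by rewrite (V1_derive1D (a *: h.1) k.1) V1_derive1Z. Qed.
Lemma snd_lin' (a : R) h k :
  derive1 (a *: h + k).2 = (fun x => a * derive1 h.2 x + derive1 k.2 x).
Proof. by rewrite (V1_derive1D (a *: h.2) k.2) V1_derive1Z. Qed.

Lemma C11_exp_fst p : C11 (GC1 (Gsup R)) p (fun q x => expR (q.1 x)).
Proof.
apply: (@C11_exp R _ (fun q x => q.1 x) 1 _ _ _ p (fun q => derive1 q.1)) => //.
- exact: fst_sup.
- by move=> h; exact: V1_hderiv.
- exact: fst_sup'.
Qed.

Lemma C11_expN_fst p : C11 (GC1 (Gsup R)) p (fun q x => expR (- q.1 x)).
Proof.
have neg f c : Gsup R f c -> Gsup R (fun x => - f x) c.
  by move=> [cf bf]; split; [exact: contN|move=> x; rewrite normrN].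
apply: (@C11_exp R _ (fun q x => - q.1 x) 1 _ _ _ p (fun q x => - derive1 q.1 x)) => //.
- by move=> a h k; apply/funext => x; rewrite fst_lin; ring.
- by move=> h; apply: neg; exact: fst_sup.
- by move=> h; apply: hderivN; exact: V1_hderiv.
- by move=> h; apply: neg; exact: fst_sup'.
Qed.

(** The density is quadratic in [U] and [U'], whose products are integrable, times
  bounded functions of [v']. *)
Lemma C11_density p : D_chart_domain p.1 -> C11 (G1 R) p density.
Proof.
move=> /dom_lower[a a0 ha].
have Ceta : C11 (Gsup R) p (fun q x => 1 + derive1 q.1 x).
  apply: C11_add.
    apply: (@C11_cst _ _ _ _ _ 1) => //; split; first exact: cont_cst.
    by move=> x; rewrite normr1.
  apply: (@C11_linear _ _ _ _ (fun q x => derive1 q.1 x) 1) => //.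
    exact: fst_lin'.
  exact: fst_sup'.
have Cinv : C11 (Gsup R) p (fun q x => (1 + derive1 q.1 x)^-1).
  apply: (@C11_inv R _ (fun q x => derive1 q.1 x) 1 _ _ _ p a) => //.
  - exact: fst_lin'.
  - exact: fst_sup'.
have CU : C11 (G2 R) p (fun q x => q.2 x).
  apply: (@C11_linear _ _ _ _ (fun q x => q.2 x) 1) => // h.
  by apply: gauge_le (V1_G2 h.2) _; rewrite mul1r norm_snd.
have CU' : C11 (G2 R) p (fun q x => derive1 q.2 x).
  apply: (@C11_linear _ _ _ _ (fun q x => derive1 q.2 x) 1) => // [|h].
    exact: snd_lin'.
  by apply: gauge_le (V1_G2' h.2) _; rewrite mul1r norm_snd.
have L2M1 := product_const1 (@L2M R).
have L1Mr f g c d : G1 R f c -> Gsup R g d -> G1 R (fun x => f x * g x) (1 * (c * d)).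
  move=> Gf Gg; apply: G1e (L1M Gg Gf) _ _; last by rewrite mul1r mulrC.
  by apply/funext => x; rewrite mulrC.
apply: C11_add.
  exact: (C11_mul ler01 L1Mr (C11_mul ler01 L2M1 CU CU) Ceta).
apply: C11_scale.
exact: (C11_mul ler01 L1Mr (C11_mul ler01 L2M1 CU' CU') Cinv).
Qed.

(** Each operation in [force_fun] is bounded between the gauges of its arguments and of
  its result: the kernels send integrable functions to functions integrable with their
  derivatives, and products with exponentials of [v] preserve the latter. *)
Lemma C11_force p : D_chart_domain p.1 -> C11 (GV R) p force_fun.
Proof.
move=> pd; have Cd := C11_density pd.
have C1sup Phi : C11 (GC1 (Gsup R)) p Phi -> C11 (Gsup R) p Phi.
  apply: (@C11_incl _ _ _ _ _ _ 1) => // f c [f' [_ sf _]].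
  by rewrite mul1r.
have K10 : 0 <= 10 :> R by [].
have G1sup f c : G1 R f c -> Gsup R f c by case.
have CA : C11 (GC1 (G1 R)) p (fun q => Km (fun z => expR (q.1 z) * density q z)).
  apply: (@C11_linop _ _ (G1 R) _ _ (fun q z => expR (q.1 z) * density q z) _ 10) => //.
  - exact: Km_G1.
  - by move=> f g a c d /G1sup sf /G1sup sg; exact: Km_lin sf sg.
  - exact: (C11_mul ler01 (product_const1 (@L1M R)) (C1sup _ (C11_exp_fst p)) Cd).
have CB : C11 (GC1 (G1 R)) p (fun q => Kp (fun z => expR (- q.1 z) * density q z)).
  apply: (@C11_linop _ _ (G1 R) _ _ (fun q z => expR (- q.1 z) * density q z) _ 10) => //.
  - exact: Kp_G1.
  - by move=> f g a c d /G1sup sf /G1sup sg; exact: Kp_lin sf sg.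
  - exact: (C11_mul ler01 (product_const1 (@L1M R)) (C1sup _ (C11_expN_fst p)) Cd).
have C1 := C11_mul (ler0n _ 2) (@C1M R) (C11_expN_fst p) CA.
have C2 := C11_mul (ler0n _ 2) (@C1M R) (C11_exp_fst p) CB.
have : C11 (GC1 (G1 R)) p force_fun.
  have := C11_scale 2^-1 (C11_add C1 (C11_scale (- 1) C2)).
  apply: (@C11_ext _ _ _ _ _ _ 1) => // q _; apply/funext => x.
  by rewrite /force_fun mulN1r.
by apply: (@C11_incl _ _ _ _ _ _ 4) => // f c; exact: GC1_GV.
Qed.

Definition force q : V1 R := insubd 0 (force_fun q).

Lemma C11_ball (V : normedModType R) (N : gauge R) (p : V) Phi :
  C11 N p Phi -> exists c, N (Phi p) c.
Proof.
by move=> [dPhi [r [C [r0 _ /(_ p)]]]]; rewrite subrr normr0 => /(_ r0)[? _ _ _]; exists C.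
Qed.

Lemma forceE q : D_chart_domain q.1 -> force q = force_fun q :> (R -> R).
Proof.
move=> /C11_force/C11_ball[c [w wf _]].
by rewrite [LHS](insubdK _ (_ : force_fun q \in _))// -wf; exact/mem_set/V1P.
Qed.

Lemma dom_open v : D_chart_domain v -> exists2 r : R, 0 < r & forall w,
  `|w - v| < r -> D_chart_domain w /\ forall x, r <= 1 + derive1 w x.
Proof.
move=> /dom_lower[a a0 ha]; exists a => // w wv.
have h x : a <= 1 + derive1 w x.
  have := V1_le' (w - v) x; rewrite V1_derive1B ler_norml => /andP[h1 _].
  by have := ha x; lra.
by split => //; exact: dom_intro h.
Qed.

(** [C11_force] with values in the normed space. The Lipschitz estimate for the force is
  what existence, uniqueness and dependence on the data rest on. *)
Lemma force_local p : D_chart_domain p.1 -> exists (L : TD -> TD -> V1 R) (r C : R),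
  [/\ 0 < r, 0 <= C & forall q, `|q - p| < r ->
  [/\ D_chart_domain q.1, `|force q| <= C, linear (L q),
      (forall h, `|L q h| <= C * `|h|) &
      forall q', `|q' - p| < r ->
      [/\ `|force q' - force q| <= C * `|q' - q|,
          (forall h, `|L q' h - L q h| <= C * `|q' - q| * `|h|) &
          `|force q' - force q - L q (q' - q)| <= C * `|q' - q| ^+ 2]]].
Proof.
move=> pd; have [s s0 hs] := dom_open pd.
have [dPhi [r1 [C H]]] := C11_force pd; have [r10 C0 _] := H.
pose r := Num.min s r1.
have r0 : 0 < r by rewrite lt_min s0.
have [_ _ {}H] : C11_in (GV R) p force_fun dPhi r C.
  by apply: C11_in_shrink H => //; rewrite ge_min lexx orbT.
have dq q : `|q - p| < r -> D_chart_domain q.1.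
  move=> qr; have [] // := hs q.1.
  by apply: le_lt_trans (norm_fst (q - p)) _; rewrite (lt_le_trans qr)// ge_min lexx.
have GVn (w : V1 R) f c : GV R f c -> w =1 f -> `|w| <= c.
  by move=> [w' wf' wc] wf; rewrite (_ : w = w')//; apply: V1_eq => x; rewrite wf wf'.
have : forall qh : TD * TD, exists w : V1 R, `|qh.1 - p| < r -> w = dPhi qh.1 qh.2 :> (R -> R).
  move=> [q h]; have [qr|nqr] := pselect (`|q - p| < r); last by exists 0.
  by have [_ _ /(_ h)[w wE _] _] := H q qr; exists w.
move=> /choice[L0 HL]; pose L q h := L0 (q, h).
have LE q h : `|q - p| < r -> L q h = dPhi q h :> (R -> R) by exact: (HL (q, h)).
exists L, r, C; split; [exact: r0|exact: C0|move=> q qr].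
have [h1 h2 h3 h4] := H q qr.
have fq := forceE (dq q qr).
split.
- exact: dq.
- by apply: GVn h1 _; rewrite fq.
- move=> a h k; apply: V1_eq => x.
  by rewrite -[RHS]/(a * L q h x + L q k x) !LE// h2.
- by move=> h; apply: GVn (h3 h) _; rewrite LE.
- move=> q' q'r; have [h5 h6 h7] := h4 q' q'r.
  have fq' := forceE (dq q' q'r).
  split.
  + by apply: GVn h5 _ => x; rewrite -fq -fq'.
  + by move=> h; apply: GVn (h6 h) _ => x; rewrite -!LE.
  + by apply: GVn h7 _ => x; rewrite -fq -fq' -LE.
Qed.

Definition field q : TD := (q.2, force q).

Lemma field_C1 : C1_on (D_chart_domain (R := R) `*` setT) field.
Proof.
apply: C1_on_local => p [/= /force_local[L [r [C [r0 C0 H]]]] _].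
exists (fun q h => (h.2, L q h)), r, (1 + C); split; [exact: r0|exact: addr_ge0|].
move=> q qr; have [_ _ lin bd loc] := H q qr; split.
- by move=> a h k; rewrite lin.
- move=> h; apply: norm_pair_le => /=; rewrite mulrDl mul1r.
    by rewrite ler_wpDr ?mulr_ge0 ?norm_snd.
  by rewrite (le_trans (bd h))// lerDr.
- move=> q' /loc[_ h6 h7]; split.
    move=> h; apply: norm_pair_le => /=.
      by rewrite subrr normr0 !mulr_ge0 ?addr_ge0.
    by rewrite (le_trans (h6 h))// !ler_wpM2r// lerDr.
  apply: norm_pair_le => /=.
    by rewrite subrr normr0 mulr_ge0 ?exprn_ge0 ?addr_ge0.
  by rewrite (le_trans h7)// ler_wpM2r ?exprn_ge0// lerDr.
Qed.

End vector_field.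

(** * The nonlocal term *)

Section diffeomorphisms.
Variable R : realType.
Implicit Types (phi dphi f g : R -> R) (a b c : R).

Record bilip a b phi dphi : Prop := Bilip {
  bilip_gt0 : 0 < a ;
  bilip_deriv : hderiv phi dphi ;
  bilip_cont : continuous dphi ;
  bilip_ge : forall x, a <= dphi x ;
  bilip_le : forall x, dphi x <= b }.

Lemma bilip_expand a b phi dphi x y : bilip a b phi dphi ->
  a * `|x - y| <= `|phi x - phi y|.
Proof.
move=> [a0 d _ ge _]; have [c _ ->] := mvt_near d y x.
by rewrite normrM ler_wpM2r// (le_trans (ge c))// ler_norm.
Qed.

Lemma lip_cont f c : (forall x y, `|f x - f y| <= c * `|x - y|) -> continuous f.
Proof.
move=> h; apply/contP => x e e0.
have c1 : 0 < `|c| + 1 by rewrite ltr_wpDl.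
exists (e / (`|c| + 1)); first by rewrite divr_gt0.
move=> y yx; rewrite (le_trans (h y x))//.
apply: (@le_trans _ _ ((`|c| + 1) * `|y - x|)).
  by rewrite ler_wpM2r// (le_trans (ler_norm c))// lerDl.
by rewrite mulrC -ler_pdivlMr// ltW.
Qed.

Lemma inv_lip a b phi dphi psi : bilip a b phi dphi -> cancel psi phi ->
  forall y z, `|psi y - psi z| <= a^-1 * `|y - z|.
Proof.
move=> B K y z; have a0 := bilip_gt0 B.
by rewrite ler_pdivlMl// -{2}(K y) -{2}(K z); exact: bilip_expand B.
Qed.

(** The difference quotients of the inverse at [y] are the inverses of derivatives of
  [phi] at points close to [psi y]. *)
Lemma bilip_inv a b phi dphi psi : bilip a b phi dphi -> cancel psi phi ->
  bilip b^-1 a^-1 psi (fun y => (dphi (psi y))^-1).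
Proof.
move=> B K; have [a0 d cd ge le] := B.
have b0 : 0 < b by rewrite (lt_le_trans a0)// (le_trans (ge 0) (le 0)).
have d0 x : 0 < dphi x by exact: lt_le_trans a0 (ge x).
have cpsi := lip_cont (inv_lip B K).
have cV : continuous (fun x => (dphi x)^-1).
  by apply: contV => // x; rewrite gt_eqF.
split.
- by rewrite invr_gt0.
- move=> y; apply/hderivP => e e0.
  have [r r0 hr] := (contP _).1 cV (psi y) e e0.
  exists (a * r); first by rewrite mulr_gt0.
  move=> z zy.
  have [c cz E] := mvt_near d (psi y) (psi z); rewrite !K in E.
  have cr : `|c - psi y| < r.
    apply: (le_lt_trans cz); apply: (le_lt_trans (inv_lip B K z y)).
    by rewrite ltr_pdivrMl.
  have -> : psi z - psi y - (z - y) / dphi (psi y) =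
      (z - y) * ((dphi c)^-1 - (dphi (psi y))^-1).
    by rewrite mulrBr E [X in _ = X - _]mulrAC divff ?mul1r// gt_eqF.
  by rewrite normrM mulrC ler_wpM2r// hr.
- exact: (cont_comp cV cpsi).
- by move=> y; rewrite lef_pV2 ?posrE.
- by move=> y; rewrite lef_pV2 ?posrE.
Qed.

Implicit Types (eta : D R) (U : V1 R).

Lemma D_hderiv eta : hderiv eta (derive1 eta).
Proof. by apply: derivable_hderiv; case: (D_funP eta). Qed.

Lemma D_bilip eta : exists a b, bilip a b eta (derive1 eta).
Proof.
have [_ c [a [b [a0 _ h]]] _ _ _ _] := D_funP eta.
exists a, b; split => //; first exact: D_hderiv.
  by move=> x; have /andP[] := h x.
by move=> x; have /andP[] := h x.
Qed.

Lemma chart_derive1 eta x : derive1 (D_chart eta) x = derive1 eta x - 1.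
Proof.
by have [d _ _ _ _ _ _] := D_funP eta; have [_ ->] := derive1_subid (d x).
Qed.

Lemma chart_dom eta : D_chart_domain (D_chart eta).
Proof. by rewrite -range_D_chart; exists eta. Qed.

Lemma chart_inj eta (xi : D R) : D_chart eta = D_chart xi -> eta = xi :> (R -> R).
Proof.
move=> h; apply/funext => x; have := congr1 (fun v : V1 R => v x) h.
by rewrite /= => /addIr.
Qed.

Lemma D_inv_deriv eta : hderiv (D_inv eta) (fun y => (derive1 eta (D_inv eta y))^-1).
Proof.
have [a [b B]] := D_bilip eta.
by have [_ d _ _ _] := bilip_inv B (@D_invK R eta).
Qed.

Lemma source_bounded eta U : exists c, Gsup R (source eta U \o D_inv eta) c.
Proof.
have [a [b B]] := D_bilip eta; have [a0 d cd ge _] := B.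
have cV : continuous (fun x => (2 * derive1 eta x ^+ 2)^-1).
  apply: contV => [|x].
    by apply: contZ; apply: contM.
  by rewrite mulf_neq0// expf_neq0// gt_eqF// (lt_le_trans a0).
have cU := hderiv_cont (V1_hderiv U); have cU' := @V1_derive_cont R U.
exists (`|U| ^+ 2 + `|U| ^+ 2 * (2 * a ^+ 2)^-1); split.
  apply: (@cont_comp _ (source eta U)); last exact: hderiv_cont (D_inv_deriv eta).
  by apply: contD; [apply: contM|apply: contM => //; apply: contM].
move=> y; rewrite /source/=; set x := D_inv eta y.
have d2 : 0 < 2 * derive1 eta x ^+ 2 by rewrite mulr_gt0// exprn_gt0// (lt_le_trans a0).
have sq (z : R) : `|z| <= `|U| -> z ^+ 2 <= `|U| ^+ 2.
  by move=> h; rewrite -(real_normK (num_real z)) lerXn2r// nnegrE.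
rewrite ger0_norm; last by rewrite addr_ge0 ?sqr_ge0// divr_ge0 ?sqr_ge0// ltW.
apply: lerD; first by apply: sq; exact: V1_le.
apply: ler_pM; rewrite ?sqr_ge0 ?invr_ge0 ?(ltW d2)//.
  by apply: sq; exact: V1_le'.
rewrite lef_pV2 ?posrE// ?mulr_gt0 ?exprn_gt0//.
by rewrite ler_wpM2l// lerXn2r ?nnegrE ?(ltW a0)// (le_trans (ltW a0)).
Qed.

(** The kernels are compared by their differential equations instead of by a change of
  variables: [e^-v Km(e^v q)] and [(Km g) o eta] are bounded solutions of
  [y' = eta' (g o eta - y)], and similarly for [Kp], with the signs reversed. *)
Lemma force_Lconj eta U :
  force (D_chart eta, U) = - Lconj eta (source eta U) :> (R -> R).
Proof.
rewrite forceE; last exact: chart_dom.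
apply/funext => x; set v := D_chart eta.
have [c sg] := source_bounded eta U; set g := _ \o _ in sg.
rewrite -[RHS]/(- Lop g (eta x)) (Lop_split _ sg) /force_fun/= -/v.
have [a [b B]] := D_bilip eta; have [a0 de cde ge le] := B.
have onto y : exists x, eta x = y by exists (D_inv eta y); rewrite D_invK.
have onto' y : exists x, - eta x = y by exists (D_inv eta (- y)); rewrite D_invK opprK.
have gE z : g (eta z) = source eta U z by rewrite /g/= D_Kinv.
have dvE z : 1 + derive1 v z = derive1 eta z by rewrite chart_derive1; ring.
have e0 z : derive1 eta z != 0 by rewrite gt_eqF// (lt_le_trans a0).
have qE z : density (v, U) z = source eta U z * derive1 eta z.
  by rewrite /density/= dvE /source; field; rewrite e0.
have [C1 C2] : (exists c1, Gsup R (fun z => expR (v z) * density (v, U) z) c1) /\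
    (exists c2, Gsup R (fun z => expR (- v z) * density (v, U) z) c2).
  have [cd [sd _ _]] := C11_ball (C11_density (chart_dom eta : D_chart_domain (v, U).1)).
  have [c1 [_ [_ s1 _]]] := C11_ball (C11_exp_fst (v, U)).
  have [c2 [_ [_ s2 _]]] := C11_ball (C11_expN_fst (v, U)).
  by split; [exists (c1 * cd)|exists (c2 * cd)]; exact: supM.
have [c1 s1] := C1; have [c2 s2] := C2.
have dv := V1_hderiv v.
have vb z : `|v z| <= `|v| by exact: V1_le.
have eb (s : R) z : `|s| <= `|v| -> `|expR s * z| <= expR `|v| * `|z|.
  move=> sv; rewrite normrM ler_wpM2r// ger0_norm ?expR_ge0// ler_expR.
  exact: le_trans (ler_norm _) sv.
have A : expR (- v x) * Km (fun z => expR (v z) * density (v, U) z) x = Km g (eta x).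
  apply/eqP; rewrite -subr_eq0; apply/eqP.
  apply: (@bounded_decay _ (fun x => expR (- v x) *
    Km (fun z => expR (v z) * density (v, U) z) x - Km g (eta x)) eta _
    (expR `|v| * (8 * c1) + 8 * c) de _ _ onto).
    apply: (hderiv_eq (hderivB (hderivM (hderiv_exp (hderivN dv)) (Km_deriv s1))
      (hderiv_comp (Km_deriv sg) de))) => z /=.
    rewrite gE qE -dvE; have := expR_gt0 (v z); rewrite expRN => ez.
    by field; rewrite gt_eqF.
  move=> z; rewrite (le_trans (ler_normB _ _))// lerD ?(Km_le _ sg)//.
  by rewrite (le_trans (eb _ _ _)) ?normrN// ler_wpM2l ?expR_ge0// (Km_le _ s1).
have E : expR (v x) * Kp (fun z => expR (- v z) * density (v, U) z) x = Kp g (eta x).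
  apply/eqP; rewrite -subr_eq0; apply/eqP.
  apply: (@bounded_decay _ (fun x => expR (v x) *
    Kp (fun z => expR (- v z) * density (v, U) z) x - Kp g (eta x)) (fun x => - eta x) _
    (expR `|v| * (8 * c2) + 8 * c) (hderivN de) _ _ onto').
    apply: (hderiv_eq (hderivB (hderivM (hderiv_exp dv) (Kp_deriv s2))
      (hderiv_comp (Kp_deriv sg) de))) => z /=.
    rewrite gE qE -dvE; have := expR_gt0 (v z); rewrite expRN => ez.
    by field; rewrite gt_eqF.
  move=> z; rewrite (le_trans (ler_normB _ _))// lerD ?(Kp_le _ sg)//.
  by rewrite (le_trans (eb _ _ _))// ler_wpM2l ?expR_ge0// (Kp_le _ s2).
by rewrite A E; ring.
Qed.

Lemma field_spec : exists X : D R * V1 R -> V1 R * V1 R,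
  (forall eta U, (X (eta, U)).1 = U /\
     (X (eta, U)).2 = - Lconj eta (source eta U) :> (R -> R)) /\ C1_TD X.
Proof.
exists (fun q => field (D_chart q.1, q.2)); split.
  by move=> eta U; split => //; exact: force_Lconj.
by exists (@field R) => //; exact: field_C1.
Qed.

End diffeomorphisms.

(** * Composition with diffeomorphisms *)

Section composition.
Variable R : realType.
Implicit Types (phi dphi psi dpsi f g : R -> R) (a b c d e : R) (u v w : V1 R).

(** Compactness of a segment, in the form in which it is used. *)
Lemma seg_uniform (Q : R -> R -> Prop) a b : a <= b ->
  (forall d d' x, d' <= d -> Q d x -> Q d' x) ->
  (forall t, seg a b t -> exists2 d, 0 < d &
    forall x, seg a b x -> `|x - t| < d -> Q d x) ->
  exists2 d, 0 < d & forall x, seg a b x -> Q d x.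
Proof.
move=> ab mono loc.
pose P t := exists2 d, 0 < d & forall x, a <= x -> x <= t -> x <= b -> Q d x.
suff [d d0 hd] : P b by exists d => // x /andP[ax xb]; exact: hd.
apply: (@real_ind R P a b _ _ _ b ab (lexx b)).
- have aab : seg a b a by rewrite /seg/= lexx.
  have [d d0 hd] := loc a aab; exists d => // x ax xa xb.
  have -> : x = a by apply/eqP; rewrite eq_le ax xa.
  by apply: hd => //; rewrite subrr normr0.
- move=> t at' tb /(_ t at' (lexx _))[d d0 hd].
  have [|d' d'0 hd'] := loc t; first by rewrite /seg/= at' ltW.
  exists (d' / 2); first by rewrite divr_gt0.
  move=> s ts sd sb; exists (Num.min d d'); first by rewrite lt_min d0.
  move=> x ax xs xb; have [xt|/ltW tx] := leP x t.
    by apply: mono (hd x ax xt xb); rewrite ge_min lexx.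
  apply: (mono d'); first by rewrite ge_min lexx orbT.
  apply: hd'; first by rewrite /seg/= ax.
  by rewrite ger0_norm ?subr_ge0//; lra.
- move=> t at' tb hs.
  have [|d' d'0 hd'] := loc t; first by rewrite /seg/= (ltW at').
  have m0 : 0 < Num.min (d' / 2) (t - a) by rewrite lt_min divr_gt0//= subr_gt0.
  pose s := t - Num.min (d' / 2) (t - a).
  have as' : a <= s by rewrite lerBrDr -lerBrDl ge_min lexx orbT.
  have st : s < t by rewrite gtrBl.
  have sd : t - d' / 2 <= s by rewrite lerD2l lerN2 ge_min lexx.
  have [d d0 hd] := hs s as' st.
  exists (Num.min d d'); first by rewrite lt_min d0.
  move=> x ax xt xb; have [xs|sx] := leP x s.
    by apply: mono (hd x ax xs xb); rewrite ge_min lexx.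
  apply: (mono d'); first by rewrite ge_min lexx orbT.
  apply: hd'; first by rewrite /seg/= ax.
  by rewrite ler0_norm ?subr_le0//; lra.
Qed.

(** Uniform continuity on a large segment, smallness outside. *)
Lemma vanish_unif_cont f : continuous f -> vanish f -> forall e, 0 < e ->
  exists2 d, 0 < d & forall x y, `|y - x| <= d -> `|f y - f x| <= e.
Proof.
move=> /contP cf vf e e0.
have e20 : 0 < e / 2 by rewrite divr_gt0.
have [N hN] := vf _ e20.
pose M := `|N| + 1; have M0 : - M <= M by rewrite /M; have := normr_ge0 N; lra.
have [d d0 hd] : exists2 d, 0 < d & forall x, seg (- M) M x ->
    forall y, `|y - x| <= d -> `|f y - f x| <= e.
  apply: seg_uniform => // [d d' x dd h y yx|t _]; first by apply: h; exact: le_trans dd.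
  have [r r0 hr] := cf t _ e20.
  exists (r / 2); first by rewrite divr_gt0.
  move=> x _ xt y yx.
  have h1 : `|f x - f t| <= e / 2 by apply: hr; lra.
  have h2 : `|f y - f t| <= e / 2.
    by apply: hr; rewrite (le_lt_trans (ler_distD x _ _))//; lra.
  by rewrite (le_trans (ler_distD (f t) _ _))// (distrC (f t)); lra.
exists (Num.min d 1); first by rewrite lt_min d0 ltr01.
move=> x y; rewrite le_min => /andP[yd y1].
have [xM|Mx] := leP `|x| M; first by apply: hd => //; rewrite /seg/= -ler_norml.
have h1 : `|f x| <= e / 2.
  by apply: hN; have := ler_norm N; rewrite /M in Mx; lra.
have h2 : `|f y| <= e / 2.
  apply: hN; have := ler_distD y x 0; rewrite !subr0 (distrC x); have := ler_norm N.
  by rewrite /M in Mx; lra.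
by rewrite (le_trans (ler_normB _ _))//; lra.
Qed.

Lemma bilip_far a b phi dphi : bilip a b phi dphi -> forall M, exists2 m, 0 < m &
  forall x, m < `|x| -> M < `|phi x|.
Proof.
move=> B M; have a0 := bilip_gt0 B.
exists ((`|M| + `|phi 0|) / a + 1).
  by rewrite ltr_wpDl// divr_ge0 ?addr_ge0// ltW.
move=> x mx; have h := bilip_expand x 0 B; rewrite subr0 in h.
have h2 : `|M| + `|phi 0| < a * `|x|.
  by rewrite mulrC -ltr_pdivrMr//; lra.
have := ler_normB (phi x) (phi 0); have := ler_norm M; lra.
Qed.

Lemma vanish_comp f a b phi dphi : bilip a b phi dphi -> vanish f ->
  vanish (fun x => f (phi x)).
Proof.
move=> B vf e /vf[N hN]; have [m m0 hm] := bilip_far B N.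
by exists (m + 1) => x mx; apply: hN; apply: ltW; apply: hm; lra.
Qed.

Lemma G2_comp f c a b phi dphi : bilip a b phi dphi -> G2 R f c ->
  G2 R (fun x => f (phi x)) ((1 + a^-1) * c).
Proof.
move=> B [[cf bf] lf vf]; have [a0 d cd ge le] := B.
have ai : 0 < a^-1 by rewrite invr_gt0.
have c0 : 0 <= c by exact: le_trans (bf 0).
split.
- split; first exact: cont_comp cf (hderiv_cont d).
  by move=> x; rewrite (le_trans (bf _))// ler_peMl//; lra.
- apply: L1le_mono (L1le_comp a0 d cd ge lf) _.
  rewrite exprMn ler_wpM2r ?sqr_ge0//.
  by have := sqr_ge0 a^-1; rewrite sqrrD expr1n mul1r mulr2n; lra.
- exact: vanish_comp B vf.
Qed.

Lemma cutoff_lip (N x y : R) : `|cutoff N y - cutoff N x| <= `|y - x|.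
Proof.
have h : `| `|y| - `|x| | <= `|y - x| by exact: ler_dist_dist.
have clamp (t : R) : exists2 c : R, Num.max 0 (Num.min 1 t) = c &
    [\/ t <= 0 /\ c = 0, (0 <= t <= 1) /\ c = t | 1 <= t /\ c = 1].
  have /orP[t0|t0] := le_total t 0.
    exists 0; last by constructor 1.
    by rewrite min_r ?(le_trans t0)// max_l.
  have /orP[t1|t1] := le_total t 1.
    by exists t; [rewrite min_r// max_r|constructor 2; rewrite t0].
  by exists 1; [rewrite min_l// max_r|constructor 3].
move: h; rewrite !ler_norml => /andP[h1 h2]; rewrite /cutoff.
have [c -> hc] := clamp (N + 1 - `|y|); have [d -> hd] := clamp (N + 1 - `|x|).
have {}h2 : `|y| - `|x| <= `|y - x| by [].
apply/andP; case: hc => [[? ->]|[/andP[? ?] ->]|[? ->]];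
  case: hd => [[? ->]|[/andP[? ?] ->]|[? ->]]; split; lra.
Qed.

(** The function is cut into a part supported in a bounded set and a remainder that is
  small in L2. Composition with a bilipschitz map keeps the remainder small, and on
  bounded sets uniform convergence implies convergence in L2. *)
Lemma comp_G2_cont f c a b phi dphi : bilip a b phi dphi -> G2 R f c ->
  forall e, 0 < e -> exists2 d, 0 < d & forall psi dpsi, bilip a b psi dpsi ->
  (forall x, `|psi x - phi x| <= d) -> G2 R (fun x => f (psi x) - f (phi x)) e.
Proof.
move=> B Gf e e0; have [[cf bf] lf vf] := Gf; have [a0 dp cd ge le] := B.
have c0 : 0 <= c by exact: le_trans (bf 0).
have e1 : 0 < a * e ^+ 2 / 16 by rewrite divr_gt0// mulr_gt0// exprn_gt0.
have [N N0 hN] := L1_cutoff (contM cf cf) lf e1.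
have [m m0 hm] := bilip_far B (N + 2).
have [w w0 hw] : exists2 w, 0 < w & 16 * m * w ^+ 2 <= e ^+ 2 / 2.
  exists (Num.min 1 (e ^+ 2 / (32 * m))).
    by rewrite lt_min ltr01 divr_gt0 ?exprn_gt0 ?mulr_gt0.
  have x0 : 0 <= Num.min 1 (e ^+ 2 / (32 * m)).
    by rewrite le_min ler01 divr_ge0 ?sqr_ge0// mulr_ge0// ltW.
  have x1 : Num.min 1 (e ^+ 2 / (32 * m)) <= 1 by rewrite ge_min lexx.
  have x2 : Num.min 1 (e ^+ 2 / (32 * m)) * (32 * m) <= e ^+ 2.
    by rewrite -ler_pdivlMr ?mulr_gt0// ge_min lexx orbT.
  have := ler_wpM2l x0 x1; rewrite mulr1 -expr2 => x3.
  have := ler_wpM2l (ltW m0) x3; lra.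
have w20 : 0 < Num.min (w / 2) e by rewrite lt_min divr_gt0.
have [r r0 hr] := vanish_unif_cont cf vf w20.
have c1 : 0 < c + 1 by rewrite ltr_wpDl.
exists (Num.min (Num.min r 1) (w / 2 / (c + 1))).
  by rewrite !lt_min r0 ltr01 !divr_gt0.
move=> psi dpsi Bpsi; have [_ dps cds ges les] := Bpsi.
move=> hd; have {hd} hd x : [/\ `|psi x - phi x| <= r, `|psi x - phi x| <= 1 &
    `|psi x - phi x| <= w / 2 / (c + 1)].
  by have := hd x; rewrite !le_min => /andP[/andP[-> ->] ->].
have cphi := hderiv_cont dp; have cpsi := hderiv_cont dps.
have fe x : `|f (psi x) - f (phi x)| <= w / 2 /\ `|f (psi x) - f (phi x)| <= e.
  have [h _ _] := hd x; have := hr _ _ h.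
  by rewrite le_min => /andP[].
split.
- split; first by apply: contB; exact: cont_comp.
  by move=> x; have [] := fe x.
- pose g x := f x * (1 - cutoff N x); pose h x := f x * cutoff N x.
  have lg : L1le (fun x => g x ^+ 2) (a * e ^+ 2 / 16).
    apply: L1le_dom hN _ => x; rewrite /g exprMn !normrM -expr2 ler_wpM2l//.
    rewrite ler_piMl// ger0_norm ?subr_ge0 ?cutoff_le1//.
    by rewrite gerBl cutoff_ge0.
  have lg1 := L1le_comp a0 dp cd ge lg.
  have lg2 := L1le_comp a0 dps cds ges lg.
  have lh : L1le (fun x => (h (psi x) - h (phi x)) ^+ 2) (8 * m * w ^+ 2).
    have hb x : `|h (psi x) - h (phi x)| <= w.
      have -> : h (psi x) - h (phi x) = (f (psi x) - f (phi x)) * cutoff N (psi x) +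
          f (phi x) * (cutoff N (psi x) - cutoff N (phi x)) by rewrite /h; ring.
      rewrite (le_trans (ler_normD _ _))// !normrM.
      have [_ _ h3] := hd x; have [h4 _] := fe x.
      have b1 : `|cutoff N (psi x)| <= 1 by rewrite ger0_norm ?cutoff_ge0 ?cutoff_le1.
      have k1 : `|f (psi x) - f (phi x)| * `|cutoff N (psi x)| <= w / 2 * 1 by exact: ler_pM.
      have k2 : `|f (phi x)| * `|cutoff N (psi x) - cutoff N (phi x)| <= (c + 1) * (w / 2 / (c + 1)).
        apply: ler_pM => //; first by rewrite (le_trans (bf _))// lerDl.
        exact: le_trans (cutoff_lip _ _ _) h3.
      have kd : (c + 1) * (w / 2 / (c + 1)) = w / 2 by rewrite mulrC divfK// gt_eqF.
      by rewrite kd in k2; lra.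
    apply: L1_compact => //; first by rewrite sqr_ge0.
      by move=> x; rewrite normrX lerXn2r ?nnegrE ?(ltW w0).
    move=> x mx; have Nx := hm x mx; have [_ h2 _] := hd x.
    rewrite /h !cutoff_out; [by rewrite !mulr0 subrr expr0n|by lra|].
    have := ler_distD (psi x) (phi x) 0; rewrite !subr0 (distrC (phi x)); lra.
  have S := L1leD (L1leZ 4 (L1leD lg1 lg2)) (L1leZ 2 lh).
  apply: (L1le_mono (L1le_dom S _)); last first.
    rewrite !ger0_norm//.
    rewrite (_ : a^-1 * (a * e ^+ 2 / 16) = e ^+ 2 / 16); last by field; rewrite gt_eqF.
    lra.
  move=> x; rewrite [leRHS]ger0_norm; last by rewrite addr_ge0// mulr_ge0 ?addr_ge0 ?sqr_ge0.
  rewrite normrX real_normK ?num_real//.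
  have -> : f (psi x) - f (phi x) = (g (psi x) - g (phi x)) + (h (psi x) - h (phi x)).
    by rewrite /g /h; ring.
  have q1 := sqr_ge0 ((g (psi x) - g (phi x)) - (h (psi x) - h (phi x))).
  have q2 := sqr_ge0 (g (psi x) + g (phi x)).
  lra.
- apply: vanishD; first exact: vanish_comp Bpsi vf.
  by apply: vanish_le (vanish_comp B vf) _ => x; rewrite normrN.
Qed.

Lemma G2M f c g (l : R) : G2 R f c -> continuous g -> (forall x, `|g x| <= l) ->
  G2 R (fun x => f x * g x) (l * c).
Proof.
move=> [[cf bf] lf vf] cg gl; have l0 : 0 <= l by exact: le_trans (gl 0).
split.
- split; first exact: contM.
  by move=> x; rewrite normrM mulrC; exact: ler_pM.
- have := @L1leM _ _ (fun x => g x ^+ 2) _ (l ^+ 2) lf.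
  rewrite (_ : (fun x => _ * _) = (fun x => (f x * g x) ^+ 2)); last first.
    by apply/funext => x; rewrite exprMn mulrC.
  by rewrite -exprMn; apply => x; rewrite normrX lerXn2r// nnegrE.
- rewrite (_ : (fun x => _) = (fun x => g x * f x)); first exact: vanishM vf gl.
  by apply/funext => x; rewrite mulrC.
Qed.

Definition V1comp u phi : V1 R := insubd 0 (u \o phi).

Lemma V1compE_of u phi w : w = u \o phi :> (R -> R) -> V1comp u phi = w.
Proof.
move=> wE; apply/val_inj; rewrite [LHS](insubdK _ _)//.
by rewrite -wE; exact/mem_set/V1P.
Qed.

Lemma V1comp_bound u a b phi dphi : bilip a b phi dphi ->
  V1comp u phi = u \o phi :> (R -> R) /\
  `|V1comp u phi| <= 4 * ((1 + a^-1) * (1 + b)) * `|u|.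
Proof.
move=> B; have [a0 d cd ge le] := B.
have ai : 0 < a^-1 by rewrite invr_gt0.
have b0 : 0 <= b by rewrite (le_trans (ltW a0))// (le_trans (ge 0)).
have du : hderiv (fun x => u (phi x)) (fun x => derive1 u (phi x) * dphi x).
  exact: hderiv_comp (V1_hderiv u) d.
have K0 : 0 <= (1 + a^-1) * `|u| by rewrite mulr_ge0// addr_ge0// ltW.
have g1 := G2_comp B (V1_G2 u).
have g2 : G2 R (fun x => derive1 u (phi x) * dphi x) ((1 + a^-1) * `|u| * b).
  rewrite mulrC; apply: (G2M (G2_comp B (V1_G2' u)) cd) => x.
  by rewrite ger0_norm// (le_trans (ltW a0)).
have [w [wE wb]] : exists w : V1 R, w = (fun x => u (phi x)) :> (R -> R) /\
    `|w| <= 4 * ((1 + a^-1) * `|u| * (1 + b)).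
  apply: V1_intro du _ _.
    by apply: gauge_le g1 _; rewrite ler_peMr// lerDl.
  by apply: gauge_le g2 _; rewrite ler_wpM2l// lerDr.
rewrite (V1compE_of (wE : w = u \o phi :> (R -> R))); split => //.
by rewrite (le_trans wb)// le_eqVlt; apply/orP; left; apply/eqP; ring.
Qed.

Lemma V1comp_cont u a b phi dphi : bilip a b phi dphi -> forall e, 0 < e ->
  exists2 d, 0 < d & forall psi dpsi, bilip a b psi dpsi ->
  (forall x, `|psi x - phi x| <= d) -> (forall x, `|dpsi x - dphi x| <= d) ->
  `|V1comp u psi - V1comp u phi| <= e.
Proof.
move=> B e e0; have [a0 dp cd ge le] := B.
have ai : 0 < a^-1 by rewrite invr_gt0.
have b0 : 0 < b by rewrite (lt_le_trans a0)// (le_trans (ge 0)).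
pose K := (1 + a^-1) * `|u| + 1.
have K0 : 0 < K by rewrite ltr_wpDl// mulr_ge0// addr_ge0// ltW.
pose e1 := e / 8 / (1 + b).
have e10 : 0 < e1 by rewrite !divr_gt0// addr_gt0.
have e1e : e1 * (1 + b) = e / 8 by rewrite /e1 divfK// gt_eqF// addr_gt0.
have [d1 d10 h1] := comp_G2_cont B (V1_G2 u) e10.
have [d2 d20 h2] := comp_G2_cont B (V1_G2' u) e10.
pose d3 := e / 8 / K; have d30 : 0 < d3 by rewrite !divr_gt0.
have Kd3 : K * d3 = e / 8 by rewrite /d3 mulrC divfK// gt_eqF.
exists (Num.min (Num.min d1 d2) d3); first by rewrite !lt_min d10 d20.
move=> psi dpsi Bs hs hds; have [_ dps cds ges les] := Bs.
have {hs} hs x : `|psi x - phi x| <= d1 /\ `|psi x - phi x| <= d2.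
  by have := hs x; rewrite !le_min => /andP[/andP[]].
have {hds} hds x : `|dpsi x - dphi x| <= d3.
  by have := hds x; rewrite le_min => /andP[].
have [E1 _] := V1comp_bound u Bs; have [E0 _] := V1comp_bound u B.
have k1 := h1 _ _ Bs (fun x => (hs x).1); have k2 := h2 _ _ Bs (fun x => (hs x).2).
have dE : hderiv (fun x => u (psi x) - u (phi x))
    (fun x => derive1 u (psi x) * dpsi x - derive1 u (phi x) * dphi x).
  by apply: hderivB; exact: hderiv_comp (V1_hderiv u) _.
have bds x : `|dpsi x| <= b by rewrite ger0_norm// (le_trans (ltW a0)).
have G' : G2 R (fun x => derive1 u (psi x) * dpsi x - derive1 u (phi x) * dphi x) (e / 4).
  have := gaugeD (G2M k2 cds bds)
    (G2M (G2_comp B (V1_G2' u)) (contB cds cd) hds).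
  rewrite (_ : (fun x => _) = (fun x =>
    derive1 u (psi x) * dpsi x - derive1 u (phi x) * dphi x)); last first.
    by apply/funext => x; ring.
  move=> h; apply: gauge_le h _.
  have : d3 * ((1 + a^-1) * `|u|) <= e / 8.
    by rewrite -Kd3 mulrC ler_wpM2r ?(ltW d30)// lerDl.
  lra.
have G : G2 R (fun x => u (psi x) - u (phi x)) (e / 4).
  have h : 0 <= e1 * b by rewrite mulr_ge0 ?ltW.
  by apply: gauge_le k1 _; lra.
have [w [wE wb]] := V1_intro dE G G'.
have -> : V1comp u psi - V1comp u phi = w.
  apply: V1_eq => x; rewrite wE -[LHS]/(V1comp u psi x - V1comp u phi x).
  by rewrite E1 E0.
by move: wb; lra.
Qed.

Lemma V1comp_sub u v a b phi dphi : bilip a b phi dphi ->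
  `|V1comp u phi - V1comp v phi| <= 4 * ((1 + a^-1) * (1 + b)) * `|u - v|.
Proof.
move=> B; have [Eu _] := V1comp_bound u B; have [Ev _] := V1comp_bound v B.
have [Euv h] := V1comp_bound (u - v) B.
rewrite (_ : V1comp u phi - V1comp v phi = V1comp (u - v) phi)//.
apply: V1_eq => x; rewrite -[LHS]/(V1comp u phi x - V1comp v phi x).
by rewrite Eu Ev Euv.
Qed.

(** Composition with a given map is linear and bounded, with a bound that only depends
  on the constants [a] and [b]; so continuity in the inner map is enough. *)
Lemma V1comp_joint u a b phi dphi : bilip a b phi dphi -> forall e, 0 < e ->
  exists2 d, 0 < d & forall v psi dpsi, hderiv psi dpsi -> continuous dpsi ->
  (forall x, `|psi x - phi x| <= d) -> (forall x, `|dpsi x - dphi x| <= d) ->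
  `|v - u| <= d ->
  bilip (a / 2) (b + 1) psi dpsi /\ `|V1comp v psi - V1comp u phi| <= e.
Proof.
move=> B e e0; have [a0 dp cd ge le] := B.
have a20 : 0 < a / 2 by rewrite divr_gt0.
have b0 : 0 < b by rewrite (lt_le_trans a0)// (le_trans (ge 0)).
have B' : bilip (a / 2) (b + 1) phi dphi.
  by split => // x; [have := ge x; lra|have := le x; lra].
have e20 : 0 < e / 2 by rewrite divr_gt0.
have [d1 d10 h1] := V1comp_cont u B' e20.
pose C := 4 * ((1 + (a / 2)^-1) * (1 + (b + 1))).
have C0 : 0 < C by rewrite !mulr_gt0// ?addr_gt0 ?invr_gt0//; lra.
pose d2 := e / 2 / C; have d20 : 0 < d2 by rewrite divr_gt0.
have Cd2 : C * d2 = e / 2 by rewrite /d2 mulrC divfK// gt_eqF.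
exists (Num.min (Num.min d1 d2) (Num.min (a / 2) 1)).
  by rewrite !lt_min d10 d20 a20 ltr01.
move=> v psi dpsi dps cds hs hds hv.
have Bs : bilip (a / 2) (b + 1) psi dpsi.
  split => // x; have := hds x; rewrite !le_min => /andP[_ /andP[]];
    rewrite !ler_norml => /andP[? ?] /andP[? ?].
    by have := ge x; lra.
  by have := le x; lra.
split => //.
have {}hs x : `|psi x - phi x| <= d1 by have := hs x; rewrite !le_min => /andP[/andP[]].
have {}hds x : `|dpsi x - dphi x| <= d1 by have := hds x; rewrite !le_min => /andP[/andP[]].
have {}hv : `|v - u| <= d2 by move: hv; rewrite !le_min => /andP[/andP[]].
have k1 := h1 _ _ Bs hs hds.
have k2 : `|V1comp v psi - V1comp u psi| <= e / 2.
  by rewrite -Cd2 (le_trans (V1comp_sub _ _ Bs))// ler_wpM2l// ltW.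
apply: (le_trans (ler_distD (V1comp u psi) _ _)); rewrite (splitr e).
by apply: lerD; [exact: k2|exact: k1].
Qed.

Implicit Types (eta xi : D R).

(** Because of the lower bound for the slope, close diffeomorphisms have close inverses;
  the slopes of the inverses are close because [eta'] is uniformly continuous. So
  [V1comp_joint] applies to the inverses. *)
Lemma comp_inv_cont eta u : forall e, 0 < e -> exists2 d, 0 < d & forall xi v,
  `|D_chart xi - D_chart eta| <= d -> `|v - u| <= d ->
  `|V1comp v (D_inv xi) - V1comp u (D_inv eta)| <= e.
Proof.
move=> e e0; have [a [b B]] := D_bilip eta; have [a0 de cde ge le] := B.
have Bi := bilip_inv B (@D_invK R eta).
have [d1 d10 h1] := V1comp_joint u Bi e0.
pose dV := derive1 (D_chart eta).
have [r r0 hr] : exists2 r, 0 < r & forall x y, `|y - x| <= r ->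
    `|dV y - dV x| <= d1 * a ^+ 2 / 4.
  apply: vanish_unif_cont; [exact: V1_derive_cont|by have [] := V1_G2' (D_chart eta)|].
  by rewrite divr_gt0// mulr_gt0// exprn_gt0.
have a2 : 0 < a ^+ 2 by rewrite exprn_gt0.
exists (Num.min (Num.min (a * r) (a * d1)) (Num.min (Num.min (a / 2) (d1 * a ^+ 2 / 4)) d1)).
  by rewrite !lt_min !mulr_gt0 ?divr_gt0// mulr_gt0.
move=> xi v hxi hv.
have {}hv : `|v - u| <= d1 by move: hv; rewrite !le_min => /andP[_ /andP[_]].
have dxi := D_inv_deriv xi.
have cdxi : continuous (fun y => (derive1 xi (D_inv xi y))^-1).
  by have [a' [b' B']] := D_bilip xi; have [] := bilip_inv B' (@D_invK R xi).
have [k [k1 k2 k3 k4] [E0 E1]] : exists2 k : R,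
    [/\ k <= a * r, k <= a * d1, k <= a / 2 & k <= d1 * a ^+ 2 / 4] &
    (forall x, `|xi x - eta x| <= k) /\
    (forall x, `|derive1 xi x - derive1 eta x| <= k).
  exists `|D_chart xi - D_chart eta|.
    by move: hxi; rewrite !le_min => /andP[/andP[-> ->] /andP[/andP[-> ->] _]].
  split=> x.
    have := V1_le (D_chart xi - D_chart eta) x.
    rewrite -[V1_fun _ x]/((xi x - x) - (eta x - x)).
    by rewrite (_ : _ - _ = xi x - eta x)//; ring.
  have := V1_le' (D_chart xi - D_chart eta) x.
  rewrite V1_derive1B !chart_derive1.
  by rewrite (_ : _ - _ = derive1 xi x - derive1 eta x)//; ring.
suff [s1 s2] : (forall y, `|D_inv xi y - D_inv eta y| <= d1) /\
    (forall y, `|(derive1 xi (D_inv xi y))^-1 - (derive1 eta (D_inv eta y))^-1| <= d1).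
  by have [] := h1 v (D_inv xi) _ dxi cdxi s1 s2 hv.
clear v hv hxi h1.
have S y : `|D_inv xi y - D_inv eta y| <= a^-1 * k.
  rewrite ler_pdivlMl//; apply: (le_trans (bilip_expand _ _ B)).
  by rewrite D_invK; have := E0 (D_inv xi y); rewrite D_invK distrC.
split.
- by move=> y; rewrite (le_trans (S y))// ler_pdivrMl.
- move=> y; set x := D_inv xi y; set x0 := D_inv eta y.
  have hx : `|derive1 xi x - derive1 eta x0| <= d1 * a ^+ 2 / 2.
    rewrite (le_trans (ler_distD (derive1 eta x) _ _))//.
    have := le_trans (E1 x) k4.
    have : `|dV x - dV x0| <= d1 * a ^+ 2 / 4.
      by apply: hr; rewrite (le_trans (S y))// ler_pdivrMl.
    rewrite /dV !chart_derive1 (_ : _ - _ = derive1 eta x - derive1 eta x0); last by ring.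
    lra.
  have p0 : a <= derive1 eta x0 by exact: ge.
  have p1 : a / 2 <= derive1 xi x.
    have := le_trans (E1 x) k3; rewrite ler_norml => /andP[? _].
    by have := ge x; lra.
  have n0 : derive1 eta x0 != 0 by rewrite gt_eqF//; lra.
  have n1 : derive1 xi x != 0 by rewrite gt_eqF//; lra.
  rewrite (_ : _ - _ = - (derive1 xi x - derive1 eta x0) / (derive1 xi x * derive1 eta x0)); last first.
    by field; rewrite n0.
  rewrite normrM normrN normfV ler_pdivrMr ?normr_gt0 ?mulf_neq0//.
  rewrite (le_trans hx)// ger0_norm; last by rewrite mulr_ge0//; lra.
  rewrite -mulrA ler_wpM2l ?(ltW d10)//.
  have -> : a ^+ 2 / 2 = a / 2 * a by ring.
  by rewrite ler_pM//; lra.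
Qed.

End composition.

(** * Derivatives with respect to time *)

Section time_calculus.
Variables (R : realType).
Implicit Types (A : set R) (t s e d : R).

Section one_space.
Variable W : normedModType R.
Implicit Types (f g : R -> W).

Lemma is_derive_withinP A f t l : is_derive_within A f t l <-> tderiv A f t l.
Proof.
have E s : s - t != 0 -> l - (s - t)^-1 *: (f s - f t) =
    - ((s - t)^-1 *: (f s - f t - (s - t) *: l)).
  move=> st; rewrite -[in LHS](scale1r l) -(mulVf st).
  by move: (s - t)^-1 => c; lmod R.
split.
  move=> /cvgrPdist_le h e e0; have /nbhs_ballP[d d0 hd] := h e e0.
  exists d => // s As st; have [->|st0] := eqVneq s t.
    by rewrite !subrr scale0r subr0 !normr0 mulr0.
  have st1 : s - t != 0 by rewrite subr_eq0.
  have := hd s _ st0 As; rewrite /ball/= distrC => /(_ st).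
  rewrite E// normrN normrZ normfV ler_pdivrMl ?normr_gt0//.
  by rewrite [X in _ <= X]mulrC.
move=> h; apply/cvgrPdist_le => e e0; have [d d0 hd] := h e e0.
apply/nbhs_ballP; exists d => // s; rewrite /ball/= distrC => st st0 As.
have st1 : s - t != 0 by rewrite subr_eq0.
rewrite E// normrN normrZ normfV ler_pdivrMl ?normr_gt0//.
by rewrite [X in _ <= X]mulrC; exact: hd.
Qed.

Lemma tderiv_sub A A' f t l : A' `<=` A -> tderiv A f t l -> tderiv A' f t l.
Proof. by move=> AA h e /h; exact: ederiv_sub. Qed.

Lemma tderiv_ext A f g t l : A t -> (forall s, A s -> f s = g s) ->
  tderiv A f t l -> tderiv A g t l.
Proof.
move=> At fg h e /h[d d0 hd]; exists d => // s As st.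
by rewrite -(fg s As) -(fg t At); exact: hd.
Qed.

Lemma tderivB A f g t l m : tderiv A f t l -> tderiv A g t m ->
  tderiv A (fun s => f s - g s) t (l - m).
Proof.
move=> hf hg e e0; have e20 : 0 < e / 2 by rewrite divr_gt0.
by rewrite (splitr e); apply: ederivB; [exact: hf|exact: hg].
Qed.

Lemma tderiv_cst A (c : W) t : tderiv A (fun=> c) t 0.
Proof.
move=> e e0; exists 1 => // s _ _.
by rewrite subrr scaler0 subr0 normr0 mulr_ge0// ltW.
Qed.

Lemma tderiv_growth A f t l : tderiv A f t l -> exists2 d, 0 < d &
  forall s, A s -> `|s - t| < d -> `|f s - f t| <= (`|l| + 1) * `|s - t|.
Proof. by move=> /(_ 1 ltr01)/ederiv_growth. Qed.

Lemma gronwall_exact f (a b L k c : R) : 0 <= L -> 0 <= k -> `|f a| <= c ->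
  (forall t, a <= t -> t <= b -> exists2 l,
    `|l| <= L * `|f t| + k & tderiv (seg a b) f t l) ->
  forall t, a <= t -> t <= b -> `|f t| <= (c + k * (t - a)) * expR (L * (t - a)).
Proof.
move=> L0 k0 fa h t at' tb; apply/ler_addgt0Pr => e e0.
pose K := (t - a) * expR (L * (t - a)) + 1.
have K0 : 0 < K by rewrite ltr_wpDl// mulr_ge0 ?expR_ge0// subr_ge0.
have d0 : 0 < e / K by rewrite divr_gt0.
apply: (@le_trans _ _ ((c + (k + e / K) * (t - a)) * expR (L * (t - a)))).
  apply: (@gronwall _ _ f a b L (k + e / K) c) => //; first by rewrite addr_ge0// ltW.
  move=> s as' sb; have [l ll dl] := h s as' sb.
  by exists l, (e / K); split; [rewrite addrA lerD2r|exact: dl].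
have -> : (c + (k + e / K) * (t - a)) * expR (L * (t - a)) =
  (c + k * (t - a)) * expR (L * (t - a)) + e / K * ((t - a) * expR (L * (t - a))) by ring.
rewrite lerD2l mulrAC ler_pdivrMr// ler_wpM2l ?(ltW e0)// lerDl//.
Qed.

(** Gronwall's inequality with zero constants. *)
Lemma tderiv_unique f g (a b : R) : f a = g a ->
  (forall t, a <= t -> t <= b -> exists2 l, tderiv (seg a b) f t l & tderiv (seg a b) g t l) ->
  forall t, a <= t -> t <= b -> f t = g t.
Proof.
move=> fga h t at' tb; apply/eqP; rewrite -subr_eq0 -normr_le0.
have := @gronwall_exact (fun t => f t - g t) a b 0 0 0 (lexx _) (lexx _).
rewrite fga subrr normr0 => /(_ (lexx _)) G.
have := G _ t at' tb; rewrite !mul0r add0r mul0r; apply=> s as' sb.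
have [l hf hg] := h s as' sb; exists 0; first by rewrite normr0 addr0.
by rewrite -(subrr l); exact: tderivB.
Qed.

Lemma contwP (X : normedModType R) (B : set X) (f : X -> W) :
  {within B, continuous f} <-> forall x, B x -> forall e, 0 < e ->
  exists2 d, 0 < d & forall y, B y -> `|y - x| < d -> `|f y - f x| <= e.
Proof.
split.
  move=> /subspace_continuousP h x Bx e e0.
  have /cvgrPdist_le/(_ e e0)/nbhs_ballP[d d0 hd] := h x Bx.
  exists d => // y By yx; rewrite distrC; apply: hd => //.
  by rewrite -ball_normE /ball_/= distrC.
move=> h; apply/subspace_continuousP => x Bx; apply/cvgrPdist_le => e e0.
have [d d0 hd] := h x Bx e e0.
apply/nbhs_ballP; exists d => // y; rewrite -ball_normE /ball_/= distrC => yx By.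
by rewrite distrC; exact: hd.
Qed.

Definition cont_at A f t := forall e, 0 < e ->
  exists2 d, 0 < d & forall s, A s -> `|s - t| < d -> `|f s - f t| <= e.

Lemma tderiv_cont_at A f t l : tderiv A f t l -> cont_at A f t.
Proof.
move=> h e e0; have [d d0 hd] := tderiv_growth h.
have l0 : 0 < `|l| + 1 by rewrite ltr_wpDl.
exists (Num.min d (e / (`|l| + 1))); first by rewrite lt_min d0 divr_gt0.
move=> s As; rewrite lt_min => /andP[sd se]; rewrite (le_trans (hd s As sd))//.
by rewrite mulrC -ler_pdivlMr// ltW.
Qed.

Lemma tderiv_cont A f (df : R -> W) : (forall t, A t -> tderiv A f t (df t)) ->
  {within A, continuous f}.
Proof. by move=> h; apply/contwP => t At; exact: tderiv_cont_at (h t At). Qed.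

Lemma tderiv_lip f (df : R -> W) (S M : R) : 0 <= M ->
  (forall t, seg 0 S t -> tderiv (seg 0 S) f t (df t)) ->
  (forall t, seg 0 S t -> `|df t| <= M) ->
  forall t s, seg 0 S t -> seg 0 S s -> `|f s - f t| <= M * `|s - t|.
Proof.
move=> M0 hf hM.
have H a b : seg 0 S a -> seg 0 S b -> a <= b -> `|f b - f a| <= M * (b - a).
  move=> /andP[a0 _] /andP[_ bS] ab.
  have sub : seg a b `<=` seg 0 S.
    by move=> z /andP[az zb]; rewrite /seg/= (le_trans a0 az) (le_trans zb).
  apply/ler_addgt0Pr => e e0.
  have fa : `|f a - f a| <= 0 by rewrite subrr normr0.
  have G := @gronwall_exact (fun t => f t - f a) a b 0 M 0 (lexx 0) M0 fa.
  have {}G := G _ b ab (lexx b); rewrite mul0r expR0 mulr1 add0r in G.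
  apply: (@le_trans _ _ (M * (b - a))); last by rewrite lerDl ltW.
  apply: G => z az zb; have abz : seg a b z by rewrite /seg/= az.
  exists (df z - 0); first by rewrite subr0 mul0r add0r; exact: hM (sub z abz).
  apply: tderivB; first exact: tderiv_sub sub (hf z (sub z abz)).
  exact: tderiv_cst.
move=> t s St Ss; have [ts|/ltW st] := leP t s.
  by rewrite (ger0_norm (_ : 0 <= s - t)) ?subr_ge0//; exact: H.
by rewrite distrC (distrC s) (ger0_norm (_ : 0 <= t - s)) ?subr_ge0//; exact: H.
Qed.
End one_space.

Section two_spaces.
Variables V W : normedModType R.

Lemma tderiv_pair A (f : R -> V) (g : R -> W) t l m :
  tderiv A f t l -> tderiv A g t m -> tderiv A (fun s => (f s, g s)) t (l, m).
Proof.
move=> hf hg e e0; have [d d0 hd] := hf e e0; have [d' d'0 hd'] := hg e e0.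
exists (Num.min d d'); first by rewrite lt_min d0.
move=> s As; rewrite lt_min => /andP[sd sd'].
by apply: norm_pair_le => /=; [exact: hd|exact: hd'].
Qed.

Lemma tderiv_contract A (f : R -> V) t l (F : V -> W) :
  (forall (a : R) u v, F (a *: u + v) = a *: F u + F v) -> (forall u, `|F u| <= `|u|) ->
  tderiv A f t l -> tderiv A (fun s => F (f s)) t (F l).
Proof.
move=> lin bd hf e /hf[d d0 hd]; exists d => // s As st.
rewrite (_ : F (f s) - F (f t) - (s - t) *: F l = F (f s - f t - (s - t) *: l)).
  by rewrite (le_trans (bd _))// hd.
have -> : f s - f t - (s - t) *: l = (- (s - t)) *: l + ((-1) *: f t + f s) by lmod R.
by rewrite !lin; lmod R.
Qed.

Lemma geo_complete_pair : geo_complete V -> geo_complete W ->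
  geo_complete ((V * W)%type : normedModType R).
Proof.
move=> cV cW C u hu.
have [l hl] := cV C (fun n => (u n).1) (fun n => le_trans (norm_fst _) (hu n)).
have [m hm] := cW C (fun n => (u n).2) (fun n => le_trans (norm_snd _) (hu n)).
by exists (l, m) => n; apply: norm_pair_le => /=; [exact: hl|exact: hm].
Qed.

End two_spaces.

Lemma itv0_0 (T : \bar R) : (0 < T)%E -> itv0 T 0.
Proof. by move=> T0; split. Qed.

Lemma itv0_lt (T : \bar R) t : itv0 T t -> exists2 S, t < S & itv0 T S.
Proof.
move=> [t0 tT]; case: T tT => [T| |//].
  rewrite lte_fin => tT; exists ((t + T) / 2); first by lra.
  by split; [lra|rewrite lte_fin; lra].
by exists (t + 1); [lra|split; [lra|exact: ltry]].
Qed.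

Lemma itv0_seg (T : \bar R) S : itv0 T S -> seg 0 S `<=` itv0 T.
Proof.
move=> [S0 ST] t /andP[t0 tS]; split => //.
by apply: le_lt_trans ST; rewrite lee_fin.
Qed.

Lemma tderiv_itv0 (W : normedModType R) (f : R -> W) (T : \bar R) t l : itv0 T t ->
  (forall S, itv0 T S -> t <= S -> tderiv (seg 0 S) f t l) -> tderiv (itv0 T) f t l.
Proof.
move=> Tt h e e0; have [S tS TS] := itv0_lt Tt.
have [d d0 hd] := h S TS (ltW tS) e e0.
exists (Num.min d (S - t)); first by rewrite lt_min d0 subr_gt0.
move=> s [s0 _]; rewrite lt_min => /andP[sd sS]; apply: hd => //.
rewrite /seg/= s0 -(subrK t s) -lerBrDr.
by rewrite (le_trans (ler_norm _))// ltW.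
Qed.

End time_calculus.

(** * The Lagrangian flow *)

Lemma norm_near (R : realType) (V : normedModType R) (p q : V) (r : R) :
  `|q - p| < r -> `|q| <= `|p| + r.
Proof.
move=> h; have := ler_normD (q - p) p; rewrite subrK => /le_trans; apply.
by rewrite addrC lerD2l ltW.
Qed.

Section lagrangian_flow.
Variable R : realType.
Local Notation TD := (V1 R * V1 R)%type.
Implicit Types (p q : TD) (x y : R -> TD) (u v : V1 R) (T : \bar R).

(** In the chart, the diffeomorphism [Id] is the origin. *)
Definition flow_curve (A : set R) v x := x 0 = (0, v) /\
  forall t, A t -> D_chart_domain (x t).1 /\ tderiv A x t (field (x t)).

Lemma D_of_dom : forall v, D_chart_domain v -> exists eta : D R, D_chart eta = v.
Proof. by move=> v; rewrite -range_D_chart => -[eta _ <-]; exists eta. Qed.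

Lemma dom0 : @D_chart_domain R 0.
Proof.
apply: (@dom_intro _ _ 1) => // x; rewrite (_ : derive1 _ = fun=> 0) ?addr0//.
by apply: hderiv1E; exact: hderiv_cst.
Qed.

Lemma force_cont p : D_chart_domain p.1 -> forall e, 0 < e -> exists2 d, 0 < d &
  forall q, `|q - p| < d -> `|force q - force p| <= e.
Proof.
move=> /force_local[L [r [C [r0 C0 H]]]] e e0.
have C1 : 0 < C + 1 by rewrite ltr_wpDl.
exists (Num.min r (e / (C + 1))); first by rewrite lt_min r0 divr_gt0.
move=> q; rewrite lt_min => /andP[qr qe].
have pr : `|p - p| < r by rewrite subrr normr0.
have [_ _ _ _ /(_ q qr)[h _ _]] := H p pr.
apply: (le_trans h); apply: (@le_trans _ _ ((C + 1) * `|q - p|)).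
  by apply: ler_wpM2r; [exact: normr_ge0|rewrite lerDl].
by rewrite mulrC -ler_pdivlMr//; exact: ltW.
Qed.

Lemma curve_of_solution T v (eta : R -> D R) (U : R -> V1 R) : 
  system_solution T v eta U ->
  flow_curve (itv0 T) v (fun t => (D_chart (eta t), U t)).
Proof.
move=> [dU [[hd _] hdU eta0 U0]]; split.
  congr pair => //; apply: V1_eq => x.
  by rewrite -[LHS]/(eta 0 x - x) eta0 subrr.
move=> t Tt; split; first exact: chart_dom.
have /is_derive_withinP := hd t Tt.
rewrite (_ : dU t = force (D_chart (eta t), U t))//.
by apply: V1_eq => x; rewrite force_Lconj -hdU.
Qed.

Lemma solution_of_curve T v x : (0 < T)%E -> flow_curve (itv0 T) v x ->
  exists (eta : R -> D R) (U : R -> V1 R), system_solution T v eta U /\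
    forall t, itv0 T t -> (D_chart (eta t), U t) = x t.
Proof.
move=> T0 [x0 hx].
have : forall t, exists eta : D R, itv0 T t -> D_chart eta = (x t).1.
  move=> t; have [Tt|nTt] := pselect (itv0 T t).
    by have [dx _] := hx t Tt; have [eta E] := D_of_dom dx; exists eta.
  by have [eta _] := D_of_dom dom0; exists eta.
move=> /choice[eta etaE]; exists eta, (fun t => (x t).2).
have E t : itv0 T t -> (D_chart (eta t), (x t).2) = x t.
  by move=> Tt; rewrite etaE//; case: (x t).
have T00 := itv0_0 T0.
split => //; exists (fun t => force (x t)); split.
- split.
    move=> t Tt; apply/is_derive_withinP.
    have [_ h] := hx t Tt.
    by apply: tderiv_ext h => // s Ts; rewrite E.
  have cx := tderiv_cont (fun t Tt => (hx t Tt).2).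
  apply/contwP => t Tt e e0.
  have [d d0 hd] := force_cont (hx t Tt).1 e0.
  have m0 : 0 < Num.min e (d / 2) by rewrite lt_min e0 divr_gt0.
  have [d' d'0 hd'] := (contwP _ _).1 cx t Tt _ m0.
  have [me md] : Num.min e (d / 2) <= e /\ Num.min e (d / 2) <= d / 2.
    by rewrite !ge_min !lexx orbT.
  exists d'; first exact: d'0.
  move=> s Ts st; have h := hd' s Ts st.
  have xe := le_trans h me; have xd := le_trans h md.
  apply: norm_pair_le => /=; first exact: le_trans (norm_snd (x s - x t)) xe.
  by apply: hd; apply: (le_lt_trans xd); rewrite ltr_pdivrMr// ltr_pMr// ltr1n.
- by move=> t Tt; rewrite -(E t Tt); exact: force_Lconj.
- apply/funext => z; have := congr1 (fun w : V1 R => w z) (etaE 0 T00).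
  by rewrite x0 /= => /eqP; rewrite subr_eq0 => /eqP.
- by rewrite x0.
Qed.

(** By induction along the interval: the local Lipschitz estimate and Gronwall's
  inequality continue an equality to the right, and continuity closes it. *)
Lemma flow_curve_unique T v x y : flow_curve (itv0 T) v x -> flow_curve (itv0 T) v y ->
  forall t, itv0 T t -> x t = y t.
Proof.
move=> [x0 hx] [y0 hy] S TS; have [S0 _] := TS.
have sub := itv0_seg TS.
have cont z w (h : flow_curve (itv0 T) w z) t e : 0 < e -> seg 0 S t -> exists2 d, 0 < d &
    forall s, seg 0 S s -> `|s - t| < d -> `|z s - z t| <= e.
  move=> e0 St; have [_ hz] := h.
  have cz := tderiv_cont (fun t Tt => (hz t Tt).2).
  have [d d0 hd] := (contwP _ _).1 cz t (sub t St) _ e0.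
  by exists d => // s Ss; apply: hd; exact: sub.
apply: (@real_ind R (fun t => x t = y t) 0 S _ _ _ S S0 (lexx S)).
- by rewrite x0 y0.
- move=> t t0 tS /(_ t t0 (lexx t)) xy.
  have St : seg 0 S t by rewrite /seg/= t0 ltW.
  have [L [r [C [r0 C0 H]]]] := force_local (hx t (sub t St)).1.
  have r20 : 0 < r / 2 by rewrite divr_gt0.
  have rr : r / 2 < r by rewrite ltr_pdivrMr// ltr_pMr// ltr1n.
  have [d1 d10 h1] := cont x v (conj x0 hx) t _ r20 St.
  have [d2 d20 h2] := cont y v (conj y0 hy) t _ r20 St.
  exists (Num.min d1 d2 / 2); first by rewrite divr_gt0// lt_min d10.
  move=> s ts sd sS.
  have in_s z : t <= z -> z <= s -> [/\ seg 0 S z, `|z - t| < d1 & `|z - t| < d2].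
    move=> tz zs; have zd : `|z - t| < Num.min d1 d2.
      have m0 : 0 < Num.min d1 d2 by rewrite lt_min d10.
      by rewrite ger0_norm ?subr_ge0//; lra.
    by move: zd; rewrite lt_min => /andP[-> ->]; rewrite /seg/= (le_trans t0 tz) (le_trans zs).
  apply/eqP; rewrite -subr_eq0 -normr_le0.
  have := @gronwall_exact _ _ (fun z => x z - y z) t s (1 + C) 0 0 (addr_ge0 ler01 C0) (lexx _).
  rewrite {1}xy subrr normr0 => /(_ (lexx _)) G.
  have := G _ s ts (lexx s); rewrite mul0r add0r mul0r; apply => z tz zs.
  have [Sz zd1 zd2] := in_s z tz zs.
  have xr : `|x z - x t| < r by apply: le_lt_trans rr; exact: h1.
  have yr : `|y z - x t| < r by apply: le_lt_trans rr; rewrite xy; exact: h2.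
  exists (field (x z) - field (y z)).
    have [_ _ _ _ /(_ _ xr)[h _ _]] := H _ yr.
    rewrite addr0; apply: norm_pair_le => /=; rewrite mulrDl mul1r.
      apply: (le_trans (norm_snd (x z - y z))).
      by rewrite lerDl mulr_ge0.
    by apply: (le_trans h); rewrite lerDr normr_ge0.
  have dx := (hx z (sub z Sz)).2; have dy := (hy z (sub z Sz)).2.
  apply: tderiv_sub (tderivB dx dy) => w /andP[tw ws]; apply: sub.
  by rewrite /seg/= (le_trans t0 tw) (le_trans ws).
- move=> t t0 tS hs.
  have St : seg 0 S t by rewrite /seg/= ltW.
  apply/eqP; rewrite -subr_eq0 -normr_le0; apply/ler_addgt0Pr => e e0; rewrite add0r.
  have e20 : 0 < e / 2 by rewrite divr_gt0.
  have [d1 d10 h1] := cont x v (conj x0 hx) t _ e20 St.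
  have [d2 d20 h2] := cont y v (conj y0 hy) t _ e20 St.
  pose m := Num.min (Num.min (d1 / 2) (d2 / 2)) t.
  have m0 : 0 < m by rewrite !lt_min !divr_gt0.
  have [m1 m2 m3] : [/\ m <= d1 / 2, m <= d2 / 2 & m <= t] by rewrite /m !ge_min !lexx ?orbT.
  have tm : `|(t - m) - t| = m by rewrite addrAC subrr add0r normrN gtr0_norm.
  have Sm : seg 0 S (t - m) by rewrite /seg/=; apply/andP; split; lra.
  have xy : x (t - m) = y (t - m) by apply: hs; lra.
  have k1 : `|x (t - m) - x t| <= e / 2 by apply: h1; rewrite // tm; lra.
  have k2 : `|y (t - m) - y t| <= e / 2 by apply: h2; rewrite // tm; lra.
  apply: (le_trans (ler_distD (x (t - m)) _ _)); rewrite (splitr e).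
  by apply: lerD; [rewrite distrC; exact: k1|rewrite xy; exact: k2].
Qed.

Lemma TD_complete : geo_complete (TD : normedModType R).
Proof. by apply: geo_complete_pair; exact: V1_geo_complete. Qed.

(** On a ball of radius [r] around the initial point the field is bounded by [M] and
  Lipschitz, and curves that start in its inner half do not leave it before time
  [r / (4 M)]. One time of existence thus serves all nearby data, and Gronwall's
  inequality compares their solutions. *)
Lemma local_flow u : exists (T r K : R) (x : V1 R -> R -> TD), [/\ 0 < T, 0 < r, 0 <= K,
  (forall v, `|v - u| < r -> flow_curve (itv0 T%:E) v (x v)) &
  (forall v w, `|v - u| < r -> `|w - u| < r -> forall t, itv0 T%:E t ->
    `|x v t - x w t| <= K * `|v - w|)].
Proof.
pose p : TD := (0, u).
have [L0 [r [C [r0 C0 H]]]] := @force_local R p dom0.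
pose M := `|p| + r + C.
have M0 : 0 < M by rewrite ltr_pwDl// ltr_wpDl// normr_ge0.
pose T := r / (4 * M).
have T0 : 0 < T by rewrite divr_gt0// mulr_gt0.
have MT : M * T = r / 4 by rewrite /T; field; rewrite gt_eqF.
have r40 : 0 < r / 4 by rewrite divr_gt0.
have r20 : 0 < r / 2 by rewrite divr_gt0.
have rr : r / 4 + r / 2 < r by clear - r0; lra.
pose B : set TD := [set q | `|q - p| < r].
have fieldM q : B q -> `|field q| <= M.
  move=> Bq; have [_ fC _ _ _] := H q Bq.
  apply: norm_pair_le => /=.
    apply: (@le_trans _ _ (`|p| + r)); last by rewrite lerDl.
    apply: (le_trans (norm_snd q)).
    exact: norm_near.
  by apply: (le_trans fC); rewrite lerDr addr_ge0 ?normr_ge0// ltW.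
have fieldL q q' : B q -> B q' -> `|field q - field q'| <= (1 + C) * `|q - q'|.
  move=> Bq Bq'; have [_ _ _ _ /(_ q Bq)[h _ _]] := H q' Bq'.
  apply: norm_pair_le => /=; rewrite mulrDl mul1r.
    by apply: (le_trans (norm_snd (q - q'))); rewrite lerDl mulr_ge0.
  by apply: (le_trans h); rewrite lerDr normr_ge0.
have start v : `|v - u| < r / 2 -> `|((0, v) : TD) - p| < r / 2.
  move=> vu; apply: le_lt_trans vu.
  by apply: norm_pair_le => /=; rewrite ?subrr ?normr0 ?normr_ge0.
have ex v : exists x, `|v - u| < r / 2 -> [/\ x 0 = (0, v),
    forall t, seg 0 T t -> B (x t) &
    forall t, seg 0 T t -> tderiv (seg 0 T) x t (field (x t))].
  have [vu|nvu] := pselect (`|v - u| < r / 2); last by exists (fun=> 0).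
  have inB (q : TD) : `|q - (0, v)| <= M * (T - 0) -> B q.
    rewrite subr0 MT => h; rewrite /B/=; apply: le_lt_trans rr.
    apply: (le_trans (ler_distD (0, v) _ _)).
    by apply: lerD; [exact: h|apply: ltW; exact: start].
  have [|||||||x [x0 xM xd]] := @ode_exists R TD (0, v) 0 T M (1 + C) B (fun=> @field R) TD_complete.
  - exact: ltW.
  - exact: ltW.
  - by rewrite addr_ge0.
  - exact: inB.
  - by move=> t q _; exact: fieldM.
  - by move=> t q q' _; exact: fieldL.
  - move=> t e _ e0; exists 1 => // s _ _ q _.
    by rewrite subrr normr0 ltW.
  - exists x => _; split; [exact: x0| |exact: xd].
    by move=> t /xM; exact: inB.
have [x hx] := choice ex.
have sub : itv0 T%:E `<=` seg 0 T.
  by move=> t [t0]; rewrite lte_fin => tT; rewrite /seg/= t0 ltW.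
exists T, (r / 2), (expR ((1 + C) * T)), x; split; [exact: T0|exact: r20|exact: expR_ge0| |].
- move=> v vu; have [x0 xB xd] := hx v vu.
  split; first exact: x0.
  move=> t /sub Tt; have [dq _ _ _ _] := H _ (xB t Tt).
  by split; [exact: dq|exact: tderiv_sub sub (xd t Tt)].
- move=> v w vu wu t /sub/andP[t0 tT].
  have [x0 xB xd] := hx v vu; have [y0 yB yd] := hx w wu.
  have C1 : 0 <= 1 + C by rewrite addr_ge0.
  have start0 : `|x v 0 - x w 0| <= `|v - w|.
    rewrite x0 y0; apply: norm_pair_le => /=; last exact: lexx.
    by rewrite subrr normr0 normr_ge0.
  have := @gronwall_exact _ _ (fun t => x v t - x w t) 0 T (1 + C) 0 _ C1 (lexx 0) start0.
  move=> G; have {G} G := G _ t t0 tT.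
  apply: (le_trans (G _)).
    move=> s s0 sT; have Ss : seg 0 T s by rewrite /seg/= s0.
    exists (field (x v s) - field (x w s)).
      by rewrite addr0; apply: fieldL; [exact: xB|exact: yB].
    by apply: tderivB; [exact: xd|exact: yd].
  rewrite mul0r addr0 subr0 mulrC; apply: ler_wpM2r; first exact: normr_ge0.
  by rewrite ler_expR; apply: ler_wpM2l.
Qed.

End lagrangian_flow.

(** * From Lagrangian to Eulerian variables *)

Section moving_frames.
Variable R : realType.
Implicit Types (A : set R) (t s e d : R) (w : R -> V1 R).

(** If the increments of [F] are those of [f] times a factor [k] that tends to [k0], plus
  those of [g], then [F' = k0 f' + g']. Applied with mean value slopes for [k], this is
  the chain rule along moving points, which needs no joint differentiability. *)
Lemma tderiv_comb A (F f g k : R -> R) (k0 : R) t (l m : R) :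
  tderiv A f t l -> tderiv A g t m ->
  (forall e, 0 < e -> exists2 d, 0 < d & forall s, A s -> `|s - t| < d -> `|k s - k0| <= e) ->
  (forall s, A s -> F s - F t = k s * (f s - f t) + (g s - g t)) ->
  tderiv A F t (k0 * l + m).
Proof.
move=> hf hg hk hF e e0.
have e30 : 0 < e / 3 by rewrite divr_gt0.
have K0 : 0 < `|k0| + 1 by rewrite ltr_wpDl.
have l0 : 0 < `|l| + 1 by rewrite ltr_wpDl.
have [d1 d10 h1] := hf (e / 3 / (`|k0| + 1)) (divr_gt0 e30 K0).
have [d2 d20 h2] := hg _ e30.
have m0 : 0 < Num.min 1 (e / 3 / (`|l| + 1)) by rewrite lt_min ltr01 divr_gt0.
have [d3 d30 h3] := hk _ m0.
exists (Num.min d1 (Num.min d2 d3)); first by rewrite !lt_min d10 d20.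
move=> s As; rewrite !lt_min => /and3P[s1 s2 s3].
have {h1} := h1 s As s1; have {h2} := h2 s As s2; have := h3 s As s3.
rewrite hF// le_min /GRing.scale/= => /andP[k1 k2] h2 h1.
have -> : k s * (f s - f t) + (g s - g t) - (s - t) * (k0 * l + m) =
  k s * (f s - f t - (s - t) * l) + (k s - k0) * l * (s - t) + (g s - g t - (s - t) * m).
  by ring.
have kb : `|k s| <= `|k0| + 1.
  by have := ler_normD (k s - k0) k0; rewrite subrK; lra.
have a1 : `|k s * (f s - f t - (s - t) * l)| <= e / 3 * `|s - t|.
  rewrite normrM (@le_trans _ _ ((`|k0| + 1) * (e / 3 / (`|k0| + 1) * `|s - t|)))//.
    by rewrite ler_pM.
  by rewrite mulrA [X in X * _]mulrC divfK// gt_eqF.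
have a2 : `|(k s - k0) * l * (s - t)| <= e / 3 * `|s - t|.
  rewrite normrM ler_wpM2r// normrM.
  rewrite (@le_trans _ _ (e / 3 / (`|l| + 1) * (`|l| + 1)))//.
    by rewrite ler_pM// lerDl.
  by rewrite divfK// gt_eqF.
rewrite (le_trans (ler_normD _ _))// (_ : e * _ = (e / 3 * `|s - t| + e / 3 * `|s - t|) +
  e / 3 * `|s - t|); last by field.
by rewrite lerD// (le_trans (ler_normD _ _))// lerD.
Qed.

Lemma slope_along A w (z : R -> R) t : cont_at A w t -> cont_at A z t ->
  cont_at A (fun s => derive1 (w s) (z s)) t.
Proof.
move=> cw cz e e0; have e20 : 0 < e / 2 by rewrite divr_gt0.
have [d1 d10 h1] := cw _ e20.
have [r r0 hr] := (contP _).1 (@V1_derive_cont R (w t)) (z t) _ e20.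
have [d2 d20 h2] := cz _ (divr_gt0 r0 (ltr0n _ 2)).
exists (Num.min d1 d2); first by rewrite lt_min d10.
move=> s As; rewrite lt_min => /andP[s1 s2].
apply: (le_trans (ler_distD (derive1 (w t) (z s)) _ _)); rewrite (splitr e).
apply: lerD; first exact: le_trans (V1_dist_le _ _ _) (h1 s As s1).
by apply: hr; have := h2 s As s2; lra.
Qed.

(** The slope of [w s] between [z t] and [z s] is a derivative at an intermediate
  point, which also moves continuously. *)
Lemma slope_cont A w (z : R -> R) t : cont_at A w t -> cont_at A z t ->
  exists k : R -> R, (forall s, w s (z s) - w s (z t) = k s * (z s - z t)) /\
  forall e, 0 < e -> exists2 d, 0 < d &
    forall s, A s -> `|s - t| < d -> `|k s - derive1 (w t) (z t)| <= e.
Proof.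
move=> cw cz.
have : forall s, exists c, `|c - z t| <= `|z s - z t| /\
    w s (z s) - w s (z t) = derive1 (w s) c * (z s - z t).
  by move=> s; have [c h1 h2] := mvt_near (V1_hderiv (w s)) (z t) (z s); exists c.
move=> /choice[c hc]; exists (fun s => derive1 (w s) (c s)); split.
  by move=> s; have [] := hc s.
have ct : c t = z t.
  by have [] := hc t; rewrite subrr normr0 normr_le0 subr_eq0 => /eqP.
rewrite -ct; apply: slope_along cw _ => e /cz[d d0 hd]; exists d => // s As st.
by rewrite ct; apply: le_trans (hd s As st); have [] := hc s.
Qed.

Lemma joint_cont A (F : V1 R -> R -> R) w :
  (forall u v x, `|F u x - F v x| <= `|u - v|) -> (forall u, continuous (F u)) ->
  {within A, continuous w} ->
  {within A `*` setT, continuous (fun p : R * R => F (w p.1) p.2)}.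
Proof.
move=> FL cF /contwP cw; apply/contwP => -[t x] [/= At _] e e0.
have e20 : 0 < e / 2 by rewrite divr_gt0.
have [d1 d10 h1] := cw t At _ e20.
have [d2 d20 h2] := (contP _).1 (cF (w t)) x _ e20.
exists (Num.min d1 d2); first by rewrite lt_min d10.
move=> [s y] [/= As _]; rewrite lt_min => /andP[n1 n2].
have k1 : `|F (w s) y - F (w t) y| <= e / 2.
  apply: (le_trans (FL _ _ _)); apply: h1 => //.
  exact: le_lt_trans (norm_fst ((s, y) - (t, x))) n1.
have k2 : `|F (w t) y - F (w t) x| <= e / 2.
  apply: h2; exact: le_lt_trans (norm_snd ((s, y) - (t, x))) n2.
apply: (le_trans (ler_distD (F (w t) y) _ _)); rewrite (splitr e).
by apply: lerD; [exact: k1|exact: k2].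
Qed.

Lemma V1_joint A w : {within A, continuous w} ->
  {within A `*` setT, continuous (fun p : R * R => w p.1 p.2)}.
Proof.
apply: (@joint_cont A (fun u x => u x)).
  by move=> u v x; exact: (V1_le (u - v) x).
by move=> u; exact: hderiv_cont (V1_hderiv u).
Qed.

Lemma V1_joint' A w : {within A, continuous w} ->
  {within A `*` setT, continuous (fun p : R * R => derive1 (w p.1) p.2)}.
Proof.
apply: (@joint_cont A (fun u => derive1 (u : V1 R))).
  by move=> u v x; exact: V1_dist_le.
by move=> u; exact: V1_derive_cont.
Qed.

Lemma tderiv_eval A w t (l : V1 R) (x : R) : tderiv A w t l ->
  tderiv A (fun s => w s x) t (l x).
Proof.
apply: (@tderiv_contract R (V1 R) R A w t l (fun u : V1 R => u x)) => //.
by move=> u; exact: V1_le.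
Qed.

End moving_frames.

Section eulerian.
Variable R : realType.
Implicit Types (T : \bar R) (eta : R -> D R) (U : R -> V1 R).

Lemma V1comp_inv (xi : D R) (v : V1 R) : V1comp v (D_inv xi) = v \o D_inv xi :> (R -> R).
Proof.
have [a [b B]] := D_bilip xi.
by have [] := V1comp_bound v (bilip_inv B (@D_invK R xi)).
Qed.

Lemma eulerian_cont T v eta U (W : R -> V1 R) : system_solution T v eta U ->
  {within itv0 T, continuous W} ->
  {within itv0 T, continuous (fun t => V1comp (W t) (D_inv (eta t)))}.
Proof.
move=> /curve_of_solution[_ hx] /contwP cW; apply/contwP => t Tt e e0.
have [d d0 hd] := comp_inv_cont (eta t) (W t) e0.
have [d1 d10 h1] := cW t Tt _ d0.
have [d2 d20 h2] := tderiv_cont_at (hx t Tt).2 d0.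
exists (Num.min d1 d2); first by rewrite lt_min d10.
move=> s Ts; rewrite lt_min => /andP[s1 s2]; apply: hd.
  have h := h2 s Ts s2.
  exact: (le_trans (norm_fst ((D_chart (eta s), U s) - (D_chart (eta t), U t))) h).
exact: h1.
Qed.

Lemma solution_cont T v eta U : system_solution T v eta U ->
  {within itv0 T, continuous U}.
Proof.
move=> /curve_of_solution[_ hx]; apply/contwP => t Tt e e0.
have [d2 d20 h2] := tderiv_cont_at (hx t Tt).2 e0.
exists d2 => // s Ts s2; have h := h2 s Ts s2.
exact: (le_trans (norm_snd ((D_chart (eta s), U s) - (D_chart (eta t), U t))) h).
Qed.

Lemma solution_force_cont T v eta U : system_solution T v eta U ->
  {within itv0 T, continuous (fun t => force (D_chart (eta t), U t))}.
Proof.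
move=> /curve_of_solution[_ hx]; apply/contwP => t Tt e e0.
have [d d0 hd] := force_cont (hx t Tt).1 e0.
have d20 : 0 < d / 2 by rewrite divr_gt0.
have [d2 d2_0 h2] := tderiv_cont_at (hx t Tt).2 d20.
exists d2 => // s Ts s2; apply: hd; apply: (le_lt_trans (h2 s Ts s2)).
by rewrite ltr_pdivrMr// ltr_pMr// ltr1n.
Qed.

(** In [u s (eta s x) = U s x] the velocity of the moving point is [u] itself, so that
  [u_t + u u_x] is the time derivative of [U], transported by the inverse of [eta].
  The derivative in time at fixed [y] is taken at the particle that is in [y] at time
  [t]. *)
Lemma eulerian_of_lagrangian T v eta U : (0 < T)%E -> system_solution T v eta U ->
  let u t := V1comp (U t) (D_inv (eta t)) in
  [/\ {within itv0 T, continuous u}, CH_solution T v (fun t => u t) &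
      corresponds T u eta U].
Proof.
move=> T0 sol u.
have uE t y : u t y = U t (D_inv (eta t) y) by rewrite /u V1comp_inv.
have uU t x : u t (eta t x) = U t x by rewrite uE D_Kinv.
have cu : {within itv0 T, continuous u} by exact: eulerian_cont sol (solution_cont sol).
have [x0 hx] := curve_of_solution sol.
pose G t := force (D_chart (eta t), U t).
pose W t := V1comp (G t) (D_inv (eta t)).
have cW : {within itv0 T, continuous W}.
  exact: eulerian_cont sol (solution_force_cont sol).
have dchart t : itv0 T t -> tderiv (itv0 T) (fun s => D_chart (eta s)) t (U t).
  move=> Tt; have [_ h] := hx t Tt.
  exact: (@tderiv_contract R (V1 R * V1 R)%type (V1 R) _ _ t _ fst (fun a u v => erefl)
    (@norm_fst R (V1 R) (V1 R)) h).
have dU t : itv0 T t -> tderiv (itv0 T) U t (G t).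
  move=> Tt; have [_ h] := hx t Tt.
  exact: (@tderiv_contract R (V1 R * V1 R)%type (V1 R) _ _ t _ snd (fun a u v => erefl)
    (@norm_snd R (V1 R) (V1 R)) h).
have deta t x : itv0 T t -> tderiv (itv0 T) (fun s => eta s x) t (U t x).
  move=> Tt e e0; have [d d0 hd] := tderiv_eval x (dchart t Tt) e0.
  exists d => // s Ts st; have := hd s Ts st.
  rewrite -[V1_fun (D_chart (eta s)) x]/(eta s x - x).
  rewrite -[V1_fun (D_chart (eta t)) x]/(eta t x - x).
  by rewrite (_ : eta s x - x - (eta t x - x) = eta s x - eta t x)//; ring.
have [dU' [_ hdU' eta0 U0]] := sol.
split => //.
- exists (fun t y => W t y - u t y * derive1 (u t) y), (fun t => derive1 (u t)).
  split.
  + split.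
    * move=> t y Tt; apply/is_derive_withinP.
      pose x := D_inv (eta t) y.
      have ex : eta t x = y by rewrite /x D_invK.
      have [k [kE kl]] := @slope_cont R (itv0 T) u (fun s => eta s x) t
        (fun e e0 => (contwP _ _).1 cu t Tt e e0) (tderiv_cont_at (deta t x Tt)).
      have -> : W t y - u t y * derive1 (u t) y = - derive1 (u t) (eta t x) * U t x + G t x.
        by rewrite ex /W V1comp_inv uE/= -/x; ring.
      apply: (@tderiv_comb R (itv0 T) _ (fun s => eta s x) (fun s => U s x) (fun s => - k s)).
      - exact: deta.
      - exact: tderiv_eval (dU t Tt).
      - move=> e /kl[d d0 hd]; exists d => // s Ts st.
        by rewrite -opprD normrN; exact: hd.
      - move=> s Ts; rewrite mulNr -kE -ex !uU.
        by ring.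
    * by move=> t y Tt; exact: V1_hderiv.
    * have c1 := V1_joint cW; have c2 := V1_joint cu; have c3 := V1_joint' cu.
      move=> p; apply: (@continuousB _ _ (subspace (itv0 T `*` setT)) (fun p => W p.1 p.2)
        (fun p => u p.1 p.2 * derive1 (u p.1) p.2)); first exact: c1.
      by apply: continuousM; [exact: c2|exact: c3].
    * exact: V1_joint'.
  + move=> t y Tt; rewrite subrK /W V1comp_inv/= /G force_Lconj.
    rewrite -[LHS]/(- Lop (source (eta t) (U t) \o D_inv (eta t)) (eta t (D_inv (eta t) y))).
    rewrite D_invK; congr (- Lop _ y); apply/funext => z /=.
    rewrite uE /source; congr (_ + _).
    have -> : derive1 (u t) z = derive1 (U t) (D_inv (eta t) z) * (derive1 (eta t) (D_inv (eta t) z))^-1.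
      have := hderiv_comp (V1_hderiv (U t)) (D_inv_deriv (eta t)).
      rewrite (_ : (fun x => _) = u t) => [d|]; first by rewrite (hderiv1E d).
      by apply/funext => w; rewrite uE.
    have [a [b B]] := D_bilip (eta t); have [a0 _ _ ge _] := B.
    field; rewrite gt_eqF//; exact: lt_le_trans a0 (ge _).
  + apply/funext => y; rewrite uE U0; congr (v _).
    by rewrite -[RHS](D_invK (eta 0)) eta0.
- split => //.
  + by move=> t x Tt; rewrite uU; apply/is_derive_withinP; exact: deta.
  + by move=> t Tt; apply/funext => x; rewrite /= uU.
  + by move=> t Tt; apply/funext => x; rewrite uE.
Qed.

End eulerian.

(** * Trajectories of a time-dependent velocity *)

Section curves.
Variables (R : realType) (W : normedModType R).
Implicit Types (g : R -> W) (S : R).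

Lemma curve_bounded g S : 0 <= S -> (forall t, seg 0 S t -> cont_at (seg 0 S) g t) ->
  exists2 M, 0 <= M & forall t, seg 0 S t -> `|g t| <= M.
Proof.
move=> S0 cg.
have [d d0 hd] : exists2 d, 0 < d & forall t, seg 0 S t -> `|g t| * d <= 1.
  apply: seg_uniform => // [d d' x dd h|t St].
    by apply: le_trans h; rewrite ler_wpM2l.
  have [d d0 hd] := cg t St 1 ltr01.
  have K0 : 0 < `|g t| + 1 by rewrite ltr_wpDl.
  exists (Num.min d (`|g t| + 1)^-1); first by rewrite lt_min d0 invr_gt0.
  move=> s Ss; rewrite lt_min => /andP[/(hd s Ss) h _].
  have m0 : 0 <= Num.min d (`|g t| + 1)^-1 by rewrite le_min (ltW d0) invr_ge0 ltW.
  apply: (@le_trans _ _ ((`|g t| + 1) * (`|g t| + 1)^-1)); last by rewrite mulfV// gt_eqF.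
  apply: ler_pM => //; last by rewrite ge_min lexx orbT.
  by have := ler_normD (g s - g t) (g t); rewrite subrK addrC => /le_trans; apply; rewrite lerD2l.
exists d^-1; first by rewrite invr_ge0 ltW.
by move=> t St; rewrite -[d^-1]mul1r ler_pdivlMr//; exact: hd.
Qed.

(** A differential equation whose right-hand side does not depend on the unknown. *)
Lemma curve_primitive g S p : geo_complete W -> 0 <= S ->
  (forall t, seg 0 S t -> cont_at (seg 0 S) g t) ->
  exists2 P, P 0 = p & forall t, seg 0 S t -> tderiv (seg 0 S) P t (g t).
Proof.
move=> cW S0 cg; have [M M0 hM] := curve_bounded S0 cg.
have [||||x [x0 _ hx]] := @ode_exists R W p 0 S M 0 setT (fun t _ => g t) cW S0 M0 (lexx 0).
- by [].
- by move=> t y St _; exact: hM.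
- by move=> t y z _ _ _; rewrite subrr normr0 mul0r.
- move=> t e St e0; have [d d0 hd] := cg t St e e0.
  by exists d => // s Ss st y _; exact: hd.
- by exists x.
Qed.

End curves.

Lemma tderivZ (R : realType) (A : set R) (f : R -> R) t (a l : R) :
  tderiv A f t l -> tderiv A (fun s => a * f s) t (a * l).
Proof.
move=> hf; rewrite -[a * l]addr0.
apply: (@tderiv_comb R A _ f (fun=> 0) (fun=> a)) => //; first exact: tderiv_cst.
  by move=> e e0; exists 1 => // s _ _; rewrite subrr normr0 ltW.
by move=> s _; rewrite subrr addr0 mulrBr.
Qed.

Lemma tderiv_exp (R : realType) (A : set R) (f : R -> R) t (l : R) :
  tderiv A f t l -> tderiv A (fun s => expR (f s)) t (expR (f t) * l).
Proof.
move=> hf.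
have dexp : hderiv (@expR R) (@expR R) by move=> x; exact: is_derive_expR.
have : forall s, exists c, `|c - f t| <= `|f s - f t| /\
    expR (f s) - expR (f t) = expR c * (f s - f t).
  by move=> s; have [c h1 h2] := mvt_near dexp (f t) (f s); exists c.
move=> /choice[c hc].
rewrite -[_ * l]addr0.
apply: (@tderiv_comb R A _ f (fun=> 0) (fun s => expR (c s))) => //.
- exact: tderiv_cst.
- move=> e e0.
  have [r r0 hr] := (contP _).1 (@continuous_expR R) (f t) e e0.
  have r20 : 0 < r / 2 by rewrite divr_gt0.
  have [d d0 hd] := tderiv_cont_at hf r20.
  exists d => // s As st; apply: hr; have [h _] := hc s.
  have k := hd s As st; apply: (le_lt_trans h); apply: (le_lt_trans k).
  by rewrite ltr_pdivrMr// ltr_pMr// ltr1n.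
- by move=> s As; rewrite subrr addr0; have [_ ->] := hc s.
Qed.

Section scalar_flow.
Variables (R : realType) (S : R) (u : R -> V1 R).
Hypothesis S0 : 0 <= S.
Hypothesis cu : forall t, seg 0 S t -> cont_at (seg 0 S) u t.
Local Notation A := (seg 0 S).
Implicit Types (t s x y e : R).

Definition is_flow (eta : R -> R -> R) := (forall x, eta 0 x = x) /\
  forall t x, A t -> tderiv A (fun s => eta s x) t (u t (eta t x)).

Lemma A0S : A 0. Proof. by rewrite /seg/= lexx S0. Qed.

Lemma V1_lip (v : V1 R) x y : `|v y - v x| <= `|v| * `|y - x|.
Proof. by apply: mvt_norm (V1_hderiv v) _ => z; exact: V1_le'. Qed.

Lemma flow_exists : exists eta, is_flow eta.
Proof.
have [M M0 hM] := curve_bounded S0 cu.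
have : forall x, exists y : R -> R, y 0 = x /\ forall t, A t -> tderiv A y t (u t (y t)).
  move=> x.
  have [||||y [y0 _ hy]] := @ode_exists R R x 0 S M M setT (fun t y => u t y)
    (@R_geo_complete R) S0 M0 M0.
  - by [].
  - by move=> t y At _; exact: le_trans (V1_le _ _) (hM t At).
  - move=> t y z At _ _; apply: (le_trans (V1_lip _ _ _)).
    by rewrite ler_wpM2r// hM.
  - move=> t e At e0; have [d d0 hd] := cu At e0.
    exists d => // s As st y _.
    exact: le_trans (V1_le (u s - u t) y) (hd s As st).
  - by exists y.
move=> /choice[eta heta]; exists (fun t x => eta x t); split=> [x|t x At].
  by have [] := heta x.
by have [_ /(_ t At)] := heta x.
Qed.

Lemma flow_sub eta t' : is_flow eta -> A t' ->
  forall t x, seg 0 t' t -> tderiv (seg 0 t') (fun s => eta s x) t (u t (eta t x)).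
Proof.
move=> [_ h] /andP[t'0 t'S].
have sub : seg 0 t' `<=` A.
  by move=> s /andP[s0 st]; rewrite /seg/= s0 (le_trans st).
by move=> t x /sub At; apply: tderiv_sub sub (h t x At).
Qed.

(** Gronwall's inequality for two trajectories, which move apart at most at the exponential
  rate [M]. *)
Lemma flow_lip (M : R) eta xi : 0 <= M -> (forall t, A t -> `|u t| <= M) ->
  is_flow eta -> is_flow xi -> forall t x y, A t ->
  `|eta t y - xi t x| <= `|y - x| * expR (M * S).
Proof.
move=> M0 hM [eta0 heta] [xi0 hxi] t x y /andP[t0 tS].
have := @gronwall_exact R R (fun t => eta t y - xi t x) 0 S M 0 `|y - x| M0 (lexx 0).
rewrite eta0 xi0 => /(_ (lexx _)) G; have {}G := G _ t t0 tS.
apply: (le_trans (G _)).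
  move=> s s0 sS; have As : A s by rewrite /seg/= s0.
  exists (u s (eta s y) - u s (xi s x)).
    rewrite addr0; apply: (le_trans (V1_lip _ _ _)).
    by rewrite ler_wpM2r// hM.
  by apply: tderivB; [exact: heta|exact: hxi].
rewrite mul0r addr0 subr0 ler_wpM2l// ler_expR ler_wpM2l//.
Qed.

Lemma flow_unique eta xi : is_flow eta -> is_flow xi ->
  forall t x, A t -> eta t x = xi t x.
Proof.
move=> heta hxi t x At; have [M M0 hM] := curve_bounded S0 cu.
apply/eqP; rewrite -subr_eq0 -normr_le0.
by rewrite (le_trans (flow_lip M0 hM heta hxi x x At))// subrr normr0 mul0r.
Qed.

Variable eta : R -> R -> R.
Hypothesis flow : is_flow eta.

Let eta_cont x t : A t -> cont_at A (fun s => eta s x) t.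
Proof. by move=> At; have [_ /(_ t x At)/tderiv_cont_at] := flow. Qed.

(** Each [u t] has a continuous slope that vanishes at infinity; compactness in time
  makes the modulus of continuity uniform. *)
Let equi e : 0 < e -> exists2 d, 0 < d & forall t, A t ->
  forall x y, `|y - x| <= d -> `|derive1 (u t) y - derive1 (u t) x| <= e.
Proof.
move=> e0; apply: seg_uniform => // [d d' t dd h x y yx|t At].
  by apply: h; exact: le_trans dd.
have e30 : 0 < e / 3 by rewrite divr_gt0.
have [r r0 hr] := vanish_unif_cont (@V1_derive_cont R (u t))
  (let: And3 _ _ v := V1_G2' (u t) in v) e30.
have [d d0 hd] := cu At e30.
exists (Num.min r d); first by rewrite lt_min r0.
move=> s As; rewrite lt_min => /andP[_ sd] x y; rewrite le_min => /andP[yr _].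
have k z : `|derive1 (u s) z - derive1 (u t) z| <= e / 3.
  exact: le_trans (V1_dist_le _ _ _) (hd s As sd).
rewrite (_ : _ - _ = (derive1 (u t) y - derive1 (u t) x) +
  ((derive1 (u s) y - derive1 (u t) y) - (derive1 (u s) x - derive1 (u t) x))); last by ring.
rewrite (_ : e = e / 3 + (e / 3 + e / 3)); last by field.
apply: (le_trans (ler_normD _ _)); apply: lerD; first exact: hr.
by apply: (le_trans (ler_normB _ _)); apply: lerD; exact: k.
Qed.

(** Differentiating the equation [eta_t = u(t, eta)] in [x] formally gives the space
  derivative [E], the exponential of the integral of the slopes along the trajectory.
  Gronwall's inequality for [eta t y - eta t x - (y - x) E t x] shows that it is the
  derivative; the bounds for [E] make [eta t] a diffeomorphism. *)
Lemma flow_diffeo : exists (M : R) (E : R -> R -> R), [/\ 0 <= M,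
  (forall t, A t -> `|u t| <= M),
  (forall t, A t -> bilip (expR (- (M * S))) (expR (M * S)) (eta t) (E t)) &
  (forall t s x, A t -> A s -> `|E s x - E t x| <= expR (M * S) * M * `|s - t|)].
Proof.
have S0' := S0.
have [M M0 hM] := curve_bounded S0 cu.
have : forall x, exists I : R -> R, I 0 = 0 /\
    forall t, A t -> tderiv A I t (derive1 (u t) (eta t x)).
  move=> x; have [I I0 hI] := @curve_primitive R R (fun s => derive1 (u s) (eta s x)) S 0
    (@R_geo_complete R) S0 (fun t At => slope_along (cu At) (eta_cont x At)).
  by exists I.
move=> /choice[I hI]; pose E t x := expR (I x t).
have [eta0 heta] := flow.
have slope_le t x : A t -> `|derive1 (u t) x| <= M.
  by move=> At; exact: le_trans (V1_le' _ _) (hM t At).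
have Ilip x t s : A t -> A s -> `|I x s - I x t| <= M * `|s - t|.
  move=> At As; have [_ dI] := hI x.
  apply: (@tderiv_lip _ _ (I x) _ S M M0 dI) => // z Az; exact: slope_le.
have Ib x t : A t -> `|I x t| <= M * S.
  move=> At; have [I0 _] := hI x; have := Ilip x 0 t A0S At.
  rewrite I0 !subr0 => /le_trans; apply; rewrite ler_wpM2l//.
  by case/andP: At => t0 tS; rewrite ger0_norm.
have Eb t x : A t -> expR (- (M * S)) <= E t x <= expR (M * S).
  by move=> /(Ib x); rewrite ler_norml !ler_expR.
have Ed t s x y : A t -> A s -> `|E s y - E t x| <= expR (M * S) * `|I y s - I x t|.
  move=> At As; have [h _] := @exp_taylor R (M * S) (I x t) (I y s)
    (le_trans (ler_norm _) (Ib x t At)) (le_trans (ler_norm _) (Ib y s As)).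
  exact: h.
have P0 : 0 < expR (M * S) by exact: expR_gt0.
exists M, E; split => //; last first.
  move=> t s x At As; rewrite -mulrA; apply: (le_trans (Ed _ _ _ _ At As)).
  by rewrite ler_wpM2l ?(ltW P0)// Ilip.
pose P := expR (M * S); rewrite -/P in P0 Ed.
have traj s x y : A s -> `|eta s y - eta s x| <= `|y - x| * P.
  by move=> As; exact: flow_lip M0 hM flow flow _ _ _ As.
have near d x y s : A s -> `|y - x| < d / P -> `|eta s y - eta s x| <= d.
  move=> As yx; apply: (le_trans (traj s x y As)).
  by rewrite -ler_pdivlMr// ltW.
move=> t At; have /andP[t0 tS] := At; split.
- exact: expR_gt0.
- move=> x; apply/hderivP => e e0.
  pose K := P * S * P + 1.
  have K0 : 0 < K by rewrite ltr_wpDl// !mulr_ge0// ltW.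
  have [d d0 hd] := equi (divr_gt0 e0 K0).
  exists (d / P); first by rewrite divr_gt0.
  move=> y yx.
  have E0 : E 0 x = 1 by rewrite /E; have [-> _] := hI x; rewrite expR0.
  pose k := e / K * (`|y - x| * P).
  have k0 : 0 <= k by rewrite !mulr_ge0 ?invr_ge0// ltW.
  have := @gronwall_exact R R (fun s => eta s y - eta s x - (y - x) * E s x) 0 S M k 0 M0 k0.
  rewrite !eta0 E0 mulr1 subrr normr0 => /(_ (lexx _)) G.
  apply: (le_trans (G _ t t0 tS)).
    move=> s s0 sS; have As : A s by rewrite /seg/= s0.
    exists (u s (eta s y) - u s (eta s x) -
        (y - x) * (E s x * derive1 (u s) (eta s x))).
      have [c cz cE] := mvt_near (V1_hderiv (u s)) (eta s x) (eta s y).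
      rewrite cE.
      set w := eta s y - eta s x.
      rewrite (_ : derive1 (u s) c * w - _ = derive1 (u s) (eta s x) * (w - (y - x) * E s x) +
        (derive1 (u s) c - derive1 (u s) (eta s x)) * w); last by ring.
      rewrite (le_trans (ler_normD _ _))// lerD//.
        by rewrite normrM ler_wpM2r// slope_le.
      rewrite normrM /k; apply: ler_pM => //; last exact: traj.
      by apply: hd => //; apply: (le_trans cz); exact: near.
    apply: tderivB; first by apply: tderivB; exact: heta.
    by apply: tderivZ; apply: tderiv_exp; have [_ /(_ s As)] := hI x.
  rewrite add0r subr0.
  apply: (@le_trans _ _ (k * S * P)).
    apply: ler_pM; [exact: mulr_ge0|exact: expR_ge0|by rewrite ler_wpM2l|].
    by rewrite /P ler_expR ler_wpM2l.
  rewrite /k (_ : e / K * (`|y - x| * P) * S * P = e * `|y - x| * ((P * S * P) / K)); last by ring.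
  by rewrite ler_piMr ?mulr_ge0 ?(ltW e0)// ler_pdivrMr// mul1r /K lerDl.
- apply/contP => x e e0.
  pose K := P * S + 1.
  have K0 : 0 < K by rewrite ltr_wpDl// !mulr_ge0// ltW.
  have e'0 := divr_gt0 e0 K0.
  have [d d0 hd] := equi e'0.
  exists (d / P); first by rewrite divr_gt0.
  move=> y yx; apply: (le_trans (Ed _ _ _ _ At At)).
  have := @gronwall_exact R R (fun s => I y s - I x s) 0 S 0 (e / K) 0 (lexx _) (ltW e'0).
  have [Ix0 dIx] := hI x; have [Iy0 dIy] := hI y.
  rewrite Ix0 Iy0 subrr normr0 => /(_ (lexx _)) G.
  apply: (@le_trans _ _ (P * (e / K * S))).
    rewrite ler_wpM2l ?(ltW P0)//; apply: (le_trans (G _ t t0 tS)).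
      move=> s s0 sS; have As : A s by rewrite /seg/= s0.
      exists (derive1 (u s) (eta s y) - derive1 (u s) (eta s x)).
        by rewrite mul0r add0r; apply: hd => //; exact: near.
      by apply: tderivB; [exact: dIy|exact: dIx].
    by rewrite mul0r expR0 mulr1 add0r subr0 ler_wpM2l ?(ltW e'0).
  rewrite (_ : P * (e / K * S) = e * ((P * S) / K)); last by ring.
  by rewrite ler_piMr ?(ltW e0)// ler_pdivrMr// mul1r /K lerDl.
- by move=> x; have /andP[] := Eb t x At.
- by move=> x; have /andP[] := Eb t x At.
Qed.

End scalar_flow.

(** * From Eulerian to Lagrangian variables *)

Section lagrangian.
Variables (R : realType).
Implicit Types (S t s x y e : R) (u : R -> V1 R) (T : \bar R).

(** The flow and its space derivative are Lipschitz in time, uniformly in [x]. *)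
Lemma comp_flow_cont S u eta : 0 <= S -> (forall t, seg 0 S t -> cont_at (seg 0 S) u t) ->
  is_flow S u eta ->
  (forall t, seg 0 S t -> exists a b E, bilip a b (eta t) E) /\
  forall t, seg 0 S t -> cont_at (seg 0 S) (fun s => V1comp (u s) (eta s)) t.
Proof.
move=> S0 cu flow.
have [M [E [M0 hM B EL]]] := flow_diffeo S0 cu flow.
split; first by move=> t St; do 3 eexists; exact: B.
move=> t St e e0.
have [d d0 hd] := V1comp_joint (u t) (B t St) e0.
have [d1 d10 h1] := cu t St d d0.
have K0 : 0 < expR (M * S) * M + M + 1.
  by rewrite ltr_wpDl// addr_ge0// mulr_ge0// expR_ge0.
exists (Num.min d1 (d / (expR (M * S) * M + M + 1))); first by rewrite lt_min d10 divr_gt0.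
move=> s Ss; rewrite lt_min => /andP[s1 s2].
have [_ ds cds _ _] := B s Ss.
have s3 : (expR (M * S) * M + M + 1) * `|s - t| <= d.
  by rewrite mulrC -ler_pdivlMr// ltW.
have n0 := normr_ge0 (s - t).
have [eta0 heta] := flow.
have eL x : `|eta s x - eta t x| <= M * `|s - t|.
  apply: (tderiv_lip M0 (fun z Sz => heta z x Sz)) => // z Sz.
  exact: le_trans (V1_le _ _) (hM z Sz).
have K1 : 0 <= expR (M * S) * M by rewrite mulr_ge0 ?expR_ge0.
have [] // := hd (u s) (eta s) (E s) ds cds.
- move=> x; apply: (le_trans (eL x)); apply: le_trans s3; rewrite ler_wpM2r//.
  by rewrite -addrA addrCA lerDl addr_ge0.
- move=> x; apply: (le_trans (EL t s x St Ss)); apply: le_trans s3; rewrite ler_wpM2r//.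
  by rewrite -addrA lerDl addr_ge0.
- exact: h1.
Qed.

(** The displacement [eta - Id] is the primitive of [u o eta] as a curve in V1: the two
  agree pointwise. This is what puts it in V1 and makes it a C^1 curve there. *)
Lemma flow_chart S u eta : 0 <= S -> (forall t, seg 0 S t -> cont_at (seg 0 S) u t) ->
  is_flow S u eta -> exists P : R -> V1 R, forall t, seg 0 S t ->
  [/\ D_chart_domain (P t), (forall x, P t x = eta t x - x) &
      tderiv (seg 0 S) P t (V1comp (u t) (eta t))].
Proof.
move=> S0 cu flow; have [B cU] := comp_flow_cont S0 cu flow.
have [eta0 heta] := flow.
have [P P0 hP] := curve_primitive 0 (@V1_geo_complete R) S0 cU.
have PE t x : seg 0 S t -> P t x = eta t x - x.
  move=> /andP[t0 tS].
  apply: (@tderiv_unique _ _ (fun t => P t x) (fun t => eta t x - x) 0 S _ _ t t0 tS).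
    by rewrite P0 eta0 subrr.
  move=> s s0 sS; have Ss : seg 0 S s by rewrite /seg/= s0.
  exists (u s (eta s x)).
    have := tderiv_eval x (hP s Ss).
    by have [a [b [E hB]]] := B s Ss; have [-> _] := V1comp_bound (u s) hB.
  by rewrite -[X in tderiv _ _ _ X]subr0; apply: tderivB; [exact: heta|exact: tderiv_cst].
exists P => t St; split; [|by move=> x; exact: PE|exact: hP].
have [a [b [E hB]]] := B t St; have [a0 dE _ ge _] := hB.
apply: (dom_intro a0) => x.
have -> : derive1 (P t) = fun x => E x - 1.
  apply: hderiv1E; apply: hderiv_eq2 (hderivB dE (@hderiv_id R)) _ => z /=.
  by rewrite PE.
by have := ge x; lra.
Qed.

(** By uniqueness, the flows on two segments agree where both are defined. *)
Lemma flow_glue T u : {within itv0 T, continuous u} ->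
  exists eta, forall S, itv0 T S -> is_flow S u eta.
Proof.
move=> /contwP cu.
have cS S : itv0 T S -> forall t, seg 0 S t -> cont_at (seg 0 S) u t.
  move=> TS t St e e0; have [d d0 hd] := cu t (itv0_seg TS St) e e0.
  by exists d => // s Ss; apply: hd; exact: itv0_seg TS _ Ss.
have : forall S, exists eta, itv0 T S -> is_flow S u eta.
  move=> S; have [TS|nTS] := pselect (itv0 T S); last by exists (fun _ x => x).
  have [S0 _] := TS; have [eta heta] := flow_exists S0 (cS S TS).
  by exists eta.
move=> /choice[Y hY]; exists (fun t x => Y t t x) => S TS.
have [S0 _] := TS; have [Y0 HY] := hY S TS.
have E t x : seg 0 S t -> Y S t x = Y t t x.
  move=> St; have Tt := itv0_seg TS St; have [t0 _] := Tt.
  apply: (flow_unique t0 (cS t Tt) _ (hY t Tt)); last by rewrite /seg/= t0 lexx.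
  split=> // s z ts.
  exact: (flow_sub (hY S TS) St z ts).
split.
  move=> x; have S00 : seg 0 S 0 by rewrite /seg/= lexx.
  by rewrite -E.
move=> t x St; rewrite -E//; apply: tderiv_ext (HY t x St) => // s Ss.
exact: E.
Qed.

(** The equation for [u] only gives the derivative in time of [U = u o eta] at each [x].
  That [U] is a C^1 curve in V1 follows as in [flow_chart]: by [force_Lconj] this
  derivative is the value of the force, a continuous curve in V1, so that [U] agrees
  pointwise with a primitive in V1. *)
Lemma lagrangian_of_eulerian T (u0 : V1 R) u : (0 < T)%E -> {within itv0 T, continuous u} ->
  CH_solution T u0 (fun t => u t) ->
  exists (eta : R -> D R) (U : R -> V1 R),
    system_solution T u0 eta U /\ corresponds T u eta U.
Proof.
move=> T0 cuT [ut [ux [[hut hux _ _] CH u00]]].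
have cu := (contwP _ _).1 cuT.
have cS S : itv0 T S -> forall t, seg 0 S t -> cont_at (seg 0 S) u t.
  move=> TS t St e e0; have [d d0 hd] := cu t (itv0_seg TS St) e e0.
  by exists d => // s Ss; apply: hd; exact: itv0_seg TS _ Ss.
have uxE t : itv0 T t -> ux t = derive1 (u t).
  by move=> Tt; rewrite (@hderiv1E R (u t) (ux t))// => x; exact: hux.
have [eta heta] := flow_glue cuT.
have : forall t, exists xi : D R, itv0 T t -> xi = eta t :> (R -> R).
  move=> t; have [Tt|nTt] := pselect (itv0 T t); last first.
    by have [xi _] := D_of_dom (@dom0 R); exists xi.
  have [t0 _] := Tt; have tt : seg 0 t t by rewrite /seg/= t0 lexx.
  have [P hP] := flow_chart t0 (cS t Tt) (heta t Tt).
  have [dP PE _] := hP t tt; have [xi xiE] := D_of_dom dP.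
  exists xi => _; apply/funext => x.
  have := congr1 (fun v : V1 R => v x) xiE; rewrite PE /=.
  by move=> /addIr.
move=> /choice[xi xiE].
pose U t := V1comp (u t) (eta t).
have UE t x : itv0 T t -> U t x = u t (eta t x).
  move=> Tt; have [t0 _] := Tt; have tt : seg 0 t t by rewrite /seg/= t0 lexx.
  have [B _] := comp_flow_cont t0 (cS t Tt) (heta t Tt).
  have [a [b [E hB]]] := B t tt.
  by rewrite /U; have [-> _] := V1comp_bound (u t) hB.
have dchart S t : itv0 T S -> seg 0 S t ->
    tderiv (seg 0 S) (fun s => D_chart (xi s)) t (U t).
  move=> TS St; have [S0 _] := TS.
  have [P hP] := flow_chart S0 (cS S TS) (heta S TS).
  have [_ _ h] := hP t St; apply: tderiv_ext h => // s Ss.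
  have [_ PE _] := hP s Ss; apply: V1_eq => x; rewrite PE.
  by rewrite -[RHS]/(xi s x - x) xiE//; exact: itv0_seg TS _ Ss.
pose G t := force (D_chart (xi t), U t).
(* at each [x] the time derivative of [u s (eta s x)] is [u_t + u u_x] *)
have dUx S t x : itv0 T S -> seg 0 S t -> tderiv (seg 0 S) (fun s => U s x) t (G t x).
  move=> TS St; have Tt := itv0_seg TS St.
  have [_ hS] := heta S TS.
  have [k [kE kl]] := slope_cont (cS S TS t St) (tderiv_cont_at (hS t x St)).
  have GE : G t x = derive1 (u t) (eta t x) * u t (eta t x) + ut t (eta t x).
    have CHt := CH t (eta t x) Tt; rewrite (uxE t Tt) in CHt.
    have SE : source (xi t) (U t) \o D_inv (xi t) =
        (fun y => u t y ^+ 2 + 2^-1 * derive1 (u t) y ^+ 2).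
      apply/funext => y /=; rewrite /source.
      have xy : eta t (D_inv (xi t) y) = y by rewrite -(xiE t Tt) D_invK.
      rewrite (UE _ _ Tt) xy; congr (_ + _).
      have [a [b B]] := D_bilip (xi t); have [a0 dxi _ ge _] := B.
      have -> : derive1 (U t) = fun z => derive1 (u t) (xi t z) * derive1 (xi t) z.
        apply: hderiv1E; apply: hderiv_eq2 (hderiv_comp (V1_hderiv (u t)) dxi) _ => z /=.
        by rewrite (UE _ _ Tt) xiE.
      rewrite D_invK; field; rewrite gt_eqF//; exact: lt_le_trans a0 (ge _).
    have GL : G t x = - Lop (fun y => u t y ^+ 2 + 2^-1 * derive1 (u t) y ^+ 2) (eta t x).
      rewrite /G force_Lconj -SE -(xiE t Tt); exact: erefl.
    rewrite GL -CHt; ring.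
  rewrite GE.
  apply: (@tderiv_comb R _ _ (fun s => eta s x) (fun s => u s (eta t x)) k) => //.
  - exact: hS.
  - have /is_derive_withinP h := hut t (eta t x) Tt.
    exact: tderiv_sub (itv0_seg TS) h.
  - move=> s Ss; rewrite -kE !UE//; last exact: itv0_seg TS _ Ss.
    by ring.
have cG S t : itv0 T S -> seg 0 S t -> cont_at (seg 0 S) G t.
  move=> TS St e e0; have [S0 _] := TS.
  have [d d0 hd] := force_cont (chart_dom (xi t) : D_chart_domain (D_chart (xi t), U t).1) e0.
  have d20 : 0 < d / 2 by rewrite divr_gt0.
  have dd : d / 2 < d by rewrite ltr_pdivrMr// ltr_pMr// ltr1n.
  have [d1 d10 h1] := tderiv_cont_at (dchart S t TS St) d20.
  have [_ cU] := comp_flow_cont S0 (cS S TS) (heta S TS).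
  have [d2 d2_0 h2] := cU t St _ d20.
  exists (Num.min d1 d2); first by rewrite lt_min d10.
  move=> s Ss; rewrite lt_min => /andP[s1 s2]; apply: hd.
  apply: le_lt_trans dd; apply: norm_pair_le => /=.
    exact: h1 s Ss s1.
  exact: h2 s Ss s2.
have U0 : U 0 = u0.
  apply: V1_eq => x; have T00 := itv0_0 T0.
  by rewrite UE//; have [-> _] := heta 0 T00; rewrite -u00.
have dU S t : itv0 T S -> seg 0 S t -> tderiv (seg 0 S) U t (G t).
  move=> TS St; have [S0 _] := TS.
  have [Q Q0 hQ] := curve_primitive u0 (@V1_geo_complete R) S0 (fun t => cG S t TS).
  apply: tderiv_ext (hQ t St) => // s /andP[s0 sS].
  apply: V1_eq => x.
  apply: (@tderiv_unique _ _ (fun s => Q s x) (fun s => U s x) 0 S _ _ s s0 sS).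
    by rewrite Q0 U0.
  move=> z z0 zS; have Sz : seg 0 S z by rewrite /seg/= z0.
  by exists (G z x); [exact: tderiv_eval (hQ z Sz)|exact: dUx].
have curve : flow_curve (itv0 T) u0 (fun t => (D_chart (xi t), U t)).
  split.
    congr pair => //; apply: V1_eq => x; have T00 := itv0_0 T0.
    rewrite -[LHS]/(xi 0 x - x) xiE//; have [-> _] := heta 0 T00.
    by rewrite subrr.
  move=> t Tt; split; first exact: chart_dom.
  apply: tderiv_itv0 => // S TS tS.
  have St : seg 0 S t by case: Tt => t0 _; rewrite /seg/= t0.
  exact: tderiv_pair (dchart S t TS St) (dU S t TS St).
have [eta' [U' [sol E]]] := solution_of_curve T0 curve.
have EU t : itv0 T t -> U' t = U t by move=> Tt; exact: (congr1 snd (E t Tt)).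
have Eeta t : itv0 T t -> eta' t = eta t :> (R -> R).
  move=> Tt; rewrite -xiE//; apply: chart_inj.
  exact: (congr1 fst (E t Tt)).
exists eta', U'; split => //; split.
- move=> t x Tt; apply/is_derive_withinP.
  rewrite Eeta//; apply: (@tderiv_ext _ _ _ (fun s => eta s x)) => //.
    by move=> s Ts; rewrite Eeta.
  apply: tderiv_itv0 => // S TS tS.
  have St : seg 0 S t by case: Tt => t0 _; rewrite /seg/= t0.
  by have [_ hS] := heta S TS; exact: hS.
- by have [_ [_ _ h _]] := sol.
- move=> t Tt; rewrite EU//; apply/funext => x /=.
  by rewrite UE// Eeta.
- move=> t Tt; rewrite EU//; apply/funext => y /=.
  by rewrite UE// -(Eeta t Tt) D_invK.
Qed.

End lagrangian.

(** * Equivalence and well-posedness *)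

Lemma nbhs_dist (R : realType) (V : normedModType R) (p : V) (r : R) : 0 < r ->
  nbhs p [set q | `|q - p| < r].
Proof.
by move=> r0; apply/nbhs_ballP; exists r => // q; rewrite -ball_normE /ball_/= distrC.
Qed.

(** The time of existence is uniform near [u0] and the solutions depend on the data in
  a Lipschitz way by [local_flow]; the passage to Eulerian variables is continuous by
  [comp_inv_cont]. *)
Lemma dependence (R : realType) (u0 : V1 R) : exists2 T : R, 0 < T &
  exists2 N : set (V1 R), nbhs u0 N &
  exists (eta : V1 R -> R -> D R) (U u : V1 R -> R -> V1 R),
    (forall v0, N v0 ->
      system_solution T%:E v0 (eta v0) (U v0) /\
      (forall t, itv0 T%:E t ->
        u v0 t = U v0 t \o D_inv (eta v0 t) :> (R -> R))) /\
    (forall t, itv0 T%:E t ->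
      {within N, continuous (fun v0 => u v0 t)}).
Proof.
have [T [r [K [x [T0 r0 K0 hx hK]]]]] := local_flow u0.
pose N : set (V1 R) := [set v | `|v - u0| < r].
have Nn : nbhs u0 N.
  exact: nbhs_dist.
have : forall v, exists q : (R -> D R) * (R -> V1 R), N v ->
    system_solution T%:E v q.1 q.2 /\
    forall t, itv0 T%:E t -> (D_chart (q.1 t), q.2 t) = x v t.
  move=> v; have [Nv|nNv] := pselect (N v).
    have [eta [U [h1 h2]]] := solution_of_curve (T0 : (0 < T%:E)%E) (hx v Nv).
    by exists (eta, U).
  have [xi _] := D_of_dom (@dom0 R).
  by exists (fun=> xi, fun=> 0).
move=> /choice[q hq].
exists T => //; exists N => //.
exists (fun v => (q v).1), (fun v => (q v).2),
  (fun v t => V1comp ((q v).2 t) (D_inv ((q v).1 t))).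
split.
  move=> v /hq[sol _]; split => // t _; exact: V1comp_inv.
move=> t Tt; apply/contwP => v Nv e e0.
have [d d0 hd] := comp_inv_cont ((q v).1 t) ((q v).2 t) e0.
have K1 : 0 < K + 1 by rewrite ltr_wpDl.
exists (d / (K + 1)); first by rewrite divr_gt0.
move=> w Nw wv.
have h : `|x w t - x v t| <= d.
  apply: (le_trans (hK w v Nw Nv t Tt)).
  apply: (@le_trans _ _ ((K + 1) * `|w - v|)); first by rewrite ler_wpM2r// lerDl.
  by rewrite mulrC -ler_pdivlMr//; exact: ltW.
have [_ /(_ t Tt) Ew] := hq w Nw; have [_ /(_ t Tt) Ev] := hq v Nv.
rewrite -Ew -Ev in h.
apply: hd.
  exact: (le_trans (norm_fst ((D_chart ((q w).1 t), (q w).2 t) -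
    (D_chart ((q v).1 t), (q v).2 t))) h).
exact: (le_trans (norm_snd ((D_chart ((q w).1 t), (q w).2 t) -
    (D_chart ((q v).1 t), (q v).2 t))) h).
Qed.

Theorem theorem16 (R : realType) (u0 : V1 R) :
  (* equivalence of the two Cauchy problems *)
  (forall T : \bar R, (0 < T)%E ->
    (forall u : R -> V1 R,
      {within itv0 T, continuous u} -> CH_solution T u0 (fun t => u t) ->
      exists (eta : R -> D R) (U : R -> V1 R),
        system_solution T u0 eta U /\ corresponds T u eta U) /\
    (forall (eta : R -> D R) (U : R -> V1 R),
      system_solution T u0 eta U ->
      exists u : R -> V1 R,
        [/\ {within itv0 T, continuous u},
            CH_solution T u0 (fun t => u t) &
            corresponds T u eta U])) /\
  (* (1) *)
  (exists X : D R * V1 R -> V1 R * V1 R,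
    (forall eta U,
      (X (eta, U)).1 = U /\
      (X (eta, U)).2 = - Lconj eta (source eta U) :> (R -> R)) /\
    C1_TD X) /\
  (* (2) *)
  ((exists2 T : R, 0 < T &
      exists (eta : R -> D R) (U : R -> V1 R),
        system_solution T%:E u0 eta U) /\
   (forall T : \bar R, (0 < T)%E ->
    forall (eta eta' : R -> D R) (U U' : R -> V1 R),
      system_solution T u0 eta U -> system_solution T u0 eta' U' ->
      forall t, itv0 T t ->
        eta t = eta' t :> (R -> R) /\ U t = U' t)) /\
  (* (3) *)
  (forall T : \bar R, (0 < T)%E ->
    forall (eta : R -> D R) (U : R -> V1 R),
      system_solution T u0 eta U ->
      CH_solution T u0 (fun t => U t \o D_inv (eta t))) /\
  (* (4) *)
  (exists2 T : R, 0 < T &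
    exists2 N : set (V1 R), nbhs u0 N &
    exists (eta : V1 R -> R -> D R) (U u : V1 R -> R -> V1 R),
      (forall v0, N v0 ->
        system_solution T%:E v0 (eta v0) (U v0) /\
        (forall t, itv0 T%:E t ->
          u v0 t = U v0 t \o D_inv (eta v0 t) :> (R -> R))) /\
      (forall t, itv0 T%:E t ->
        {within N, continuous (fun v0 => u v0 t)})).
Proof.
split.
  move=> T T0; split=> [u cu CH|eta U sol]; first exact: lagrangian_of_eulerian.
  by have [c CH co] := eulerian_of_lagrangian T0 sol; eexists; split.
split; first exact: field_spec.
split.
  split.
    have [T T0 [N Nn [eta [U [u [h _]]]]]] := dependence u0.
    have [sol _] := h u0 (nbhs_singleton Nn).
    by exists T => //; exists (eta u0), (U u0).
  move=> T T0 eta eta' U U' sol sol' t Tt.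
  have E := flow_curve_unique (curve_of_solution sol) (curve_of_solution sol') Tt.
  by split; [apply: chart_inj; exact: (congr1 fst E)|exact: (congr1 snd E)].
split; last exact: dependence.
move=> T T0 eta U sol; have [_ CH _] := eulerian_of_lagrangian T0 sol.
rewrite (_ : (fun t => _) = fun t => V1comp (U t) (D_inv (eta t)) : R -> R)//.
by apply/funext => t; rewrite V1comp_inv.
Qed.
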